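(* Over $\mathsf{ACA}_0^\omega$, each of the following is equivalent to $\mathsf{HBU}$: (i) (Uniqueness) If a function $f:[0,1]\to\mathbb{R}$ is gauge integrable on $[0,1]$, then its gauge integral is unique. (ii) (Consistency) If a function $f:[0,1]\to\mathbb{R}$ is Riemann integrable on $[0,1]$, then it is gauge integrable there, and the two integrals are equal. Here $\mathsf{HBU}$ is the statement $(\forall \Psi:\mathbb{R}\to\mathbb{R}^+)(\exists \langle y_1,\dots,y_k\rangle)(\forall x\in[0,1])(\exists i\leq k)\big(x\in (y_i-\Psi(y_i),y_i+\Psi(y_i))\big)$, with $y_1,\dots,y_k$ a finite sequence of reals in $[0,1]$.
   Context: Language and base theory. Finite types: $0$ (natural numbers) is a type, and if $\sigma,\tau$ are types then so is $\sigma\to\tau$ (mappings); $1:=0\to 0$ and $n+1:=n\to 0$; $\rho^*$ is the type of finite sequences of type-$\rho$ objects (suitably coded). Superscripts on variables indicate types. $\mathsf{L}_\omega$ is the language with variables of all finite types, constants $0,1,<_0,+_0,\times_0,=_0$, the combinators and recursors. Equality $=_\tau$ and $\leq_\tau$ at type $\tau=\tau_1\to\dots\to\tau_k\to 0$ are defined pointwise from $=_0$, $\leq_0$. Quantifier-free formulas may contain variables of any type. The axiom $\mathsf{QF\text{-}AC}^{\sigma,\tau}$ is $(\forall x^\sigma)(\exists y^\tau)A(x,y)\to(\exists Y^{\sigma\to\tau})(\forall x^\sigma)A(x,Y(x))$ for all quantifier-free $A$. The (classical) system $\mathsf{RCA}_0^\omega$ consists of: the ordered semi-ring axioms for $0,1,<_0,+_0,\times_0$;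 the defining axioms of the $\Pi$ and $\Sigma$ (i.e. $K$ and $S$) combinators, yielding $\lambda$-abstraction; the recursor $\mathbf{R}_0$ with $\mathbf{R}_0(f,m,0)=m$ and $\mathbf{R}_0(f,m,n+1)=f(\mathbf{R}_0(f,m,n))$ for $m^0,f^1$; the axiom of extensionality $x=_\rho y\to\varphi(x)=_\tau\varphi(y)$ for all types $\rho,\tau$; induction for quantifier-free formulas; and $\mathsf{QF\text{-}AC}^{1,0}$. The axiom $(\mu^2)$ is $(\exists\mu^2)(\forall f^1)\big[(\exists n)(f(n)=0)\to f(\mu(f))=0\big]$, and $\mathsf{ACA}_0^\omega:=\mathsf{RCA}_0^\omega+(\mu^2)$. Reals. A real is coded by $q_{(\cdot)}:\mathbb{N}\to\mathbb{Q}$ with $|q_n-q_{n+i}|<2^{-n}$ for all $n,i$; $x=_{\mathbb{R}}y$ means $|q_n-r_n|\leq 2^{-(n-1)}$ for all $n$, and $<_{\mathbb{R}}$ is defined similarly. A function $F:\mathbb{R}\to\mathbb{R}$ is given by a $\Phi^{1\to1}$ with $x=_{\mathbb{R}}y\to\Phi(x)=_{\mathbb{R}}\Phi(y)$; $\mathbb{R}^+$ is the set of positive reals. Gauge integral. Let $I=[0,1]$. A gauge on $I$ is any function $\delta:\mathbb{R}\to\mathbb{R}^+$. A tagged partition of $I$ is a finite sequence $P=(t_0,I_0,\dots,t_k,I_k)$ where the intervals $I_i$ partition $I$ and each tag $t_i\in I_i$; write $P\in\mathsf{tp}$. $P$ is $\delta$-fine if $I_i\subseteq[t_i-\delta(t_i),t_i+\delta(t_i)]$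 for all $i\leq k$. The Riemann sum is $S(f,P)=\sum_{i=0}^{k}f(t_i)|I_i|$ and the mesh is $\|P\|=\max_{i\leq k}|I_i|$. $f:I\to\mathbb{R}$ is Riemann integrable on $I$ if there is $A\in\mathbb{R}$ (a Riemann integral) with $(\forall\varepsilon>0)(\exists\delta>0)(\forall P\in\mathsf{tp})(\|P\|\leq\delta\to|S(f,P)-A|<\varepsilon)$. $f$ is gauge integrable on $I$ if there is $A\in\mathbb{R}$ (a gauge integral) with $(\forall\varepsilon>0)(\exists\delta:\mathbb{R}\to\mathbb{R}^+)(\forall P\in\mathsf{tp})(P\text{ is }\delta\text{-fine}\to|S(f,P)-A|<\varepsilon)$. *)

(* Defs.v *)
From Stdlib Require Import List.
Import ListNotations.

Set Implicit Arguments.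
Unset Strict Implicit.
Unset Printing Implicit Defensive.

(** Syntax of L_omega is intrinsically typed: [term G s] is the type of terms of finite
    type [s] whose free variables are declared in the context [G] (de Bruijn
    indices, innermost variable first). *)

Inductive ty : Type :=
| N : ty
| Arr : ty -> ty -> ty.

Declare Scope ty_scope.
Delimit Scope ty_scope with ty.
Bind Scope ty_scope with ty.
Infix "⟶" := Arr (at level 60, right associativity) : ty_scope.

Notation T1 := (N ⟶ N)%ty.

Definition ctx : Type := list ty.

Inductive var : ctx -> ty -> Type :=
| vz : forall (G : ctx) (s : ty), var (s :: G) s
| vs : forall (G : ctx) (s r : ty), var G s -> var (r :: G) s.
Arguments vz {G s}.
Arguments vs {G s r} v.

Inductive term (G : ctx) : ty -> Type :=
| Var : forall s : ty, var G s -> term G s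
| Zero : term G N
| One : term G N
| Plus : term G (N ⟶ N ⟶ N)
| Times : term G (N ⟶ N ⟶ N)
| CombK : forall s t : ty, term G (s ⟶ t ⟶ s)
| CombS : forall r s t : ty, term G ((r ⟶ s ⟶ t) ⟶ (r ⟶ s) ⟶ r ⟶ t)
| Rec0 : term G ((N ⟶ N) ⟶ N ⟶ N ⟶ N)
| App : forall s t : ty, term G (s ⟶ t) -> term G s -> term G t.
Arguments Var {G s} v.
Arguments Zero {G}.
Arguments One {G}.
Arguments Plus {G}.
Arguments Times {G}.
Arguments CombK {G} s t.
Arguments CombS {G} r s t.
Arguments Rec0 {G}.
Arguments App {G s t} _ _.

Inductive form : ctx -> Type :=
| Bot : forall G : ctx, form G
| Eq0 : forall G : ctx, term G N -> term G N -> form G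
| Lt0 : forall G : ctx, term G N -> term G N -> form G
| And : forall G : ctx, form G -> form G -> form G
| Or : forall G : ctx, form G -> form G -> form G
| Imp : forall G : ctx, form G -> form G -> form G
| All : forall (G : ctx) (s : ty), form (s :: G) -> form G
| Ex : forall (G : ctx) (s : ty), form (s :: G) -> form G.
Arguments Bot {G}.
Arguments All {G} s A.
Arguments Ex {G} s A.

Fixpoint qf (G : ctx) (A : form G) : bool :=
  match A with
  | Bot => true
  | Eq0 _ _ => true
  | Lt0 _ _ => true
  | And A B => andb (qf A) (qf B)
  | Or A B => andb (qf A) (qf B)
  | Imp A B => andb (qf A) (qf B)
  | All _ _ => false
  | Ex _ _ => false
  end.

Definition ren (G D : ctx) : Type := forall s : ty, var G s -> var D s.
Definition sub (G D : ctx) : Type := forall s : ty, var G s -> term D s.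

Fixpoint tren (G D : ctx) (x : ren G D) (s : ty) (t : term G s) : term D s :=
  match t with
  | Var v => Var (x _ v)
  | Zero => Zero
  | One => One
  | Plus => Plus
  | Times => Times
  | CombK s t => CombK s t
  | CombS r s t => CombS r s t
  | Rec0 => Rec0
  | App t u => App (tren x t) (tren x u)
  end.

Fixpoint tsub (G D : ctx) (x : sub G D) (s : ty) (t : term G s) : term D s :=
  match t with
  | Var v => x _ v
  | Zero => Zero
  | One => One
  | Plus => Plus
  | Times => Times
  | CombK s t => CombK s t
  | CombS r s t => CombS r s t
  | Rec0 => Rec0
  | App t u => App (tsub x t) (tsub x u)
  end.

Definition shift (G : ctx) (r : ty) : ren G (r :: G) := fun s v => vs v.

Definition scons (G D : ctx) (r : ty) (t : term D r) (x : sub G D) :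
    sub (r :: G) D :=
  fun s v =>
    match v in var L s' return
      match L with
      | [] => unit
      | r' :: G' => term D r' -> sub G' D -> term D s'
      end
    with
    | vz => fun t _ => t
    | vs w => fun _ x => x _ w
    end t x.

Definition lift_sub (G D : ctx) (r : ty) (x : sub G D) :
    sub (r :: G) (r :: D) :=
  scons (Var vz) (fun s v => tren (@shift D r) (x s v)).

Fixpoint fsub (G : ctx) (A : form G) : forall D : ctx, sub G D -> form D :=
  match A with
  | Bot => fun D _ => Bot
  | Eq0 t u => fun D x => Eq0 (tsub x t) (tsub x u)
  | Lt0 t u => fun D x => Lt0 (tsub x t) (tsub x u)
  | And A B => fun D x => And (fsub A x) (fsub B x)
  | Or A B => fun D x => Or (fsub A x) (fsub B x)
  | Imp A B => fun D x => Imp (fsub A x) (fsub B x)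
  | All s A => fun D x => All s (fsub A (lift_sub x))
  | Ex s A => fun D x => Ex s (fsub A (lift_sub x))
  end.

Definition id_sub (G : ctx) : sub G G := fun s v => Var v.

Definition fshift (G : ctx) (r : ty) (A : form G) : form (r :: G) :=
  fsub A (fun s v => Var (@shift G r s v)).

Definition inst (G : ctx) (s : ty) (A : form (s :: G)) (t : term G s) : form G :=
  fsub A (scons t (@id_sub G)).

(** [prov T H A]: derivability in classical many-sorted natural deduction of [A] from the hypotheses
    [H] and the axioms [T].  Axioms are given in every context, so that schemata
    may have parameters; by the generalization rule this is the same as
    postulating their universal closures. *)

Definition theory : Type := forall G : ctx, form G -> Prop.

Inductive prov (T : theory) : forall G : ctx, list (form G) -> form G -> Prop :=
| p_ax : forall G (H : list (form G)) A, T G A -> prov T H A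
| p_hyp : forall G (H : list (form G)) A, In A H -> prov T H A
| p_dne : forall G (H : list (form G)) A,
    prov T H (Imp (Imp A Bot) Bot) -> prov T H A
| p_andI : forall G (H : list (form G)) A B,
    prov T H A -> prov T H B -> prov T H (And A B)
| p_andE1 : forall G (H : list (form G)) A B, prov T H (And A B) -> prov T H A
| p_andE2 : forall G (H : list (form G)) A B, prov T H (And A B) -> prov T H B
| p_orI1 : forall G (H : list (form G)) A B, prov T H A -> prov T H (Or A B)
| p_orI2 : forall G (H : list (form G)) A B, prov T H B -> prov T H (Or A B)
| p_orE : forall G (H : list (form G)) A B C,
    prov T H (Or A B) -> prov T (A :: H) C -> prov T (B :: H) C -> prov T H C
| p_impI : forall G (H : list (form G)) A B,
    prov T (A :: H) B -> prov T H (Imp A B)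
| p_impE : forall G (H : list (form G)) A B,
    prov T H (Imp A B) -> prov T H A -> prov T H B
| p_allI : forall G (H : list (form G)) s (A : form (s :: G)),
    prov T (map (@fshift G s) H) A -> prov T H (All s A)
| p_allE : forall G (H : list (form G)) s (A : form (s :: G)) (t : term G s),
    prov T H (All s A) -> prov T H (inst A t)
| p_exI : forall G (H : list (form G)) s (A : form (s :: G)) (t : term G s),
    prov T H (inst A t) -> prov T H (Ex s A)
| p_exE : forall G (H : list (form G)) s (A : form (s :: G)) C,
    prov T H (Ex s A) ->
    prov T (A :: map (@fshift G s) H) (fshift s C) -> prov T H C
| p_refl : forall G (H : list (form G)) (t : term G N), prov T H (Eq0 t t)
| p_leibniz : forall G (H : list (form G)) (A : form (N :: G)) (t u : term G N),
    prov T H (Eq0 t u) -> prov T H (inst A t) -> prov T H (inst A u).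

Definition provable (T : theory) (A : form []) : Prop := prov T [] A.

(** [∀ x ∷ s, A] and [∃ x ∷ s, A] bind an object variable: in [A], the
    metavariable [x] is the de Bruijn variable 0 of the extended context.  Under
    further binders a term must be weakened, written [↑ x]; the (unique)
    weakening is found by instance resolution, and an incorrect one does not
    typecheck. *)

Class Wk (G D : ctx) : Type := wk : ren G D.
#[export] Instance wk_here (G : ctx) : Wk G G | 0 := fun s v => v.
#[export] Instance wk_there (G D : ctx) (r : ty) (w : Wk G D) :
  Wk G (r :: D) | 1 := fun s v => vs (w s v).

Definition up {G D : ctx} {w : Wk G D} {s : ty} (t : term G s) : term D s :=
  tren w t.

Definition all {G : ctx} (s : ty)
    (A : term (s :: G) s -> form (s :: G)) : form G := All s (A (Var vz)).
Definition ex {G : ctx} (s : ty)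
    (A : term (s :: G) s -> form (s :: G)) : form G := Ex s (A (Var vz)).

Definition Neg {G : ctx} (A : form G) : form G := Imp A Bot.
Definition Iff {G : ctx} (A B : form G) : form G := And (Imp A B) (Imp B A).

Arguments all {G} s & A.
Arguments ex {G} s & A.
Arguments And {G} & _ _.
Arguments Or {G} & _ _.
Arguments Imp {G} & _ _.
Arguments Neg {G} & _.
Arguments Iff {G} & _ _.
Arguments Eq0 {G} & _ _.
Arguments Lt0 {G} & _ _.

Declare Scope term_scope.
Delimit Scope term_scope with tm.
Bind Scope term_scope with term.
Declare Scope form_scope.
Delimit Scope form_scope with fm.
Bind Scope form_scope with form.

Notation "↑ t" := (up t) (at level 9, t at level 9) : term_scope.
Notation "t · u" := (App t u) (at level 38, left associativity) : term_scope.
Notation "t ⊗ u" := (App (App Times t) u)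
  (at level 40, left associativity) : term_scope.
Notation "t ⊕ u" := (App (App Plus t) u)
  (at level 50, left associativity) : term_scope.

Notation "⊥" := Bot : form_scope.
Notation "t ≐ u" := (Eq0 t u) (at level 70, no associativity) : form_scope.
Notation "t ≺ u" := (Lt0 t u) (at level 70, no associativity) : form_scope.
Notation "¬ A" := (Neg A) (at level 75, right associativity) : form_scope.
Notation "A ∧ B" := (And A B) (at level 80, right associativity) : form_scope.
Notation "A ∨ B" := (Or A B) (at level 85, right associativity) : form_scope.
Notation "A ⇒ B" := (Imp A B) (at level 90, right associativity) : form_scope.
Notation "A ⇔ B" := (Iff A B) (at level 95, no associativity) : form_scope.
Notation "∀ x ∷ s , A" := (all s (fun x => A%fm))
  (at level 100, x name, s at level 60, A at level 100, right associativity)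
  : form_scope.
Notation "∃ x ∷ s , A" := (ex s (fun x => A%fm))
  (at level 100, x name, s at level 60, A at level 100, right associativity)
  : form_scope.

Open Scope ty_scope.
Open Scope term_scope.
Open Scope form_scope.

Definition le0 {G : ctx} (t u : term G N) : form G := t ≺ u ∨ t ≐ u.
Notation "t ≼ u" := (le0 t u) (at level 70, no associativity) : form_scope.

Fixpoint eqt {G : ctx} (s : ty) : term G s -> term G s -> form G :=
  match s with
  | N => fun t u => t ≐ u
  | r ⟶ s => fun t u => ∀ x ∷ r, eqt (↑t · x) (↑u · x)
  end.

(** Quantifier-free induction on variable 0 of [A]; the other free variables are
    parameters. *)
Definition IND {G : ctx} (A : form (N :: G)) : form G :=
  inst A Zero
  ∧ All N (A ⇒ fsub A (scons (Var vz ⊕ One) (fun s v => Var (vs v))))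
  ⇒ All N A.

(** The instance of QF-AC^{s,t} for [A(x, y)], where [y] is variable 0 and [x]
    is variable 1 of [A]; in the conclusion [y] is replaced by [Y(x)]. *)
Definition QFAC (s t : ty) {G : ctx} (A : form (t :: s :: G)) : form G :=
  All s (Ex t A)
  ⇒ Ex (s ⟶ t) (All s
      (fsub A (scons (Var (vs vz) · Var vz)
               (scons (Var vz)
                      (fun r v => Var (vs (vs v))))))).

(** The arithmetical axioms are those of discretely ordered semi-rings (PA^-).  The
    recursor is the iterator R_0(f, m, n+1) = f(R_0(f, m, n)). *)
Inductive RCA0w : theory :=
| ax_addA G : @RCA0w G (∀ x ∷ N, ∀ y ∷ N, ∀ z ∷ N, (↑x ⊕ ↑y) ⊕ z ≐ ↑x ⊕ (↑y ⊕ z))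
| ax_addC G : @RCA0w G (∀ x ∷ N, ∀ y ∷ N, ↑x ⊕ y ≐ y ⊕ ↑x)
| ax_mulA G : @RCA0w G (∀ x ∷ N, ∀ y ∷ N, ∀ z ∷ N, (↑x ⊗ ↑y) ⊗ z ≐ ↑x ⊗ (↑y ⊗ z))
| ax_mulC G : @RCA0w G (∀ x ∷ N, ∀ y ∷ N, ↑x ⊗ y ≐ y ⊗ ↑x)
| ax_mulD G : @RCA0w G (∀ x ∷ N, ∀ y ∷ N, ∀ z ∷ N,
    ↑x ⊗ (↑y ⊕ z) ≐ (↑x ⊗ ↑y) ⊕ (↑x ⊗ z))
| ax_add0 G : @RCA0w G (∀ x ∷ N, x ⊕ Zero ≐ x)
| ax_mul0 G : @RCA0w G (∀ x ∷ N, x ⊗ Zero ≐ Zero)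
| ax_mul1 G : @RCA0w G (∀ x ∷ N, x ⊗ One ≐ x)
| ax_ltT G : @RCA0w G (∀ x ∷ N, ∀ y ∷ N, ∀ z ∷ N, ↑x ≺ ↑y ∧ ↑y ≺ z ⇒ ↑x ≺ z)
| ax_ltI G : @RCA0w G (∀ x ∷ N, ¬ (x ≺ x))
| ax_ltL G : @RCA0w G (∀ x ∷ N, ∀ y ∷ N, ↑x ≺ y ∨ ↑x ≐ y ∨ y ≺ ↑x)
| ax_ltD G : @RCA0w G (∀ x ∷ N, ∀ y ∷ N, ∀ z ∷ N,
    ↑x ≺ ↑y ⇒ (↑x ⊕ z) ≺ (↑y ⊕ z))
| ax_ltM G : @RCA0w G (∀ x ∷ N, ∀ y ∷ N, ∀ z ∷ N,
    Zero ≺ z ∧ ↑x ≺ ↑y ⇒ (↑x ⊗ z) ≺ (↑y ⊗ z))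
| ax_ltB G : @RCA0w G (∀ x ∷ N, ∀ y ∷ N, ↑x ≺ y ⇒ ∃ z ∷ N, ↑x ⊕ z ≐ ↑y)
| ax_01 G : @RCA0w G (Zero ≺ One)
| ax_disc G : @RCA0w G (∀ x ∷ N, Zero ≺ x ⇒ One ≼ x)
| ax_ge0 G : @RCA0w G (∀ x ∷ N, Zero ≼ x)
| ax_K s t G : @RCA0w G (∀ x ∷ s, ∀ y ∷ t, eqt (CombK s t · ↑x · y) (↑x))
| ax_S r s t G : @RCA0w G (∀ x ∷ r ⟶ s ⟶ t, ∀ y ∷ r ⟶ s, ∀ z ∷ r,
    eqt (CombS r s t · ↑x · ↑y · z) (↑x · z · (↑y · z)))
| ax_R0 G : @RCA0w G (∀ f ∷ N ⟶ N, ∀ m ∷ N, Rec0 · ↑f · m · Zero ≐ m)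
| ax_RS G : @RCA0w G (∀ f ∷ N ⟶ N, ∀ m ∷ N, ∀ n ∷ N,
    Rec0 · ↑f · ↑m · (n ⊕ One) ≐ ↑f · (Rec0 · ↑f · ↑m · n))
| ax_ext r t G : @RCA0w G (∀ x ∷ r, ∀ y ∷ r, ∀ p ∷ r ⟶ t,
    eqt (↑x) (↑y) ⇒ eqt (p · ↑x) (p · ↑y))
| ax_ind G (A : form (N :: G)) : qf A = true -> @RCA0w G (IND A)
| ax_qfac G (A : form (N :: T1 :: G)) :
    qf A = true -> @RCA0w G (QFAC A).

Definition mu2 {G : ctx} : form G :=
  ∃ m ∷ T1 ⟶ N, ∀ f ∷ T1,
    (∃ n ∷ N, ↑f · n ≐ Zero) ⇒ f · (↑m · f) ≐ Zero.

Inductive ACA0w : theory :=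
| aca_rca G (A : form G) : RCA0w A -> ACA0w A
| aca_mu G : @ACA0w G mu2.

(** The natural number [⟨a, ⟨b, d⟩⟩] codes the rational [(a - b) / (d + 1)],
    where [⟨i, j⟩ = (i + j)^2 + i] is the usual injective pairing.  [frac] is
    a metalevel triple of terms that represents the rational
    [(fpos - fneg) / fden] with [fden] positive. *)

Definition pair {G : ctx} (i j : term G N) : term G N := (i ⊕ j) ⊗ (i ⊕ j) ⊕ i.
Definition qcode {G : ctx} (a b d : term G N) : term G N := pair a (pair b d).

Record frac (G : ctx) : Type :=
  Frac { fpos : term G N; fneg : term G N; fden : term G N }.

Definition fup {G D : ctx} {w : Wk G D} (q : frac G) : frac D :=
  Frac (↑(fpos q)) (↑(fneg q)) (↑(fden q)).

(** [dec c A]: [c] codes a rational, and [A] holds of that rational. *)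
Definition dec {G : ctx} (c : term G N)
    (A : frac (N :: N :: N :: G) -> form (N :: N :: N :: G)) : form G :=
  ∃ a ∷ N, ∃ b ∷ N, ∃ d ∷ N,
    ↑c ≐ qcode (↑a) (↑b) d ∧ A (Frac (↑a) (↑b) (d ⊕ One)).
Arguments dec {G} & c A.

Definition dec2 {G : ctx} (c1 c2 : term G N)
    (A : let D := N :: N :: N :: N :: N :: N :: G in
         frac D -> frac D -> form D) : form G :=
  dec c1 (fun q1 => dec (↑c2) (fun q2 => A (fup q1) q2)).
Arguments dec2 {G} & c1 c2 A.

Definition dec3 {G : ctx} (c1 c2 c3 : term G N)
    (A : let D := N :: N :: N :: N :: N :: N :: N :: N :: N :: G in
         frac D -> frac D -> frac D -> form D) : form G :=
  dec c1 (fun q1 => dec (↑c2) (fun q2 => dec (↑c3) (fun q3 =>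
    A (fup q1) (fup q2) q3))).
Arguments dec3 {G} & c1 c2 c3 A.

Definition qadd {G : ctx} (p q : frac G) : frac G :=
  Frac (fpos p ⊗ fden q ⊕ fpos q ⊗ fden p)
       (fneg p ⊗ fden q ⊕ fneg q ⊗ fden p)
       (fden p ⊗ fden q).
Definition qopp {G : ctx} (p : frac G) : frac G := Frac (fneg p) (fpos p) (fden p).
Definition qsub {G : ctx} (p q : frac G) : frac G := qadd p (qopp q).
Definition qmul {G : ctx} (p q : frac G) : frac G :=
  Frac (fpos p ⊗ fpos q ⊕ fneg p ⊗ fneg q)
       (fpos p ⊗ fneg q ⊕ fneg p ⊗ fpos q)
       (fden p ⊗ fden q).
Definition qnat {G : ctx} (t : term G N) : frac G := Frac t Zero One.

Definition qeq {G : ctx} (p q : frac G) : form G :=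
  fpos p ⊗ fden q ⊕ fneg q ⊗ fden p ≐ fpos q ⊗ fden p ⊕ fneg p ⊗ fden q.
Definition qlt {G : ctx} (p q : frac G) : form G :=
  (fpos p ⊗ fden q ⊕ fneg q ⊗ fden p) ≺ (fpos q ⊗ fden p ⊕ fneg p ⊗ fden q).
Definition qle {G : ctx} (p q : frac G) : form G :=
  (fpos p ⊗ fden q ⊕ fneg q ⊗ fden p) ≼ (fpos q ⊗ fden p ⊕ fneg p ⊗ fden q).

(** [2^n], by iterating [x |-> x + x = S (+) I x], where [I = S K K]. *)
Definition pow2 {G : ctx} (n : term G N) : term G N :=
  Rec0 · (CombS N N N · Plus · (CombS N T1 N · CombK N T1 · CombK N N)) · One · n.

(** [m * 2^(-n)] *)
Definition dyad {G : ctx} (m n : term G N) : frac G := Frac m Zero (pow2 n).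

Definition Two {G : ctx} : term G N := One ⊕ One.

(** |q_n - q_{n+i}| < 2^{-n} *)
Definition isReal {G : ctx} (x : term G T1) : form G :=
  ∀ n ∷ N, ∀ i ∷ N,
    dec2 (↑x · ↑n) (↑x · (↑n ⊕ i)) (fun p q =>
      qlt (qsub p q) (dyad One (↑n)) ∧ qlt (qsub q p) (dyad One (↑n))).

(** |q_n - r_n| <= 2^{-(n-1)} for all n *)
Definition eqR {G : ctx} (x y : term G T1) : form G :=
  ∀ n ∷ N, dec2 (↑x · n) (↑y · n) (fun p q =>
    qle (qsub p q) (dyad Two (↑n)) ∧ qle (qsub q p) (dyad Two (↑n))).

(** q_n + 2^{-(n-1)} < r_n for some n *)
Definition ltR {G : ctx} (x y : term G T1) : form G :=
  ∃ n ∷ N, dec2 (↑x · n) (↑y · n) (fun p q =>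
    qlt (qadd p (dyad Two (↑n))) q).

Definition leR {G : ctx} (x y : term G T1) : form G :=
  ∀ n ∷ N, dec2 (↑x · n) (↑y · n) (fun p q =>
    qle p (qadd q (dyad Two (↑n)))).

Definition zeroR {G : ctx} : term G T1 := CombK N N · qcode Zero Zero Zero.
Definition oneR {G : ctx} : term G T1 := CombK N N · qcode One Zero Zero.

(** Graphs of the real operations: [z] is a sequence of rationals with
    z_n = x_{n+1} + y_{n+1}, z_n = x_{n+1} - y_{n+1}, z_n = |x_n|, and
    z_n = x_{n+k} * y_{n+k} where 2^k >= |x_0| + |y_0| + 2. *)
Definition isSum {G : ctx} (x y z : term G T1) : form G :=
  ∀ n ∷ N, dec3 (↑x · (n ⊕ One)) (↑y · (n ⊕ One)) (↑z · n) (fun p q r =>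
    qeq r (qadd p q)).

Definition isDiff {G : ctx} (x y z : term G T1) : form G :=
  ∀ n ∷ N, dec3 (↑x · (n ⊕ One)) (↑y · (n ⊕ One)) (↑z · n) (fun p q r =>
    qeq r (qsub p q)).

Definition isAbs {G : ctx} (x z : term G T1) : form G :=
  ∀ n ∷ N, dec2 (↑x · n) (↑z · n) (fun p r =>
    (qle (qnat Zero) p ∧ qeq r p) ∨ (qle p (qnat Zero) ∧ qeq r (qopp p))).

Definition isProd {G : ctx} (x y z : term G T1) : form G :=
  ∃ k ∷ N,
    dec2 (↑x · Zero) (↑y · Zero) (fun p q =>
      let bd s := qle (qadd s (qnat Two)) (qnat (pow2 (↑k))) in
      bd (qadd p q) ∧ bd (qsub p q) ∧ bd (qsub q p) ∧ bd (qopp (qadd p q)))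
    ∧ ∀ n ∷ N, dec3 (↑x · (n ⊕ ↑k)) (↑y · (n ⊕ ↑k)) (↑z · n) (fun p q r =>
        qeq r (qmul p q)).

(** |x - y| < e *)
Definition distltR {G : ctx} (x y e : term G T1) : form G :=
  ∃ d ∷ T1, ∃ a ∷ T1, isDiff (↑x) (↑y) (↑d) ∧ isAbs (↑d) a ∧ ltR a (↑e).

Definition allR {G : ctx} (A : term (T1 :: G) T1 -> form (T1 :: G)) : form G :=
  ∀ x ∷ T1, isReal x ⇒ A x.
Definition exR {G : ctx} (A : term (T1 :: G) T1 -> form (T1 :: G)) : form G :=
  ∃ x ∷ T1, isReal x ∧ A x.
Arguments allR {G} & A.
Arguments exR {G} & A.
Notation "∀ᴿ x , A" := (allR (fun x => A%fm))
  (at level 100, x name, A at level 100, right associativity) : form_scope.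
Notation "∃ᴿ x , A" := (exR (fun x => A%fm))
  (at level 100, x name, A at level 100, right associativity) : form_scope.

Definition inI {G : ctx} (x : term G T1) : form G :=
  isReal x ∧ leR zeroR x ∧ leR x oneR.

Definition funR {G : ctx} (F : term G (T1 ⟶ T1)) : form G :=
  (∀ᴿ x, isReal (↑F · x))
  ∧ ∀ᴿ x, ∀ᴿ y, eqR (↑x) y ⇒ eqR (↑F · ↑x) (↑F · y).

Definition funRpos {G : ctx} (F : term G (T1 ⟶ T1)) : form G :=
  funR F ∧ ∀ᴿ x, ltR zeroR (↑F · x).

Definition funI {G : ctx} (F : term G (T1 ⟶ T1)) : form G :=
  (∀ x ∷ T1, inI x ⇒ isReal (↑F · x))
  ∧ ∀ x ∷ T1, ∀ y ∷ T1,
      inI (↑x) ∧ inI y ∧ eqR (↑x) y ⇒ eqR (↑F · ↑x) (↑F · y).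

(** A finite sequence of objects of type 1 is coded by its length and an object
    of type 0 -> 1.  A tagged partition (t_0, I_0, ..., t_k, I_k) is given by
    [k], the division points [c] of 0 = c_0 < ... < c_{k+1} = 1, and the
    tags [t], with I_i = [c_i, c_{i+1}]. *)

Notation Seq1 := (N ⟶ T1).

Definition tp {G : ctx} (k : term G N) (c t : term G Seq1) : form G :=
  (∀ i ∷ N, i ≼ ↑k ⊕ One ⇒ isReal (↑c · i))
  ∧ eqR (c · Zero) zeroR
  ∧ eqR (c · (k ⊕ One)) oneR
  ∧ ∀ i ∷ N, i ≼ ↑k ⇒
      isReal (↑t · i)
      ∧ ltR (↑c · i) (↑c · (i ⊕ One))
      ∧ leR (↑c · i) (↑t · i) ∧ leR (↑t · i) (↑c · (i ⊕ One)).

(** I_i is included in [t_i - g(t_i), t_i + g(t_i)] for i <= k. *)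
Definition fine {G : ctx} (g : term G (T1 ⟶ T1))
    (k : term G N) (c t : term G Seq1) : form G :=
  ∀ i ∷ N, i ≼ ↑k ⇒
    ∀ᴿ y, leR (↑c · ↑i) y ∧ leR y (↑c · (↑i ⊕ One)) ⇒
      ∃ l ∷ T1, ∃ u ∷ T1,
        isDiff (↑t · ↑i) (↑g · (↑t · ↑i)) (↑l)
        ∧ isSum (↑t · ↑i) (↑g · (↑t · ↑i)) u
        ∧ leR (↑l) (↑y) ∧ leR (↑y) u.

(** The mesh: [m] is the maximum of the |I_i| for i <= k. *)
Definition isMesh {G : ctx} (k : term G N) (c : term G Seq1)
    (m : term G T1) : form G :=
  isReal m
  ∧ (∀ i ∷ N, i ≼ ↑k ⇒
       ∃ l ∷ T1, isDiff (↑c · (↑i ⊕ One)) (↑c · ↑i) l ∧ leR l (↑m))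
  ∧ ∃ i ∷ N, i ≼ ↑k
      ∧ ∃ l ∷ T1, isDiff (↑c · (↑i ⊕ One)) (↑c · ↑i) l ∧ eqR l (↑m).

(** The Riemann sum S(f, P), via the sequence [s] of partial sums:
    s_0 = 0, s_{i+1} = s_i + f(t_i) |I_i| for i <= k, and [S] is s_{k+1}. *)
Definition isRSum {G : ctx} (f : term G (T1 ⟶ T1))
    (k : term G N) (c t : term G Seq1) (S : term G T1) : form G :=
  isReal S
  ∧ ∃ s ∷ Seq1,
    (∀ i ∷ N, i ≼ ↑k ⊕ One ⇒ isReal (↑s · i))
    ∧ eqR (s · Zero) zeroR
    ∧ (∀ i ∷ N, i ≼ ↑k ⇒
         ∃ l ∷ T1, ∃ p ∷ T1, ∃ u ∷ T1,
           isDiff (↑c · (↑i ⊕ One)) (↑c · ↑i) (↑l)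
           ∧ isProd (↑f · (↑t · ↑i)) (↑l) (↑p)
           ∧ isSum (↑s · ↑i) (↑p) u
           ∧ eqR (↑s · (↑i ⊕ One)) u)
    ∧ eqR (↑S) (s · (↑k ⊕ One)).

(** |S(f, P) - A| < e *)
Definition rsum_near {G : ctx} (f : term G (T1 ⟶ T1))
    (k : term G N) (c t : term G Seq1) (A e : term G T1) : form G :=
  ∃ S ∷ T1, isRSum (↑f) (↑k) (↑c) (↑t) S ∧ distltR S (↑A) (↑e).

Definition RiemannInt {G : ctx} (f : term G (T1 ⟶ T1)) (A : term G T1) : form G :=
  isReal A
  ∧ ∀ᴿ e, ltR zeroR e ⇒
      ∃ᴿ d, ltR zeroR d
        ∧ ∀ k ∷ N, ∀ c ∷ Seq1, ∀ t ∷ Seq1,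
            tp (↑k) (↑c) t
            ⇒ (∃ m ∷ T1, isMesh (↑k) (↑c) m ∧ leR m (↑d))
            ⇒ rsum_near (↑f) (↑k) (↑c) t (↑A) (↑e).

Definition GaugeInt {G : ctx} (f : term G (T1 ⟶ T1)) (A : term G T1) : form G :=
  isReal A
  ∧ ∀ᴿ e, ltR zeroR e ⇒
      ∃ g ∷ T1 ⟶ T1, funRpos g
        ∧ ∀ k ∷ N, ∀ c ∷ Seq1, ∀ t ∷ Seq1,
            tp (↑k) (↑c) t
            ⇒ fine (↑g) (↑k) (↑c) t
            ⇒ rsum_near (↑f) (↑k) (↑c) t (↑A) (↑e).

Definition RiemannIntegrable {G : ctx} (f : term G (T1 ⟶ T1)) : form G :=
  ∃ A ∷ T1, RiemannInt (↑f) A.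
Definition GaugeIntegrable {G : ctx} (f : term G (T1 ⟶ T1)) : form G :=
  ∃ A ∷ T1, GaugeInt (↑f) A.

Definition HBU : form [] :=
  ∀ P ∷ T1 ⟶ T1, funRpos P ⇒
    ∃ k ∷ N, ∃ y ∷ Seq1,
      (∀ i ∷ N, i ≺ ↑k ⇒ inI (↑y · i))
      ∧ ∀ x ∷ T1, inI x ⇒
          ∃ i ∷ N, i ≺ ↑k
            ∧ ∃ l ∷ T1, ∃ u ∷ T1,
                isDiff (↑y · ↑i) (↑P · (↑y · ↑i)) (↑l)
                ∧ isSum (↑y · ↑i) (↑P · (↑y · ↑i)) u
                ∧ ltR (↑l) (↑x) ∧ ltR (↑x) u.

Definition GaugeUniqueness : form [] :=
  ∀ f ∷ T1 ⟶ T1, funI f ∧ GaugeIntegrable f ⇒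
    ∀ A ∷ T1, ∀ B ∷ T1,
      GaugeInt (↑f) (↑A) ∧ GaugeInt (↑f) B ⇒ eqR (↑A) B.

(** Any Riemann integral of [f] equals any gauge integral of [f]; uniqueness of
    the latter is not presupposed. *)
Definition RiemannGaugeConsistency : form [] :=
  ∀ f ∷ T1 ⟶ T1, funI f ∧ RiemannIntegrable f ⇒
    GaugeIntegrable f
    ∧ ∀ A ∷ T1, ∀ B ∷ T1,
        RiemannInt (↑f) (↑A) ∧ GaugeInt (↑f) B ⇒ eqR (↑A) B.

(* Main.v *)
(* By Henkin's completeness theorem it suffices to argue in an arbitrary extensional, possibly
   nonstandard, model of ACA_0^omega. In such a model mu^2 yields arithmetical comprehension,
   induction, number choice and least elements. Its rationals form an ordered field K, and its
   reals embed in the ordered ring obtained from K by adjoining limits of sequences indexed by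
   the (nonstandard) numbers of the model, so that statements about codes become statements
   about elements of an ordered ring.

   HBU implies uniqueness: below two gauges there is a gauge with values 1/(n+1); a finite
   subcover for it is thinned out to a greedy chain of intervals with increasing centres,
   whose overlaps contain division points. The result is a tagged partition that is fine for
   both gauges, so two gauge integrals are arbitrarily close. A Riemann integral is a gauge
   integral by constant gauges, which with uniqueness gives consistency.

   Conversely, if Psi witnesses the failure of HBU, then no tagged partition is Psi-fine, as
   its tags and division points would form a finite subcover. Hence every real is vacuously a
   gauge integral of the zero function, which refutes uniqueness and consistency. *)
From HB Require Import structures.
From mathcomp Require Import all_boot all_order all_algebra.
From mathcomp Require Import boolp ring lra.
From Stdlib Require Import Eqdep_dec Cantor.
Require Import Defs.

Close Scope form_scope. Close Scope term_scope. Close Scope ty_scope.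

Set Implicit Arguments.
Unset Strict Implicit.
Unset Printing Implicit Defensive.

(** * Syntax *)

(** The lengths of partitions, sums and covers are numbers of the model and may be nonstandard, so
    no induction of the metatheory runs along them. Every induction, choice, minimum or maximum
    takes place inside the model and requires a predicate that is arithmetical with parameters. The
    limits in the ordered ring are external to the model; therefore such predicates are phrased with
    [leR], [ltR] and [eqR], and [rl] translates them into ring elements only before and after the
    induction. Two mismatches shape the equivalences. Fineness speaks of closed gauge intervals and
    HBU of open ones, so a fine partition covers its own division points only after these are added
    as centres. And a gauge has to respect equality of reals, although it is assembled from chosen
    numbers: the choice is made by [mu], whose value depends only on the set of admissible numbers,
    and equal reals admit the same ones. *)

Definition ty_eq_dec (s t : ty) : {s = t} + {s <> t}.
Proof. decide equality. Qed.
Definition ctx_eq_dec (G D : ctx) : {G = D} + {G <> D}.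
Proof. decide equality. exact: ty_eq_dec. Qed.

(** The context of the variable is a cons and not an index variable, so the elimination uses a
    return type that matches on the context. *)
Definition var_case (G : ctx) (r : ty) (P : forall s, var (r :: G) s -> Prop)
    (h0 : P r vz) (hs : forall s (v : var G s), P s (vs v)) s (v : var (r :: G) s) : P s v.
Proof.
move: P h0 hs.
refine (match v as v' in var L s' return
  match L return var L s' -> Prop with
  | [::] => fun _ => True
  | r' :: G' => fun v' => forall P : forall s, var (r' :: G') s -> Prop,
      P r' vz -> (forall s (w : var G' s), P s (vs w)) -> P s' v'
  end v' with vz _ _ => _ | vs _ _ _ w => _ end).
- by move=> P h0 _; exact: h0.
- by move=> P _ hs; exact: hs.
Qed.

Lemma sub_ext (G D : ctx) (x y : sub G D) : (forall s v, x s v = y s v) -> x = y.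
Proof. by move=> h; apply: functional_extensionality_dep => s; apply: funext => v; exact: h. Qed.

Lemma tsub_tren (G D E : ctx) (r : ren G D) (x : sub D E) s (t : term G s) :
  tsub x (tren r t) = tsub (fun s v => x s (r s v)) t.
Proof. by elim: t => //= s' t' f -> u ->. Qed.

Lemma tren_tsub (G D E : ctx) (x : sub G D) (r : ren D E) s (t : term G s) :
  tren r (tsub x t) = tsub (fun s v => tren r (x s v)) t.
Proof. by elim: t => //= s' t' f -> u ->. Qed.

Lemma tsub_tsub (G D E : ctx) (x : sub G D) (y : sub D E) s (t : term G s) :
  tsub y (tsub x t) = tsub (fun s v => tsub y (x s v)) t.
Proof. by elim: t => //= s' t' f -> u ->. Qed.

Lemma tsub_id (G : ctx) s (t : term G s) : tsub (fun s v => Var v) t = t.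
Proof. by elim: t => //= s' t' f -> u ->. Qed.

Lemma tren_as_tsub (G D : ctx) (r : ren G D) s (t : term G s) :
  tren r t = tsub (fun s v => Var (r s v)) t.
Proof. by elim: t => //= s' t' f -> u ->. Qed.

Lemma lift_sub_comp (G D E : ctx) r (x : sub G D) (y : sub D E) :
  (fun s v => tsub (lift_sub y) (@lift_sub G D r x s v))
  = lift_sub (fun s v => tsub y (x s v)).
Proof.
apply: sub_ext; apply: var_case => //= s v.
by rewrite tsub_tren tren_tsub.
Qed.

Lemma fsub_fsub (G : ctx) (A : form G) : forall (D E : ctx) (x : sub G D) (y : sub D E),
  fsub (fsub A x) y = fsub A (fun s v => tsub y (x s v)).
Proof.
elim: A => //=.
- by move=> H t u D E x y; rewrite !tsub_tsub.
- by move=> H t u D E x y; rewrite !tsub_tsub.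
- by move=> H A IHA B IHB D E x y; rewrite IHA IHB.
- by move=> H A IHA B IHB D E x y; rewrite IHA IHB.
- by move=> H A IHA B IHB D E x y; rewrite IHA IHB.
- by move=> H s A IH D E x y; rewrite IH lift_sub_comp.
- by move=> H s A IH D E x y; rewrite IH lift_sub_comp.
Qed.

Lemma lift_sub_id (G : ctx) r : lift_sub (fun s v => Var v) = (fun s v => Var v) :> sub (r :: G) (r :: G).
Proof. by apply: sub_ext; apply: var_case. Qed.

Lemma fsub_id (G : ctx) (A : form G) : fsub A (fun s v => Var v) = A.
Proof.
elim: A => //=.
- by move=> H t u; rewrite !tsub_id.
- by move=> H t u; rewrite !tsub_id.
- by move=> H A -> B ->.
- by move=> H A -> B ->.
- by move=> H A -> B ->.
- by move=> H s A IH; rewrite lift_sub_id IH.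
- by move=> H s A IH; rewrite lift_sub_id IH.
Qed.

(** Instantiates a quantified formula whose parameters have already been replaced; this is how
    [p_allE] and [p_exI] meet the truth definition. *)
Lemma inst_lift (G D : ctx) s (A : form (s :: G)) (x : sub G D) (t : term D s) :
  inst (fsub A (lift_sub x)) t = fsub A (scons t x).
Proof.
rewrite /inst fsub_fsub; congr fsub; apply: sub_ext; apply: var_case => //= r v.
by rewrite tsub_tren /= tsub_id.
Qed.

Lemma fsub_inst (G D : ctx) s (A : form (s :: G)) (x : sub G D) (t : term G s) :
  fsub (inst A t) x = fsub A (scons (tsub x t) x).
Proof. by rewrite /inst fsub_fsub; congr fsub; apply: sub_ext; apply: var_case. Qed.

Lemma fsub_eqt (s : ty) : forall (G D : ctx) (x : sub G D) (t u : term G s),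
  fsub (eqt t u) x = eqt (tsub x t) (tsub x u).
Proof.
elim: s => //= r _ s IH G D x t u; congr All.
by rewrite IH /= /up !tsub_tren !tren_tsub.
Qed.

Lemma qf_fsub (G : ctx) (A : form G) : forall D (x : sub G D), qf (fsub A x) = qf A.
Proof. by elim: A => //= H A IHA B IHB D x; rewrite IHA IHB. Qed.

(** An axiom is evaluated by inserting Henkin terms for its variables, so these instances have to be
    axioms again. *)
Definition fsub_closed (T : theory) :=
  forall G (A : form G) D (x : sub G D), T G A -> T D (fsub A x).

Lemma fsub_IND (G D : ctx) (A : form (N :: G)) (x : sub G D) :
  fsub (IND A) x = IND (fsub A (lift_sub x)).
Proof.
rewrite /IND /= fsub_inst inst_lift !fsub_fsub; congr (Imp (And _ (All _ (Imp _ _))) _).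
congr fsub; apply: sub_ext; apply: var_case => //= s v.
by rewrite tsub_tren tren_as_tsub.
Qed.

Lemma fsub_QFAC (G D : ctx) s t (A : form (t :: s :: G)) (x : sub G D) :
  fsub (QFAC A) x = QFAC (fsub A (lift_sub (lift_sub x))).
Proof.
rewrite /QFAC /= !fsub_fsub; congr (Imp _ (Ex _ (All _ _))).
congr fsub; apply: sub_ext; apply: var_case => //=.
move=> r v; move: v; move: r; apply: var_case => //= r v.
by rewrite !tsub_tren /= !tren_as_tsub tsub_tsub.
Qed.

Lemma RCA0w_closed : fsub_closed RCA0w.
Proof.
move=> G A D x h; case: {A} h x => {}G.
all: try by [move=> x; constructor].
- by move=> t G' x; rewrite /= !fsub_eqt; exact: ax_K.
- by move=> s t G' x; rewrite /= !fsub_eqt; exact: ax_S.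
- by move=> t G' x; rewrite /= !fsub_eqt; exact: ax_ext.
- by move=> A qA x; rewrite fsub_IND; apply: ax_ind; rewrite qf_fsub.
- by move=> A qA x; rewrite fsub_QFAC; apply: ax_qfac; rewrite qf_fsub.
Qed.

Lemma ACA0w_closed : fsub_closed ACA0w.
Proof.
move=> G A D x h; case: {A} h x => {}G; last by move=> x; exact: aca_mu.
by move=> A h x; apply: aca_rca; exact: RCA0w_closed.
Qed.

(** * Countability of the formulas in all contexts *)

Local Notation tree := (GenTree.tree nat).

Fixpoint ty_code (s : ty) : tree :=
  match s with
  | N => GenTree.Leaf 0
  | Arr r t => GenTree.Node 0 [:: ty_code r; ty_code t]
  end.

Lemma ty_code_inj : injective ty_code.
Proof. by elim=> [|r IHr t IHt] [|r' t'] //= [] /IHr -> /IHt ->. Qed.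

Definition ctx_code (G : ctx) : tree := GenTree.Node 0 (seq.map ty_code G).

Fixpoint var_code (G : ctx) s (v : var G s) : nat :=
  match v with vz _ _ => 0 | vs _ _ _ w => (var_code w).+1 end.

Lemma var_code_inj (G : ctx) s (v : var G s) : forall s' (v' : var G s'),
  var_code v = var_code v' -> existT (var G) s v = existT (var G) s' v'.
Proof.
elim: v => {G s} [G s|G s r v IH].
  by apply: var_case.
apply: var_case => // s' w [] /IH h.
exact: (congr1 (fun p : {s & var G s} => existT (var (r :: G)) (projT1 p) (vs (projT2 p))) h).
Qed.

(** Contexts and the types of variables and applications are left out: in a fixed context a de
    Bruijn index determines its type, and the function part of an application determines the
    remaining types. *)
Fixpoint term_code (G : ctx) s (t : term G s) : tree :=
  match t with
  | Var s v => GenTree.Leaf (var_code v)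
  | Zero => GenTree.Node 0 [::]
  | One => GenTree.Node 1 [::]
  | Plus => GenTree.Node 2 [::]
  | Times => GenTree.Node 3 [::]
  | CombK s t => GenTree.Node 4 [:: ty_code s; ty_code t]
  | CombS r s t => GenTree.Node 5 [:: ty_code r; ty_code s; ty_code t]
  | Rec0 => GenTree.Node 6 [::]
  | App s t f u => GenTree.Node 7 [:: term_code f; term_code u]
  end.

Lemma existT_ty_inj (P : ty -> Type) s (a b : P s) : existT P s a = existT P s b -> a = b.
Proof. exact: (inj_pair2_eq_dec _ ty_eq_dec). Qed.

Lemma term_code_inj (G : ctx) s (t : term G s) : forall s' (t' : term G s'),
  term_code t = term_code t' -> existT (term G) s t = existT (term G) s' t'.
Proof.
elim: t => {s} [s v|||||s t|r s t||s t f IHf u IHu] s' [] //=.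
- move=> r w [] /var_code_inj h.
  exact: (congr1 (fun p : {s & var G s} => existT (term G) (projT1 p) (Var (projT2 p))) h).
- by move=> s1 t1 [] /ty_code_inj -> /ty_code_inj ->.
- by move=> r1 s1 t1 [] /ty_code_inj -> /ty_code_inj -> /ty_code_inj ->.
- move=> s1 t1 f1 u1 [] /IHf hf /IHu hu.
  case: (hf) => es et; subst s1 t1.
  by rewrite (existT_ty_inj (P := term G) hf) (existT_ty_inj (P := term G) hu).
Qed.

Fixpoint form_code (G : ctx) (A : form G) : tree :=
  match A with
  | Bot _ => GenTree.Node 0 [::]
  | Eq0 _ t u => GenTree.Node 1 [:: term_code t; term_code u]
  | Lt0 _ t u => GenTree.Node 2 [:: term_code t; term_code u]
  | And _ A B => GenTree.Node 3 [:: form_code A; form_code B]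
  | Or _ A B => GenTree.Node 4 [:: form_code A; form_code B]
  | Imp _ A B => GenTree.Node 5 [:: form_code A; form_code B]
  | All _ s A => GenTree.Node 6 [:: ty_code s; form_code A]
  | Ex _ s A => GenTree.Node 7 [:: ty_code s; form_code A]
  end.

Lemma form_code_inj (G : ctx) : injective (@form_code G).
Proof.
have tinj D s (t u : term D s) : term_code t = term_code u -> t = u.
  by move=> /term_code_inj h; exact: (existT_ty_inj (P := term D) h).
elim=> {}G.
- by case.
- move=> t u B; case: B t u => //= D t' u' t u [] /tinj -> /tinj -> //.
- move=> t u B; case: B t u => //= D t' u' t u [] /tinj -> /tinj -> //.
- move=> A IHA B IHB C; case: C A IHA B IHB => //= D A' B' A IHA B IHB [] /IHA -> /IHB -> //.
- move=> A IHA B IHB C; case: C A IHA B IHB => //= D A' B' A IHA B IHB [] /IHA -> /IHB -> //.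
- move=> A IHA B IHB C; case: C A IHA B IHB => //= D A' B' A IHA B IHB [] /IHA -> /IHB -> //.
- move=> s A IHA C; case: C A IHA => //= D s' A' A IHA [] /ty_code_inj h; subst s'.
  by move=> /IHA ->.
- move=> s A IHA C; case: C A IHA => //= D s' A' A IHA [] /ty_code_inj h; subst s'.
  by move=> /IHA ->.
Qed.

Definition sform := {G : ctx & form G}.

Definition sform_code (p : sform) : tree :=
  GenTree.Node 0 [:: ctx_code (projT1 p); form_code (projT2 p)].

Lemma sform_code_inj : injective sform_code.
Proof.
move=> [G A] [D B] [] /(inj_map ty_code_inj) h; subst D.
by move=> /form_code_inj ->.
Qed.

(** Each formula recurs beyond every bound, because a formula with parameters from stage [n] can be
    treated only at stage [n] or later. *)
Lemma sform_enum : exists e : nat -> sform, forall p n, exists m, n <= m /\ e m = p.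
Proof.
have /choice [e0 he0] : forall n, exists p : sform, forall q, pickle (sform_code q) = n -> q = p.
  move=> n; case: (pselect (exists q, pickle (sform_code q) = n)) => [[q hq]|h].
    by exists q => r; rewrite -hq => /(pcan_inj pickleK) /sform_code_inj.
  by exists (existT _ [::] Bot) => q hq; case: h; exists q.
(* Reading only the first Cantor component repeats a formula once for every second component, and
   the code of a pair is at least its second component. *)
exists (fun n => e0 (fst (Cantor.of_nat n))) => p n.
exists (Cantor.to_nat (pickle (sform_code p), n)); split.
  apply: leq_trans (leq_addr (pickle (sform_code p)) n) _.
  by apply/leP; exact: Cantor.to_nat_non_decreasing.
by rewrite Cantor.cancel_of_to; symmetry; exact: he0.
Qed.

(** Equality of each type is interpreted by equality in Rocq; with [dom_ext], the pointwise formula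
    [eqt] then means identity of elements. *)
Record model := Model {
  dom : ty -> Type;
  ap : forall s t, dom (s ⟶ t)%ty -> dom s -> dom t;
  m0 : dom N;
  m1 : dom N;
  mplus : dom (N ⟶ N ⟶ N)%ty;
  mtimes : dom (N ⟶ N ⟶ N)%ty;
  mK : forall s t, dom (s ⟶ t ⟶ s)%ty;
  mS : forall r s t, dom ((r ⟶ s ⟶ t) ⟶ (r ⟶ s) ⟶ r ⟶ t)%ty;
  mR : dom ((N ⟶ N) ⟶ N ⟶ N ⟶ N)%ty;
  mlt : dom N -> dom N -> Prop;
  dom_ext : forall s t (f g : dom (s ⟶ t)%ty), (forall a, ap f a = ap g a) -> f = g }.
Arguments ap {m s t}.
Arguments m0 {m}.
Arguments m1 {m}.
Arguments mplus {m}.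
Arguments mtimes {m}.
Arguments mK {m}.
Arguments mS {m}.
Arguments mR {m}.
Arguments mlt {m}.

(** * Completeness *)

Section Semantics.
Variable M : model.

Fixpoint env (G : ctx) : Type :=
  match G with [::] => unit | s :: G => (dom M s * env G)%type end.

Fixpoint lookup (G : ctx) s (v : var G s) : env G -> dom M s :=
  match v with
  | vz _ _ => fun e => e.1
  | vs _ _ _ w => fun e => lookup w e.2
  end.

Fixpoint semt (G : ctx) s (t : term G s) (e : env G) : dom M s :=
  match t with
  | Var _ v => lookup v e
  | Zero => m0
  | One => m1
  | Plus => mplus
  | Times => mtimes
  | CombK s t => mK s t
  | CombS r s t => mS r s t
  | Rec0 => mR
  | App _ _ f u => ap (semt f e) (semt u e)
  end.

Fixpoint sem (G : ctx) (A : form G) : env G -> Prop :=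
  match A with
  | Bot _ => fun _ => False
  | Eq0 _ t u => fun e => semt t e = semt u e
  | Lt0 _ t u => fun e => mlt (semt t e) (semt u e)
  | And _ A B => fun e => sem A e /\ sem B e
  | Or _ A B => fun e => sem A e \/ sem B e
  | Imp _ A B => fun e => sem A e -> sem B e
  | All _ s A => fun e => forall a : dom M s, sem A (a, e)
  | Ex _ s A => fun e => exists a : dom M s, sem A (a, e)
  end.

End Semantics.

Definition models (M : model) (T : theory) := forall G (A : form G) (e : env M G), T G A -> sem A e.

Section Completeness.
Variable T : theory.
Hypothesis T_closed : fsub_closed T.
Hypothesis T_ext : forall r t G,
  @T G (∀ x ∷ r, ∀ y ∷ r, ∀ p ∷ (r ⟶ t)%ty, eqt (↑x) (↑y) ⇒ eqt (p · ↑x) (p · ↑y))%fm.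

Definition consistent G (H : list (form G)) := ~ prov T H Bot.

(** Every type is inhabited by a term, so a contradiction that uses the fresh variable can be
    generalized and instantiated back. *)
Lemma consistent_shift G r (H : list (form G)) : consistent H -> consistent (List.map (@fshift G r) H).
Proof.
move=> cH h; apply: cH.
have d : exists t : term G r, True.
  elim: r {h} => [|r _ s [t _]]; first by exists Zero.
  by exists (CombK s r · t)%tm.
case: d => t _.
exact: (@p_allE T G H r Bot t (p_allI h)).
Qed.

(** One Henkin step. It always adds exactly one variable, a dummy if no witness is due, so that the
    length of a context tells its stage. *)
Definition step_spec G (H : list (form G)) (A : form G) (p : {r : ty & list (form (r :: G))}) :=
  [/\ consistent (projT2 p),
      forall B, List.In B H -> List.In (fshift (projT1 p) B) (projT2 p)
    & (List.In (fshift (projT1 p) A) (projT2 p)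
       /\ forall s B, A = Ex s B -> exists t : term (projT1 p :: G) s,
            List.In (fsub B (scons t (fun s v => Var (vs v)))) (projT2 p))
      \/ List.In (fshift (projT1 p) (Neg A)) (projT2 p)].

Lemma scons_vz G r (B : form (r :: G)) : fsub B (scons (Var vz) (fun s v => Var (vs v))) = B.
Proof.
rewrite -[RHS]fsub_id; congr fsub; apply: sub_ext.
by apply: var_case.
Qed.

Lemma Ex_inj G s s' (B : form (s :: G)) (B' : form (s' :: G)) : Ex s B = Ex s' B' ->
  existT (fun s => form (s :: G)) s B = existT (fun s => form (s :: G)) s' B'.
Proof.
pose f D (A : form D) : option {s : ty & form (s :: D)} :=
  match A with @Ex D s C => Some (existT (fun s => form (s :: D)) s C) | _ => None end.
by move/(congr1 (@f G)) => -[].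
Qed.

(** If [A] is consistent with [H] it is added, and for an existential formula the new variable
    serves as witness, which is harmless by [p_exE]. Otherwise [H] refutes [A], and the negation is
    added. *)
Lemma step_ex G (H : list (form G)) (A : form G) : consistent H -> exists p, step_spec H A p.
Proof.
move=> cH; case: (pselect (consistent (A :: H))) => [cA|iA].
- case: (pselect (exists s B, A = Ex s B)) => [[s [B eA]]|nex].
  + exists (existT _ s (B :: List.map (@fshift G s) (A :: H))); split => /=.
    * move=> h; apply: cA; apply: (@p_exE T G (A :: H) s B Bot) => //.
      by apply: p_hyp; left.
    * by move=> C hC; right; right; exact: List.in_map.
    * left; split; first by right; left.
      move=> s' B'; rewrite eA => /Ex_inj e.
      have : (fun q : {s : ty & form (s :: G)} => exists t : term (s :: G) (projT1 q),
                fsub (projT2 q) (scons t (fun s v => Var (vs v))) = B) (existT _ s' B').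
        by rewrite -e; exists (Var vz); exact: scons_vz.
      by move=> /= [t et]; exists t; left.
  + exists (existT _ N (List.map (@fshift G N) (A :: H))); split => /=.
    * exact: (consistent_shift cA).
    * by move=> C hC; right; exact: List.in_map.
    * by left; split; [left|move=> s B e; case: nex; exists s, B].
- exists (existT _ N (List.map (@fshift G N) (Neg A :: H))); split => /=.
  + apply: (@consistent_shift _ N (Neg A :: H)) => h; apply: cH.
    exact: (p_impE (p_impI h) (p_impI (contrapT iA))).
  + by move=> C hC; right; exact: List.in_map.
  + by right; left.
Qed.

Fixpoint closed_term G (s : ty) : term G s :=
  match s with
  | N => Zero
  | Arr r s => App (CombK s r) (closed_term G s)
  end.

(* [suffix_sub G D] renames [G] into [D] whenever [D] extends [G] to the left; it is a
   junk substitution otherwise. *)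
Fixpoint suffix_sub (G D : ctx) : sub G D :=
  match ctx_eq_dec G D with
  | left e => eq_rect G (fun D => sub G D) (@id_sub G) D e
  | right _ =>
      match D return sub G D with
      | [::] => fun s _ => closed_term [::] s
      | r :: D' => fun s v => tren (@shift D' r) (@suffix_sub G D' s v)
      end
  end.

Arguments suffix_sub G D s v : clear implicits.

Lemma suffix_sub_id G : suffix_sub G G = (fun s v => Var v).
Proof.
case: G => [|r G] /=; case: ctx_eq_dec => // e.
  by rewrite (UIP_dec ctx_eq_dec e erefl).
by rewrite (UIP_dec ctx_eq_dec e erefl).
Qed.

Lemma suffix_sub_cons G r D : G <> r :: D ->
  suffix_sub G (r :: D) = (fun s v => tren (@shift D r) (suffix_sub G D s v)).
Proof. by move=> ne /=; case: ctx_eq_dec. Qed.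

(** * The chain of Henkin extensions *)

Variable A0 : form [::].
Hypothesis A0_unprovable : ~ provable T A0.
Variable enum : nat -> sform.
Hypothesis enumP : forall p n, exists m, n <= m /\ enum m = p.

Record state := State {
  st_ctx : ctx; st_hyp : list (form st_ctx); st_cons : consistent st_hyp }.

Lemma init_consistent : consistent [:: Neg A0].
Proof. by move=> h; apply: A0_unprovable; apply: p_dne; exact: p_impI. Qed.

(** A formula listed from an earlier stage appears here weakened to the current context; any other
    one becomes junk, whose decision does no harm. *)
Definition task (n : nat) (G : ctx) : form G :=
  fsub (projT2 (enum n)) (suffix_sub (projT1 (enum n)) G).

Definition next n (st : state) := cid (step_ex (task n (st_ctx st)) (@st_cons st)).

Lemma next_cons n st : consistent (projT2 (sval (next n st))).
Proof. by case: (svalP (next n st)). Qed.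

Fixpoint chain (n : nat) : state :=
  match n with
  | 0 => State init_consistent
  | n.+1 => State (@next_cons n (chain n))
  end.

Definition Gn n := st_ctx (chain n).
Definition Hn n : list (form (Gn n)) := st_hyp (chain n).
Definition rn n := projT1 (sval (next n (chain n))).

Lemma Hn_cons n : ~ prov T (Hn n) Bot.
Proof. exact: st_cons. Qed.

Lemma Hn_spec n : step_spec (Hn n) (task n (Gn n)) (existT _ (rn n) (Hn n.+1)).
Proof. by have := svalP (next n (chain n)); rewrite /Hn /rn /=; case: (sval _). Qed.

Lemma Hn_step n (B : form (Gn n)) : List.In B (Hn n) -> List.In (fshift (rn n) B) (Hn n.+1).
Proof. by case: (Hn_spec n) => _ h _; exact: h. Qed.

Lemma Hn_dec n (A : form (Gn n)) : task n (Gn n) = A ->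
  (List.In (fshift (rn n) A) (Hn n.+1)
   /\ forall s B, A = Ex s B -> exists t : term (Gn n.+1) s,
        List.In (fsub B (scons t (fun s v => Var (vs v)) : sub _ (Gn n.+1))) (Hn n.+1))
  \/ List.In (fshift (rn n) (Neg A)) (Hn n.+1).
Proof. by move=> <-; case: (Hn_spec n). Qed.

Lemma size_Gn n : size (Gn n) = n.
Proof. by elim: n => //= n IH; congr _.+1. Qed.

(** The two contexts have different lengths, so the comparison in [suffix_sub] fails and its
    recursive branch is taken. *)
Lemma Gn_suffix_step n m : n <= m ->
  suffix_sub (Gn n) (Gn m.+1) = (fun s v => tren (@shift (Gn m) (rn m)) (suffix_sub (Gn n) (Gn m) s v)).
Proof.
move=> nm; apply: suffix_sub_cons => e.
have := size_Gn m.+1; rewrite -[Gn m.+1]e size_Gn => e'.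
by rewrite e' ltnn in nm.
Qed.

(** A pre-element is a term of some stage. Its value at a later stage is its weakening; its values
    at earlier stages are junk. *)
Definition pre (s : ty) := {n : nat & term (Gn n) s}.
Definition stage_val s (a : pre s) m : term (Gn m) s := tsub (suffix_sub (Gn (projT1 a)) (Gn m)) (projT2 a).

Lemma val_step s (a : pre s) m : projT1 a <= m -> stage_val a m.+1 = tren (@shift (Gn m) (rn m)) (stage_val a m).
Proof. by move=> h; rewrite /stage_val Gn_suffix_step // tren_tsub. Qed.

Lemma val_val s (a : pre s) n m : projT1 a <= n -> n <= m ->
  tsub (suffix_sub (Gn n) (Gn m)) (stage_val a n) = stage_val a m.
Proof.
move=> an; elim: m => [|m IH]; first by rewrite leqn0 => /eqP e; rewrite e suffix_sub_id tsub_id.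
rewrite leq_eqVlt => /orP [/eqP e|nm]; first by rewrite e suffix_sub_id tsub_id.
rewrite Gn_suffix_step // val_step ?(leq_trans an) //.
by rewrite -IH // tren_tsub.
Qed.

Lemma val_here s m (t : term (Gn m) s) : stage_val (existT _ m t) m = t.
Proof. by rewrite /stage_val suffix_sub_id tsub_id. Qed.

Definition penv (D : ctx) := forall s, var D s -> pre s.

Definition pcons (D : ctx) (r : ty) (a : pre r) (x : penv D) : penv (r :: D) :=
  fun s v =>
    match v in var L s' return
      match L with
      | [::] => unit
      | r' :: D' => pre r' -> penv D' -> pre s'
      end
    with
    | vz _ _ => fun a _ => a
    | vs _ _ _ w => fun _ x => x _ w
    end a x.

Definition vsub D (x : penv D) m : sub D (Gn m) := fun s v => stage_val (x s v) m.

Lemma vsub_cons D r (a : pre r) (x : penv D) m : vsub (pcons a x) m = scons (stage_val a m) (vsub x m).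
Proof. by apply: sub_ext; apply: var_case. Qed.

Definition before D (x : penv D) n := forall s (v : var D s), projT1 (x s v) <= n.

Lemma var_nil s (v : var [::] s) : False.
Proof.
exact: (match v in var L _ return match L with [::] => False | _ => True end with
  vz _ _ => I | vs _ _ _ _ => I end).
Qed.

Lemma before_ex D (x : penv D) : exists n, before x n.
Proof.
elim: D x => [|r D IH] x; first by exists 0 => s v; case: (var_nil v).
have [n hn] := IH (fun s v => x s (vs v)).
exists (maxn (projT1 (x r vz)) n); apply: var_case => [|s v].
  exact: leq_maxl.
exact: leq_trans (hn s v) (leq_maxr _ _).
Qed.

Lemma before_le D (x : penv D) n m : n <= m -> before x n -> before x m.
Proof. by move=> nm h s v; exact: leq_trans (h s v) nm. Qed.

Lemma fsub_vsub_step D (x : penv D) n (A : form D) : before x n ->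
  fsub A (vsub x n.+1) = fshift (rn n) (fsub A (vsub x n)).
Proof.
move=> b; rewrite /fshift fsub_fsub; congr fsub; apply: sub_ext => s v.
by rewrite /vsub val_step ?b // tren_as_tsub.
Qed.

(** Provability at all late stages is closed under each rule stage by stage; persistence from one
    stage to the next is established for hypotheses, in [Tr_in]. *)
Definition Tr D (A : form D) (x : penv D) :=
  exists m0, forall m, m0 <= m -> prov T (Hn m) (fsub A (vsub x m)).

Lemma Tr_in D (A : form D) (x : penv D) n :
  before x n -> List.In (fsub A (vsub x n)) (Hn n) -> Tr A x.
Proof.
move=> b h; exists n => m nm; apply: p_hyp; elim: m nm => [|m IH].
  by rewrite leqn0 => /eqP e; subst n.
rewrite leq_eqVlt => /orP [/eqP e|nm]; first by subst n.
rewrite fsub_vsub_step; last exact: before_le b.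
by apply: Hn_step; exact: IH.
Qed.

(** Once all parameters have appeared, the formula with its parameters inserted is a single listed
    formula. It is listed again later, and at that stage it or its negation becomes a hypothesis. *)
Lemma handled D (A : form D) (x : penv D) : exists m, before x m /\
  ((Tr A x /\ forall s B, fsub A (vsub x m) = Ex s B -> exists t : term (Gn m.+1) s,
       List.In (fsub B (scons t (fun s v => Var (vs v)) : sub _ (Gn m.+1))) (Hn m.+1))
   \/ Tr (Neg A) x).
Proof.
have [n bn] := before_ex x.
have [m [nm em]] := enumP (existT _ (Gn n) (fsub A (vsub x n))) n.
have bm := before_le nm bn.
have bm1 := before_le (leqnSn m) bm.
exists m; split => //.
have e : task m (Gn m) = fsub A (vsub x m).
  rewrite /task em /= fsub_fsub; congr fsub; apply: sub_ext => s v.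
  by rewrite /vsub val_val.
case: (Hn_dec e) => [[h1 h2]|h].
- left; split; last exact: h2.
  by apply: (Tr_in bm1); rewrite fsub_vsub_step.
- by right; apply: (Tr_in bm1); rewrite fsub_vsub_step.
Qed.

Lemma Tr_dec D (A : form D) x : Tr A x \/ Tr (Neg A) x.
Proof. by case: (handled A x) => m [_ [[h _]|h]]; [left|right]. Qed.

Lemma Tr_rule1 D D1 (A : form D) x (B : form D1) y :
  (forall m, prov T (Hn m) (fsub A (vsub x m)) -> prov T (Hn m) (fsub B (vsub y m))) ->
  Tr A x -> Tr B y.
Proof. by move=> h [n hn]; exists n => m nm; apply: h; exact: hn. Qed.

Lemma Tr_rule2 D D1 D2 (A : form D) x (B : form D1) y (C : form D2) z :
  (forall m, prov T (Hn m) (fsub A (vsub x m)) -> prov T (Hn m) (fsub B (vsub y m)) ->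
     prov T (Hn m) (fsub C (vsub z m))) ->
  Tr A x -> Tr B y -> Tr C z.
Proof.
move=> h [n hn] [k hk]; exists (maxn n k) => m; rewrite geq_max => /andP [nm km].
by apply: h; [exact: hn|exact: hk].
Qed.

Lemma Tr_bot D (x : penv D) : ~ Tr Bot x.
Proof. by case=> n h; exact: (Hn_cons (h n (leqnn n))). Qed.

Lemma Tr_neg D (A : form D) x : Tr (Neg A) x <-> ~ Tr A x.
Proof.
split; last by case: (Tr_dec A x).
move=> h h'; apply: (@Tr_bot _ x); apply: Tr_rule2 h h' => m.
exact: p_impE.
Qed.

Lemma Tr_and D (A B : form D) x : Tr (And A B) x <-> Tr A x /\ Tr B x.
Proof.
split=> [h|[]].
  by split; apply: Tr_rule1 h => m; [exact: p_andE1|exact: p_andE2].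
by apply: Tr_rule2 => m; exact: p_andI.
Qed.

(** Truth decides each disjunct; a true disjunction with two rejected disjuncts would make some
    stage inconsistent. *)
Lemma Tr_or D (A B : form D) x : Tr (Or A B) x <-> Tr A x \/ Tr B x.
Proof.
split=> [h|[]]; last first.
- by apply: Tr_rule1 => m; exact: p_orI2.
- by apply: Tr_rule1 => m; exact: p_orI1.
case: (Tr_dec A x) => hA; first by left.
case: (Tr_dec B x) => hB; first by right.
have h2 := (Tr_and (Neg A) (Neg B) x).2 (conj hA hB).
case: (@Tr_bot _ x); apply: Tr_rule2 h h2 => m /= h h2.
(* Both derivations become antecedents of a nested implication, which is then derived from its own
   hypotheses. *)
apply: p_impE h2; apply: p_impE h; apply: p_impI; apply: p_impI.
apply: p_orE; first by apply: p_hyp; right; left.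
- apply: p_impE; last by apply: p_hyp; left.
  by apply: p_andE1; apply: p_hyp; right; left.
- apply: p_impE; last by apply: p_hyp; left.
  by apply: p_andE2; apply: p_hyp; right; left.
Qed.

Lemma Tr_imp D (A B : form D) x : Tr (Imp A B) x <-> (Tr A x -> Tr B x).
Proof.
split=> [h h'|h]; first by apply: Tr_rule2 h h' => m; exact: p_impE.
case: (Tr_dec A x) => [/h|].
  apply: Tr_rule1 => m; apply: p_impE; apply: p_impI; apply: p_impI.
  by apply: p_hyp; right; left.
apply: Tr_rule1 => m; apply: p_impE; apply: p_impI; apply: p_impI.
apply: p_dne; apply: p_impI; apply: p_impE; last by apply: p_hyp; right; left.
by apply: p_hyp; right; right; left.
Qed.

(** The witness is the one added at the stage where the existential formula was decided. *)
Lemma Tr_ex D s (A : form (s :: D)) x : Tr (Ex s A) x <-> exists a, Tr A (pcons a x).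
Proof.
split=> [h|[a]]; last first.
  apply: Tr_rule1 => m /=; rewrite vsub_cons -inst_lift; exact: p_exI.
have [m [b [[_ hw]|/Tr_neg //]]] := handled (Ex s A) x.
have [t ht] := hw _ _ erefl.
exists (existT _ m.+1 t : pre s); apply: (@Tr_in _ _ _ m.+1).
  by apply: var_case => //= r v; apply: leq_trans (b _ v) (leqnSn m).
move: ht; rewrite fsub_fsub vsub_cons val_here.
congr (List.In (fsub _ _) _); apply: sub_ext; apply: var_case => //= r v.
by rewrite tsub_tren /= /vsub val_step ?b // tren_as_tsub.
Qed.

Lemma prov_all_not_ex_not G (H : list (form G)) s (B : form (s :: G)) :
  prov T H (Neg (Ex s (Neg B))) -> prov T H (All s B).
Proof.
apply: p_impE; apply: p_impI; apply: p_allI; apply: p_dne; apply: p_impI.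
apply: (p_impE (A := Ex s (fsub (Neg B) (lift_sub (fun r v => Var (shift s v)))))).
  by apply: p_hyp; right; left.
by apply: (p_exI (t := Var vz)); rewrite inst_lift scons_vz; apply: p_hyp; left.
Qed.

Lemma Tr_all D s (A : form (s :: D)) x : Tr (All s A) x <-> forall a, Tr A (pcons a x).
Proof.
split=> [h a|h].
  by apply: Tr_rule1 h => m /=; rewrite vsub_cons -inst_lift; exact: p_allE.
case: (Tr_dec (Ex s (Neg A)) x) => [/Tr_ex [a /Tr_neg] //|].
by apply: Tr_rule1 => m; exact: prov_all_not_ex_not.
Qed.

Lemma Tr_ax D (A : form D) x : T A -> Tr A x.
Proof. by move=> h; exists 0 => m _; apply: p_ax; exact: T_closed. Qed.

(** * The extensional term model *)

Definition papp s t (f : pre (s ⟶ t)%ty) (a : pre s) : pre t :=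
  existT _ (maxn (projT1 f) (projT1 a))
    (App (stage_val f (maxn (projT1 f) (projT1 a))) (stage_val a (maxn (projT1 f) (projT1 a)))).

Lemma val_papp s t (f : pre (s ⟶ t)%ty) (a : pre s) m :
  maxn (projT1 f) (projT1 a) <= m -> stage_val (papp f a) m = App (stage_val f m) (stage_val a m).
Proof. by move=> h; rewrite {1}/stage_val /= !val_val // ?leq_maxl ?leq_maxr. Qed.

Lemma val_papp_ev s t (f : pre (s ⟶ t)%ty) (a : pre s) :
  exists n, forall m, n <= m -> stage_val (papp f a) m = App (stage_val f m) (stage_val a m).
Proof. by exists (maxn (projT1 f) (projT1 a)) => m; exact: val_papp. Qed.

(** Hereditarily pointwise equality makes the quotient extensional at once; the price is congruence
    in the argument, paid in [eqv_app]. *)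
Fixpoint eqv (s : ty) : pre s -> pre s -> Prop :=
  match s with
  | N => fun a b => exists m0, forall m, m0 <= m -> prov T (Hn m) (Eq0 (stage_val a m) (stage_val b m))
  | Arr r s => fun f g => forall a, eqv (papp f a) (papp g a)
  end.

Lemma prov_sym G (H : list (form G)) t u : prov T H (Eq0 t u) -> prov T H (Eq0 u t).
Proof.
move=> h.
have := @p_leibniz T G H (Eq0 (Var vz) (tren (shift N) t)) t u h.
by rewrite /inst /= !tsub_tren /= !tsub_id; apply; exact: p_refl.
Qed.

Lemma prov_trans G (H : list (form G)) t u v :
  prov T H (Eq0 t u) -> prov T H (Eq0 u v) -> prov T H (Eq0 t v).
Proof.
move=> h h'.
have := @p_leibniz T G H (Eq0 (tren (shift N) t) (Var vz)) u v h'.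
by rewrite /inst /= !tsub_tren /= !tsub_id; apply.
Qed.

Lemma prov_lt G (H : list (form G)) t t' u u' :
  prov T H (Eq0 t t') -> prov T H (Eq0 u u') -> prov T H (Lt0 t u) -> prov T H (Lt0 t' u').
Proof.
move=> h h' h0.
have := @p_leibniz T G H (Lt0 (tren (shift N) t') (Var vz)) u u' h'.
rewrite /inst /= !tsub_tren /= !tsub_id; apply.
have := @p_leibniz T G H (Lt0 (Var vz) (tren (shift N) u)) t t' h.
by rewrite /inst /= !tsub_tren /= !tsub_id; apply.
Qed.

Lemma eqv_refl s (a : pre s) : eqv a a.
Proof. elim: s a => [|r _ s IH] a /=; [by exists 0 => m _; exact: p_refl|by move=> b; exact: IH]. Qed.

Lemma eqv_sym s (a b : pre s) : eqv a b -> eqv b a.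
Proof.
elim: s a b => [|r _ s IH] a b /=; last by move=> h c; apply: IH.
by case=> n h; exists n => m nm; apply: prov_sym; exact: h.
Qed.

Lemma eqv_trans s (a b c : pre s) : eqv a b -> eqv b c -> eqv a c.
Proof.
elim: s a b c => [|r _ s IH] a b c /=; last by move=> h h' d; apply: IH (h d) (h' d).
move=> [n h] [n' h']; exists (maxn n n') => m; rewrite geq_max => /andP [nm nm'].
exact: prov_trans (h m nm) (h' m nm').
Qed.

Lemma eqv_eventually s (a b : pre s) n : (forall m, n <= m -> stage_val a m = stage_val b m) -> eqv a b.
Proof.
elim: s a b n => [|r _ s IH] a b n /= h; first by exists n => m nm; rewrite h //; exact: p_refl.
move=> c; apply: (IH _ _ (maxn n (maxn (maxn (projT1 a) (projT1 c)) (maxn (projT1 b) (projT1 c))))).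
by move=> m; rewrite 2!geq_max => /and3P [nm am bm]; rewrite !val_papp // h.
Qed.

Definition peval D s (t : term D s) (x : penv D) : pre s :=
  existT _ (sval (cid (before_ex x))) (tsub (vsub x (sval (cid (before_ex x)))) t).

Lemma val_peval D s (t : term D s) (x : penv D) :
  exists n, forall m, n <= m -> stage_val (peval t x) m = tsub (vsub x m) t.
Proof.
rewrite /peval; case: (cid (before_ex x)) => n b; exists n => m nm.
rewrite (tsub_tsub (vsub x n) (suffix_sub (Gn n) (Gn m)) t : stage_val (existT _ n _) m = _).
congr (tsub _ t); apply: sub_ext => r v.
by rewrite /vsub val_val.
Qed.

Lemma peval_app D s t (f : term D (s ⟶ t)%ty) (u : term D s) (x : penv D) :
  eqv (peval (App f u) x) (papp (peval f x) (peval u x)).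
Proof.
have [n hn] := val_peval (App f u) x.
have [n1 h1] := val_peval f x.
have [n2 h2] := val_peval u x.
apply: (@eqv_eventually _ _ _ (maxn (maxn n (maxn (projT1 (peval f x)) (projT1 (peval u x)))) (maxn n1 n2))).
move=> m; rewrite !geq_max => /andP [/and3P [a b c] /andP [d e]].
have bc : maxn (projT1 (peval f x)) (projT1 (peval u x)) <= m by rewrite geq_max b.
by rewrite hn // val_papp // h1 // h2.
Qed.

Lemma peval_var D s (v : var D s) (x : penv D) : eqv (peval (Var v) x) (x s v).
Proof. by have [n hn] := val_peval (Var v) x; apply: (@eqv_eventually _ _ _ n) => m /hn. Qed.

(** Both sides are quantifications over all pre-elements, and a weakened term applied to the new
    variable has the same late values as [papp]. *)
Lemma Tr_eqt s : forall D (t u : term D s) (x : penv D),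
  Tr (eqt t u) x <-> eqv (peval t x) (peval u x).
Proof.
elim: s => [|r _ s IH] D t u x /=.
  have [n1 h1] := val_peval t x.
  have [n2 h2] := val_peval u x.
  split=> [[n h]|[n h]]; exists (maxn n (maxn n1 n2)) => m; rewrite !geq_max => /and3P [a b c].
    by rewrite h1 // h2 //; exact: h.
  by rewrite /= -h1 // -h2 //; exact: h.
have key (a : pre r) (w : term D (r ⟶ s)%ty) :
    eqv (peval (tren (shift r) w · Var vz)%tm (pcons a x)) (papp (peval w x) a).
  apply: eqv_trans (peval_app _ _ _) _.
  have [n0 h0] := @val_peval (r :: D) r (Var vz) (pcons a x).
  have [n1 h1] := val_peval (tren (shift r) w) (pcons a x).
  have [n2 h2] := val_peval w x.
  have [n3 h3] := val_papp_ev (peval (tren (shift r) w) (pcons a x)) (peval (Var vz) (pcons a x)).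
  have [n4 h4] := val_papp_ev (peval w x) a.
  apply: (@eqv_eventually _ _ _ (maxn (maxn n3 n4) (maxn (maxn n0 n1) n2))).
  move=> m; rewrite !geq_max => /andP [/andP [b3 b4] /andP [/andP [b0 b1] b2]].
  by rewrite h3 // h4 // h0 // h1 // h2 // vsub_cons tsub_tren.
rewrite Tr_all; split=> h a.
  apply: eqv_trans (eqv_sym (key a t)) _; apply: eqv_trans (key a u).
  exact: ((IH _ _ _ _).1 (h a)).
apply: (IH _ _ _ _).2; apply: eqv_trans (key a t) _; apply: eqv_trans (eqv_sym (key a u)).
exact: h.
Qed.

(** In the function part congruence is the definition of [eqv]. In the argument it is the
    extensionality axiom, true by [Tr_ax] and read back through [Tr_eqt]. *)
Lemma eqv_app s t (f f' : pre (s ⟶ t)%ty) (a a' : pre s) :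
  eqv f f' -> eqv a a' -> eqv (papp f a) (papp f' a').
Proof.
move=> hf ha; apply: eqv_trans (hf a) _ => {f hf}.
pose x : penv [::] := fun s v => False_rect _ (var_nil v).
pose y : penv [:: (s ⟶ t)%ty; s; s] := pcons f' (pcons a' (pcons a x)).
have := Tr_ax x (@T_ext s t [::]).
move/Tr_all => /(_ a) /Tr_all => /(_ a') /Tr_all => /(_ f') /Tr_imp.
rewrite -/y => h.
have ev0 (v : var [:: (s ⟶ t)%ty; s; s] s) : eqv (peval (Var v) y) (y s v) by exact: peval_var.
have ev1 : eqv (peval (Var vz) y) f' by exact: peval_var.
have {}h : Tr (eqt (Var vz · Var (vs (vs vz))) (Var vz · Var (vs vz)))%tm y.
  apply: h; apply: (Tr_eqt _ _ _).2.
  exact: eqv_trans (ev0 (vs (vs vz))) (eqv_trans ha (eqv_sym (ev0 (vs vz)))).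
have key (v : var [:: (s ⟶ t)%ty; s; s] s) : eqv (peval (Var vz · Var v)%tm y) (papp f' (y s v)).
  apply: eqv_trans (peval_app _ _ _) _.
  have [n1 h1] := val_peval (Var v) y.
  have [n2 h2] := val_peval (Var vz : term [:: (s ⟶ t)%ty; s; s] _) y.
  have [n3 h3] := val_papp_ev (peval (Var vz) y) (peval (Var v) y).
  have [n4 h4] := val_papp_ev f' (y s v).
  apply: (@eqv_eventually _ _ _ (maxn (maxn n1 n2) (maxn n3 n4))) => m.
  by rewrite !geq_max => /andP [/andP [b1 b2] /andP [b3 b4]]; rewrite h3 // h1 // h2 // h4.
exact: eqv_trans (eqv_sym (key (vs (vs vz)))) (eqv_trans ((Tr_eqt _ _ _).1 h) (key (vs vz))).
Qed.

Definition hdom s := {P : pre s -> Prop | exists a, P = @eqv s a}.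
Definition cls s (a : pre s) : hdom s := exist _ (@eqv s a) (ex_intro _ a erefl).

Lemma cls_eq s (a b : pre s) : cls a = cls b <-> eqv a b.
Proof.
split=> [[e]|h]; first by rewrite e; exact: eqv_refl.
suff e : @eqv s a = @eqv s b by apply: eq_exist.
apply: funext => c; apply: propext; split; first exact: eqv_trans (eqv_sym h).
exact: eqv_trans.
Qed.

Definition rep s (d : hdom s) : pre s := sval (cid (svalP d)).

Lemma cls_rep s (d : hdom s) : cls (rep d) = d.
Proof.
rewrite /rep; case: (cid (svalP d)) => a /=; case: d => P hP /= e.
exact: eq_exist.
Qed.

Lemma cls_surj s (d : hdom s) : exists a, d = cls a.
Proof. by exists (rep d); rewrite cls_rep. Qed.

Definition hap s t (f : hdom (s ⟶ t)%ty) (a : hdom s) : hdom t := cls (papp (rep f) (rep a)).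

Lemma hap_cls s t (f : pre (s ⟶ t)%ty) (a : pre s) : hap (cls f) (cls a) = cls (papp f a).
Proof. by apply/cls_eq; apply: eqv_app; apply/cls_eq; rewrite cls_rep. Qed.

Lemma hdom_ext s t (f g : hdom (s ⟶ t)%ty) : (forall a, hap f a = hap g a) -> f = g.
Proof.
have [f' ->] := cls_surj f; have [g' ->] := cls_surj g => h.
by apply/cls_eq => a; apply/cls_eq; rewrite -!hap_cls.
Qed.

Definition hconst s (t : forall G, term G s) : hdom s := cls (existT _ 0 (t (Gn 0))).

Definition hlt (a b : hdom N) : Prop :=
  exists m0, forall m, m0 <= m -> prov T (Hn m) (Lt0 (stage_val (rep a) m) (stage_val (rep b) m)).

Definition henkin : model := @Model hdom hap
  (hconst (fun G => Zero)) (hconst (fun G => One)) (hconst (fun G => Plus)) (hconst (fun G => Times))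
  (fun s t => hconst (fun G => CombK s t)) (fun r s t => hconst (fun G => CombS r s t))
  (hconst (fun G => Rec0)) hlt hdom_ext.

Fixpoint henv (D : ctx) : penv D -> env henkin D :=
  match D with
  | [::] => fun _ => tt
  | r :: D => fun x => (cls (x r vz), henv (fun s v => x s (vs v)))
  end.

Lemma henv_surj D (e : env henkin D) : exists x, e = henv x.
Proof.
elim: D e => [|r D IH] e /=.
  by exists (fun s v => False_rect _ (var_nil v)); case: e.
case: e => d e; have [a ->] := cls_surj d; have [x ->] := IH e.
by exists (pcons a x).
Qed.

Lemma lookup_henv D s (v : var D s) (x : penv D) : lookup v (henv x) = cls (x s v).
Proof. by elim: v x => {D s} [D s|D s r v IH] x //=; rewrite IH. Qed.

Lemma semt_henv D s (t : term D s) (x : penv D) : semt t (henv x) = cls (peval t x).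
Proof.
have const r (c : forall G, term G r) (h : forall G E (y : sub G E), tsub y (c G) = c E) :
    hconst c = cls (peval (c D) x).
  apply/cls_eq; have [n hn] := val_peval (c D) x.
  apply: (@eqv_eventually _ _ _ n) => m nm; rewrite hn // h.
  exact: (h _ _ (suffix_sub (Gn 0) (Gn m))).
elim: t => {s} [s v|||||s t|r s t||s t f IHf u IHu] /=; try exact: const.
  by rewrite lookup_henv; apply/cls_eq; apply: eqv_sym; exact: peval_var.
by rewrite IHf IHu hap_cls; apply/cls_eq; apply: eqv_sym; exact: peval_app.
Qed.

Lemma truth D (A : form D) (x : penv D) : sem (M := henkin) A (henv x) <-> Tr A x.
Proof.
elim: A x => {D} [D|D t u|D t u|D A IHA B IHB|D A IHA B IHB|D A IHA B IHB|D s A IH|D s A IH] x /=.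
- by split=> // /Tr_bot.
- rewrite !semt_henv cls_eq -Tr_eqt; by [].
- rewrite !semt_henv /hlt.
  have [n1 h1] := val_peval t x.
  have [n2 h2] := val_peval u x.
  (* [hlt] refers to chosen representatives, which are provably equal to the evaluated terms only
     from some stage on. *)
  have [n3 h3] : eqv (rep (cls (peval t x))) (peval t x) by apply/cls_eq; rewrite cls_rep.
  have [n4 h4] : eqv (rep (cls (peval u x))) (peval u x) by apply/cls_eq; rewrite cls_rep.
  split=> -[n h]; exists (maxn n (maxn (maxn n1 n2) (maxn n3 n4))) => m;
    rewrite !geq_max => /andP [a /andP [/andP [b1 b2] /andP [b3 b4]]].
    rewrite /= -h1 // -h2 //; exact: prov_lt (h3 _ b3) (h4 _ b4) (h m a).
  apply: prov_lt (prov_sym (h3 _ b3)) (prov_sym (h4 _ b4)) _.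
  by rewrite h1 // h2 //; exact: h.
- by rewrite IHA IHB Tr_and.
- by rewrite IHA IHB Tr_or.
- by rewrite IHA IHB Tr_imp.
- rewrite Tr_all; split=> h a; first by apply/IH; exact: h.
  by have [b ->] := cls_surj a; apply: ((IH (pcons b x)).2 (h b)).
- rewrite Tr_ex; split=> -[a h]; last by exists (cls a); exact: ((IH (pcons a x)).2 h).
  by have [b e] := cls_surj a; exists b; apply/IH; rewrite e in h; exact: h.
Qed.

Lemma henkin_models : models henkin T.
Proof. by move=> D A e TA; have [x ->] := henv_surj e; apply/truth; exact: Tr_ax. Qed.

Lemma henkin_A0 : ~ sem (M := henkin) A0 tt.
Proof.
pose x : penv [::] := fun s v => False_rect _ (var_nil v).
move=> h; have hA : Tr A0 x by apply: (truth A0 x).1.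
suff /Tr_neg : Tr (Neg A0) x by [].
apply: (@Tr_in _ _ _ 0); first by move=> s v; case: (var_nil v).
left; congr Neg; rewrite -[LHS]fsub_id; congr fsub; apply: sub_ext => s v; case: (var_nil v).
Qed.

End Completeness.

Theorem completeness (T : theory) : fsub_closed T ->
  (forall r t G, @T G (∀ x ∷ r, ∀ y ∷ r, ∀ p ∷ (r ⟶ t)%ty, eqt (↑x) (↑y) ⇒ eqt (p · ↑x) (p · ↑y))%fm) ->
  forall A : form [::], (forall M : model, models M T -> sem (M := M) A tt) -> provable T A.
Proof.
move=> Tcl Text A h; apply: contrapT => nA.
have [e he] := sform_enum.
exact: (@henkin_A0 T Tcl Text A nA e he (h _ (@henkin_models T Tcl Text A nA e he))).
Qed.

Record aca_model := AcaModel { aca_carrier :> model; acaP : models aca_carrier ACA0w }.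

(** * Arithmetical comprehension and choice from mu *)

Section Interpretation.
Variable M : model.

Lemma semt_tren G D (r : ren G D) s (t : term G s) (e : env M G) (e' : env M D) :
  (forall s v, lookup (r s v) e' = lookup v e) -> semt (tren r t) e' = semt t e.
Proof. by move=> h; elim: t => //= s' t' f -> u ->. Qed.

Lemma semt_up_here G s (t : term G s) (e : env M G) : semt (@up G G (@wk_here G) s t) e = semt t e.
Proof. exact: semt_tren. Qed.

Lemma semt_up_there G D r (w : Wk G D) s (t : term G s) (a : dom M r) (e : env M D) :
  semt (@up G (r :: D) (@wk_there G D r w) s t) (a, e) = semt (@up G D w s t) e.
Proof.
elim: t => //= s' t' f IHf u IHu.
by congr ap; [exact: IHf|exact: IHu].
Qed.

Definition semt_up := (semt_up_there, semt_up_here).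

Lemma sem_eqt s : forall G (t u : term G s) (e : env M G), sem (eqt t u) e <-> semt t e = semt u e.
Proof.
elim: s => //= r _ s IH G t u e; split=> h.
  by apply: dom_ext => a; have /IH /= := h a; rewrite !semt_up.
by move=> a; apply/IH; rewrite /= !semt_up h.
Qed.

End Interpretation.

Section Arithmetic.
Variable M : aca_model.

Notation "0" := (@m0 M).
Notation "1" := (@m1 M).
Notation "x + y" := (ap (ap (@mplus M) x) y).
Notation "x * y" := (ap (ap (@mtimes M) x) y).
Notation "x < y" := (@mlt M x y).
Notation num := (dom M N).

Lemma RCA_sound G (A : form G) (e : env M G) : RCA0w A -> sem A e.
Proof. by move=> h; apply: (@acaP M); exact: aca_rca. Qed.

Lemma K_eq s t (x : dom M s) (y : dom M t) : ap (ap (mK s t) x) y = x.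
Proof.
have : sem (eqt (CombK s t · Var (vs vz) · Var vz) (Var (vs vz)))%tm ((y, (x, tt)) : env M [:: t; s]).
  exact: (RCA_sound (tt : env M [::]) (@ax_K s t [::]) x y).
by move/sem_eqt.
Qed.

Lemma S_eq r s t (x : dom M (r ⟶ s ⟶ t)) (y : dom M (r ⟶ s)) (z : dom M r) :
  ap (ap (ap (mS r s t) x) y) z = ap (ap x z) (ap y z).
Proof.
pose t1 : term [:: r; r ⟶ s; r ⟶ s ⟶ t]%ty t := (CombS r s t · Var (vs (vs vz)) · Var (vs vz) · Var vz)%tm.
pose t2 : term [:: r; r ⟶ s; r ⟶ s ⟶ t]%ty t := (Var (vs (vs vz)) · Var vz · (Var (vs vz) · Var vz))%tm.
have : sem (eqt t1 t2) ((z, (y, (x, tt))) : env M [:: r; r ⟶ s; r ⟶ s ⟶ t]%ty).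
  exact: (RCA_sound (tt : env M [::]) (@ax_S r s t [::]) x y z).
by move/sem_eqt.
Qed.

Lemma R_0 (f : dom M T1) (m : num) : ap (ap (ap mR f) m) 0 = m.
Proof. exact: (RCA_sound (tt : env M [::]) (@ax_R0 [::]) f m). Qed.

Lemma R_S (f : dom M T1) (m n : num) : ap (ap (ap mR f) m) (n + 1) = ap f (ap (ap (ap mR f) m) n).
Proof. exact: (RCA_sound (tt : env M [::]) (@ax_RS [::]) f m n). Qed.

Lemma n_addA (x y z : num) : x + (y + z) = x + y + z.
Proof. by symmetry; exact: (RCA_sound (tt : env M [::]) (@ax_addA [::]) x y z). Qed.
Lemma n_addC (x y : num) : x + y = y + x.
Proof. exact: (RCA_sound (tt : env M [::]) (@ax_addC [::]) x y). Qed.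
Lemma n_mulA (x y z : num) : x * (y * z) = x * y * z.
Proof. by symmetry; exact: (RCA_sound (tt : env M [::]) (@ax_mulA [::]) x y z). Qed.
Lemma n_mulC (x y : num) : x * y = y * x.
Proof. exact: (RCA_sound (tt : env M [::]) (@ax_mulC [::]) x y). Qed.
Lemma n_mulD (x y z : num) : x * (y + z) = x * y + x * z.
Proof. exact: (RCA_sound (tt : env M [::]) (@ax_mulD [::]) x y z). Qed.
Lemma n_add0 (x : num) : x + 0 = x.
Proof. exact: (RCA_sound (tt : env M [::]) (@ax_add0 [::]) x). Qed.
Lemma n_mul0 (x : num) : x * 0 = 0.
Proof. exact: (RCA_sound (tt : env M [::]) (@ax_mul0 [::]) x). Qed.
Lemma n_mul1 (x : num) : x * 1 = x.
Proof. exact: (RCA_sound (tt : env M [::]) (@ax_mul1 [::]) x). Qed.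
Lemma n_lt_trans (x y z : num) : x < y -> y < z -> x < z.
Proof. by move=> h h'; apply: (RCA_sound (tt : env M [::]) (@ax_ltT [::]) x y z); split. Qed.
Lemma n_lt_irr (x : num) : ~ x < x.
Proof. exact: (RCA_sound (tt : env M [::]) (@ax_ltI [::]) x). Qed.
Lemma n_lt_tri (x y : num) : x < y \/ x = y \/ y < x.
Proof. exact: (RCA_sound (tt : env M [::]) (@ax_ltL [::]) x y). Qed.
Lemma n_lt_add (x y z : num) : x < y -> x + z < y + z.
Proof. exact: (RCA_sound (tt : env M [::]) (@ax_ltD [::]) x y z). Qed.
Lemma n_lt_mul (x y z : num) : 0 < z -> x < y -> x * z < y * z.
Proof. by move=> h h'; apply: (RCA_sound (tt : env M [::]) (@ax_ltM [::]) x y z); split. Qed.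
Lemma n_lt_sub (x y : num) : x < y -> exists z, x + z = y.
Proof. exact: (RCA_sound (tt : env M [::]) (@ax_ltB [::]) x y). Qed.
Lemma n_lt01 : 0 < 1.
Proof. exact: (RCA_sound (tt : env M [::]) (@ax_01 [::])). Qed.
Lemma n_discrete (x : num) : 0 < x -> 1 < x \/ 1 = x.
Proof. exact: (RCA_sound (tt : env M [::]) (@ax_disc [::]) x). Qed.
Lemma n_ge0 (x : num) : 0 < x \/ 0 = x.
Proof. exact: (RCA_sound (tt : env M [::]) (@ax_ge0 [::]) x). Qed.

Lemma n_0neq1 : 0 <> 1.
Proof. by move=> h; apply: (@n_lt_irr 0); rewrite {2}h; exact: n_lt01. Qed.

Lemma mu_ex : exists mu : dom M (T1 ⟶ N)%ty, forall f : dom M T1,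
  (exists n, ap f n = 0) -> ap f (ap mu f) = 0.
Proof. exact: (@acaP M [::] mu2 tt (aca_mu _)). Qed.

(** Functions of the environment given by applicative expressions with parameters from the model;
    these are what the combinators can abstract. *)
Inductive Rep (G : ctx) : forall s, (env M G -> dom M s) -> Prop :=
| Rep_var s (v : var G s) : Rep (lookup v)
| Rep_const s (c : dom M s) : Rep (fun _ : env M G => c)
| Rep_app s t (f : env M G -> dom M (s ⟶ t)%ty) (u : env M G -> dom M s) :
    Rep f -> Rep u -> Rep (fun e => ap (f e) (u e)).

(** Combinatory completeness by bracket abstraction, with [S K K] as the identity. *)
Lemma Rep_lam G r s (phi : env M (r :: G) -> dom M s) : Rep phi ->
  exists psi : env M G -> dom M (r ⟶ s)%ty, Rep psi /\ forall e a, ap (psi e) a = phi (a, e).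
Proof.
elim=> {s phi} [s v|s c|s t f u _ [f' [Rf hf]] _ [u' [Ru hu]]].
- move: s v; apply: var_case => [|s v].
    exists (fun _ => ap (ap (mS r (r ⟶ r)%ty r) (mK r (r ⟶ r)%ty)) (mK r r)); split; first exact: Rep_const.
    by move=> e a; rewrite S_eq K_eq.
  exists (fun e => ap (mK s r) (lookup v e)); split; last by move=> e a; rewrite K_eq.
  by apply: Rep_app; [exact: Rep_const|exact: Rep_var].
- exists (fun _ => ap (mK s r) c); split; first exact: Rep_const.
  by move=> e a; rewrite K_eq.
- exists (fun e => ap (ap (mS r s t) (f' e)) (u' e)); split; last by move=> e a; rewrite S_eq hf hu.
  by apply: Rep_app => //; apply: Rep_app => //; exact: Rep_const.
Qed.

Lemma Rep_fun1 s t (phi : dom M s -> dom M t) :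
  Rep (G := [:: s]) (fun e => phi e.1) -> exists f : dom M (s ⟶ t)%ty, forall a, ap f a = phi a.
Proof. by move/Rep_lam => [psi [_ h]]; exists (psi tt) => a; rewrite h. Qed.

Lemma Rep_fun2 s s' t (phi : dom M s -> dom M s' -> dom M t) :
  Rep (G := [:: s'; s]) (fun e => phi e.2.1 e.1) ->
  exists f : dom M (s ⟶ s' ⟶ t)%ty, forall a b, ap (ap f a) b = phi a b.
Proof.
move/Rep_lam => [psi [Rpsi h]].
have [|f hf] := @Rep_fun1 s (s' ⟶ t)%ty (fun a => psi (a, tt)).
  by have -> // : (fun e : env M [:: s] => psi (e.1, tt)) = psi; apply: funext => -[a []].
by exists f => a b; rewrite hf h.
Qed.

Lemma Rep_fun3 s s' s'' t (phi : dom M s -> dom M s' -> dom M s'' -> dom M t) :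
  Rep (G := [:: s''; s'; s]) (fun e => phi e.2.2.1 e.2.1 e.1) ->
  exists f : dom M (s ⟶ s' ⟶ s'' ⟶ t)%ty, forall a b c, ap (ap (ap f a) b) c = phi a b c.
Proof.
move/Rep_lam => [psi [Rpsi h]].
have [|f hf] := @Rep_fun2 s s' (s'' ⟶ t)%ty (fun a b => psi (b, (a, tt))).
  by have -> // : (fun e : env M [:: s'; s] => psi (e.1, (e.2.1, tt))) = psi; apply: funext => -[a [b []]].
by exists f => a b c; rewrite hf h.
Qed.

(* A predicate is arithmetical here when its characteristic function, with values 0 for
   truth and 1 for falsity, is given by a term with parameters. *)
Definition Arith G (P : env M G -> Prop) :=
  exists chi : env M G -> num, Rep chi /\ forall e, (P e -> chi e = 0) /\ (~ P e -> chi e = 1).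

Lemma Arith_iff G (P Q : env M G -> Prop) : (forall e, P e <-> Q e) -> Arith P -> Arith Q.
Proof.
move=> h [chi [Rchi hchi]]; exists chi; split=> // e; rewrite -h; exact: hchi.
Qed.

Lemma Arith_not G (P : env M G -> Prop) : Arith P -> Arith (fun e => ~ P e).
Proof.
(* Iterating the constant function 0 from 1 gives 1 after no step and 0 after one step. *)
case=> chi [Rchi h]; exists (fun e => ap (ap (ap mR (ap (mK N N) 0)) 1) (chi e)); split.
  by apply: Rep_app => //; exact: Rep_const.
move=> e; have [h1 h2] := h e; split; last by move/contrapT/h1 => ->; rewrite R_0.
by move/h2 => ->; rewrite -(n_add0 1) n_addC R_S K_eq.
Qed.

Lemma Arith_and G (P Q : env M G -> Prop) : Arith P -> Arith Q -> Arith (fun e => P e /\ Q e).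
Proof.
case=> chi [Rchi h] [chi' [Rchi' h']].
(* Iterating the constant function 1 from [chi' e] leaves [chi' e] if [P] holds and gives 1
   otherwise. *)
exists (fun e => ap (ap (ap mR (ap (mK N N) 1)) (chi' e)) (chi e)); split.
  by apply: Rep_app => //; apply: Rep_app => //; exact: Rep_const.
move=> e; have [h1 h2] := h e; have [h1' h2'] := h' e; split.
  by move=> [/h1 -> /h1' ->]; rewrite R_0.
case: (pselect (P e)) => [p|/h2 -> _]; last by rewrite -[X in ap _ X](n_add0 1) n_addC R_S K_eq.
by rewrite (h1 p) R_0 => n; apply: h2' => q; apply: n.
Qed.

Lemma Arith_or G (P Q : env M G -> Prop) : Arith P -> Arith Q -> Arith (fun e => P e \/ Q e).
Proof.
move=> hP hQ; apply: Arith_iff (Arith_not (Arith_and (Arith_not hP) (Arith_not hQ))) => e.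
by split=> [/not_andP [/contrapT|/contrapT]|[h []|h []]]; [left|right| |].
Qed.

Lemma Arith_imp G (P Q : env M G -> Prop) : Arith P -> Arith Q -> Arith (fun e => P e -> Q e).
Proof.
move=> hP hQ; apply: Arith_iff (Arith_not (Arith_and hP (Arith_not hQ))) => e.
split=> [h p|h [p q]]; last exact: q (h p).
by apply: contrapT => q; apply: h.
Qed.

(** Here arithmetical comprehension enters: [mu] finds a zero of the characteristic function if
    there is one, so the value of that function at the point found decides the existential
    statement. *)
Lemma Arith_ex G (P : env M G -> num -> Prop) :
  Arith (G := N :: G) (fun e => P e.2 e.1) -> Arith (fun e => exists n, P e n).
Proof.
case=> chi [Rchi h]; have [mu hmu] := mu_ex; have [psi [Rpsi hpsi]] := Rep_lam Rchi.
exists (fun e => ap (psi e) (ap mu (psi e))); split.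
  by apply: Rep_app => //; apply: Rep_app => //; exact: Rep_const.
move=> e; split=> [[n hn]|hn].
  by apply: hmu; exists n; rewrite hpsi; exact: (h (n, e)).1.
by rewrite hpsi; apply: (h (_, e)).2 => hP; apply: hn; exists (ap mu (psi e)).
Qed.

Lemma Arith_all G (P : env M G -> num -> Prop) :
  Arith (G := N :: G) (fun e => P e.2 e.1) -> Arith (fun e => forall n, P e n).
Proof.
move/Arith_not => hP; apply: Arith_iff (Arith_not (Arith_ex (P := fun e n => ~ P e n) hP)) => e.
split=> [h n|h [n]]; last exact.
by apply: contrapT => hn; apply: h; exists n.
Qed.

(** Quantifier-free choice of the value that this formula demands yields the characteristic
    functional of [A]. *)
Definition dec_form (A : form [:: N; T1]) : form [:: N; T1] :=
  (A ∧ Var vz ≐ Zero ∨ ¬ A ∧ Var vz ≐ One)%fm.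

(** The available choice takes an argument of type 1, so two numbers are passed as the values at 0
    and 1 of one sequence, obtained by iterating a constant function. *)
Lemma Arith_pair (P : num -> num -> Prop) (Y : dom M (T1 ⟶ N)%ty) G (f g : env M G -> num) :
  (forall x, (P (ap x 0) (ap x 1) -> ap Y x = 0) /\ (~ P (ap x 0) (ap x 1) -> ap Y x = 1)) ->
  Rep f -> Rep g -> Arith (fun e => P (f e) (g e)).
Proof.
move=> hY Rf Rg.
have Rgf : Rep (fun e : env M G => ap (ap mR (ap (mK N N) (g e))) (f e)).
  apply: Rep_app => //; apply: Rep_app; first exact: Rep_const.
  by apply: Rep_app => //; exact: Rep_const.
exists (fun e => ap Y (ap (ap mR (ap (mK N N) (g e))) (f e))); split.
  by apply: Rep_app => //; exact: Rep_const.
move=> e; have := hY (ap (ap mR (ap (mK N N) (g e))) (f e)).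
by rewrite R_0 -[X in ap _ X](n_add0 1) n_addC R_S K_eq.
Qed.

Lemma Arith_eq G (f g : env M G -> num) : Rep f -> Rep g -> Arith (fun e => f e = g e).
Proof.
have := RCA_sound (tt : env M [::])
  (@ax_qfac [::] (dec_form (Var (vs vz) · Zero ≐ Var (vs vz) · One)%fm%tm) erefl).
case=> /= [x|Y hY].
  by case: (pselect (ap x 0 = ap x 1)) => h; [exists 0; left|exists 1; right].
apply: (@Arith_pair eq Y) => x.
by split=> h; case: (hY x) => -[].
Qed.

Lemma Arith_lt G (f g : env M G -> num) : Rep f -> Rep g -> Arith (fun e => f e < g e).
Proof.
have := RCA_sound (tt : env M [::])
  (@ax_qfac [::] (dec_form (Var (vs vz) · Zero ≺ Var (vs vz) · One)%fm%tm) erefl).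
case=> /= [x|Y hY].
  by case: (pselect (ap x 0 < ap x 1)) => h; [exists 0; left|exists 1; right].
apply: (@Arith_pair (fun a b => a < b) Y) => x.
by split=> h; case: (hY x) => -[].
Qed.

Lemma Arith_const G (P : Prop) : Arith (fun _ : env M G => P).
Proof.
exists (fun _ => if pselect P then 0 else 1); split; first exact: Rep_const.
by move=> e; case: pselect.
Qed.

(** Quantifier-free induction for an equation with 0, in which the characteristic function is a
    parameter of type 1. *)
Lemma arith_ind (P : num -> Prop) : Arith (G := [:: N]) (fun e => P e.1) ->
  P 0 -> (forall n, P n -> P (n + 1)) -> forall n, P n.
Proof.
case=> chi [/Rep_lam [psi [_ hpsi]] h] P0 PS.
have hP n : P n <-> ap (psi tt) n = 0.
  rewrite hpsi; split=> [p|e]; first exact: (h (n, tt)).1.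
  by apply: contrapT => /(h (n, tt)).2; rewrite e => /n_0neq1.
have := RCA_sound ((psi tt, tt) : env M [:: T1])
  (@ax_ind [:: T1] (Var (vs vz) · Var vz ≐ Zero)%fm%tm erefl).
move=> hi n; apply/hP; apply: hi; split; first exact/hP.
by move=> k /hP /PS /hP.
Qed.

(** The selector applies [mu] to the characteristic function of the solution set. By extensionality
    it depends on that set alone; this last conclusion later makes a gauge respect equality of
    reals. *)
Lemma arith_choice G (P : env M G -> num -> Prop) :
  Arith (G := N :: G) (fun e => P e.2 e.1) -> (forall e, exists n, P e n) ->
  exists phi, [/\ Rep phi, forall e, P e (phi e)
    & forall e e', (forall n, P e n <-> P e' n) -> phi e = phi e'].
Proof.
case=> chi [Rchi h] hP; have [mu hmu] := mu_ex; have [psi [Rpsi hpsi]] := Rep_lam Rchi.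
exists (fun e => ap mu (psi e)); split; first by apply: Rep_app => //; exact: Rep_const.
  move=> e; apply: contrapT => /(h (_, e)).2 /=.
  rewrite -hpsi hmu; first exact: n_0neq1.
  by have [n hn] := hP e; exists n; rewrite hpsi; exact: (h (n, e)).1.
move=> e e' ee'; congr ap; apply: dom_ext => n; rewrite !hpsi.
case: (pselect (P e n)) => p; first by rewrite (h (n, e)).1 // (h (n, e')).1 //; apply/ee'.
by rewrite (h (n, e)).2 // (h (n, e')).2 // => /ee'.
Qed.

Lemma arith_choice_fun (P : num -> num -> Prop) : Arith (G := [:: N; N]) (fun e => P e.2.1 e.1) ->
  (forall n, exists k, P n k) -> exists f : dom M T1, forall n, P n (ap f n).
Proof.
move=> hA hP.
have [|phi [/Rep_lam [psi [_ hpsi]] h _]] := @arith_choice [:: N] (fun e => P e.1) hA.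
  by move=> e; exact: hP.
by exists (psi tt) => n; rewrite hpsi; exact: (h (n, tt)).
Qed.

End Arithmetic.

Ltac rep_var := lazymatch goal with |- @Rep ?M ?G ?s _ => first
  [ exact (@Rep_var M G s vz) | exact (@Rep_var M G s (vs vz)) | exact (@Rep_var M G s (vs (vs vz)))
  | exact (@Rep_var M G s (vs (vs (vs vz)))) | exact (@Rep_var M G s (vs (vs (vs (vs vz)))))
  | exact (@Rep_var M G s (vs (vs (vs (vs (vs vz)))))) ] end.
Ltac rep := repeat first [ assumption | rep_var | exact: Rep_const | apply: Rep_app ].

Import Order.TTheory GRing.Theory Num.Theory.
Local Open Scope ring_scope.
Local Open Scope quotient_scope.

(** * Ordered rings from natural numbers, and their completion *)

Section ClassicalUnits.
Variable R : comNzRingType.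

Definition cl_unit (x : R) : bool := `[< exists y, y * x = 1 >].
Definition cl_inv (x : R) : R :=
  match pselect (exists y, y * x = 1) with left h => sval (cid h) | _ => x end.

Lemma cl_mulVx : {in cl_unit, left_inverse 1 cl_inv *%R}.
Proof. by move=> x /asboolP h; rewrite /cl_inv; case: pselect => // h'; case: cid. Qed.
Lemma cl_unitPl (x y : R) : y * x = 1 -> cl_unit x.
Proof. by move=> h; apply/asboolP; exists y. Qed.
Lemma cl_inv_out : {in [predC cl_unit], cl_inv =1 id}.
Proof. by move=> x /negP h; rewrite /cl_inv; case: pselect => // h'; case: h; apply/asboolP. Qed.

End ClassicalUnits.

Section PositiveCone.
Variables (R : comNzRingType) (P : R -> bool).

(** An order is given by its nonnegative cone; the same lemmas serve the integers, the fractions and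
    the completion. *)
Definition cone_le (x y : R) : bool := P (y - x).
Definition cone_lt (x y : R) : bool := (y != x) && cone_le x y.
Definition cone_norm (x : R) : R := if cone_le 0 x then x else - x.

Hypothesis P_add : forall x y, P x -> P y -> P (x + y).
Hypothesis P_mul : forall x y, P x -> P y -> P (x * y).
Hypothesis P_anti : forall x, P x -> P (- x) -> x = 0.
Hypothesis P_total : forall x, P x || P (- x).

Lemma cone_add x y : cone_le 0 x -> cone_le 0 y -> cone_le 0 (x + y).
Proof. by rewrite /cone_le !subr0; exact: P_add. Qed.
Lemma cone_mul x y : cone_le 0 x -> cone_le 0 y -> cone_le 0 (x * y).
Proof. by rewrite /cone_le !subr0; exact: P_mul. Qed.
Lemma cone_anti x : cone_le 0 x -> cone_le x 0 -> x = 0.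
Proof. by rewrite /cone_le subr0 sub0r; exact: P_anti. Qed.
Lemma cone_sub_ge0 x y : cone_le 0 (y - x) = cone_le x y.
Proof. by rewrite /cone_le subr0. Qed.
Lemma cone_total x : cone_le 0 x || cone_le x 0.
Proof. by rewrite /cone_le subr0 sub0r; exact: P_total. Qed.
Lemma cone_normN x : cone_norm (- x) = cone_norm x.
Proof.
rewrite /cone_norm /cone_le !subr0 opprK; case: ifP => h; case: ifP => h' //.
  by rewrite (P_anti h' h) oppr0.
by have := P_total x; rewrite h h'.
Qed.
Lemma cone_ge0_norm x : cone_le 0 x -> cone_norm x = x.
Proof. by rewrite /cone_norm => ->. Qed.
Lemma cone_lt_def x y : cone_lt x y = (y != x) && cone_le x y.
Proof. by []. Qed.

End PositiveCone.

(** * The ordered ring of integers of a model *)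

Section Naturals.
Variable M : aca_model.

Definition nn : Type := dom M N.

HB.instance Definition _ := gen_eqMixin nn.
HB.instance Definition _ := gen_choiceMixin nn.

Definition nn_add (a b : nn) : nn := ap (ap mplus a) b.
Definition nn_mul (a b : nn) : nn := ap (ap mtimes a) b.

Lemma nn_add0l : left_id (m0 : nn) nn_add.
Proof. by move=> x; rewrite /nn_add n_addC n_add0. Qed.
Lemma nn_mul1l : left_id (m1 : nn) nn_mul.
Proof. by move=> x; rewrite /nn_mul n_mulC n_mul1. Qed.
Lemma nn_mulDl : left_distributive nn_mul nn_add.
Proof. by move=> x y z; rewrite /nn_mul /nn_add n_mulC n_mulD !(n_mulC z). Qed.
Lemma nn_mul0l : left_zero (m0 : nn) nn_mul.
Proof. by move=> x; rewrite /nn_mul n_mulC n_mul0. Qed.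
Lemma nn_1neq0 : (m1 : nn) != m0.
Proof. by apply/eqP => /esym /n_0neq1. Qed.

HB.instance Definition _ := GRing.isNmodule.Build nn
  (@n_addA M : associative nn_add) (@n_addC M : commutative nn_add) nn_add0l.
HB.instance Definition _ := GRing.Nmodule_isComNzSemiRing.Build nn
  (@n_mulA M : associative nn_mul) (@n_mulC M : commutative nn_mul) nn_mul1l nn_mulDl nn_mul0l nn_1neq0.

Lemma nn_addI (a b c : nn) : a + c = b + c -> a = b.
Proof.
move=> e; case: (n_lt_tri a b) => [/(n_lt_add c)|[//|/(n_lt_add c)]].
  by rewrite [X in mlt X _]e => /n_lt_irr.
by rewrite [X in mlt _ X]e => /n_lt_irr.
Qed.

(** Formal differences: the integers are the Grothendieck group of the semi-ring. *)
Definition zrel (p q : nn * nn) : bool := `[< p.1 + q.2 = q.1 + p.2 >].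

Lemma zrel_refl : reflexive zrel.
Proof. by move=> p; apply/asboolP. Qed.
Lemma zrel_sym : symmetric zrel.
Proof. by move=> p q; apply/asboolP/asboolP. Qed.
Lemma zrel_trans : transitive zrel.
Proof.
move=> q p r /asboolP h /asboolP h'; apply/asboolP; apply: (@nn_addI _ _ q.2).
have -> : p.1 + r.2 + q.2 = (p.1 + q.2) + r.2 by ring.
rewrite h; have -> : q.1 + p.2 + r.2 = (q.1 + r.2) + p.2 by ring.
by rewrite h'; ring.
Qed.

Canonical zrel_equiv := EquivRel zrel zrel_refl zrel_sym zrel_trans.
Definition ZM := {eq_quot zrel}.
HB.instance Definition _ := Choice.on ZM.
HB.instance Definition _ := EqQuotient.on ZM.

Definition zpi (a b : nn) : ZM := \pi_ZM (a, b).

Lemma zpi_eq a b c d : zpi a b = zpi c d <-> a + d = c + b.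
Proof.
split=> [/eqmodP /asboolP //|h].
by apply/eqmodP/asboolP.
Qed.

Lemma zpi_surj (z : ZM) : exists a b, z = zpi a b.
Proof. by exists (repr z).1, (repr z).2; rewrite /zpi -surjective_pairing reprK. Qed.

Definition zadd (x y : ZM) : ZM := zpi ((repr x).1 + (repr y).1) ((repr x).2 + (repr y).2).
Definition zopp (x : ZM) : ZM := zpi (repr x).2 (repr x).1.
Definition zmul (x y : ZM) : ZM :=
  zpi ((repr x).1 * (repr y).1 + (repr x).2 * (repr y).2) ((repr x).1 * (repr y).2 + (repr x).2 * (repr y).1).

Lemma repr_zpi a b : (repr (zpi a b)).1 + b = a + (repr (zpi a b)).2.
Proof. by apply/zpi_eq; rewrite /zpi -surjective_pairing reprK. Qed.

Lemma zaddE a b c d : zadd (zpi a b) (zpi c d) = zpi (a + c) (b + d).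
Proof.
apply/zpi_eq; have h := repr_zpi a b; have h' := repr_zpi c d.
move: h h'; set p := repr _; set q := repr _ => h h'.
have -> : p.1 + q.1 + (b + d) = (p.1 + b) + (q.1 + d) by ring.
by rewrite h h'; ring.
Qed.

Lemma zoppE a b : zopp (zpi a b) = zpi b a.
Proof. by apply/zpi_eq; have h := repr_zpi a b; rewrite addrC -h addrC. Qed.

Lemma zpi_mull (a b a' b' c d : nn) : zpi a b = zpi a' b' ->
  zpi (a * c + b * d) (a * d + b * c) = zpi (a' * c + b' * d) (a' * d + b' * c).
Proof.
move/zpi_eq => h; apply/zpi_eq.
have -> : a * c + b * d + (a' * d + b' * c) = (a + b') * c + (a' + b) * d by ring.
have -> : a' * c + b' * d + (a * d + b * c) = (a' + b) * c + (a + b') * d by ring.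
by rewrite h.
Qed.

Lemma zmulE a b c d : zmul (zpi a b) (zpi c d) = zpi (a * c + b * d) (a * d + b * c).
Proof.
have hr x y : zpi (repr (zpi x y)).1 (repr (zpi x y)).2 = zpi x y.
  by rewrite /zpi -surjective_pairing reprK.
rewrite /zmul (zpi_mull _ _ (hr a b)).
move: (zpi_mull a b (hr c d)); set q := repr _.
by rewrite !(mulrC a) !(mulrC b) [X in zpi _ X = _]addrC [X in _ = zpi _ X]addrC.
Qed.

Lemma zaddA : associative zadd.
Proof.
move=> x y z; have [a [b ->]] := zpi_surj x; have [c [d ->]] := zpi_surj y.
by have [e [f ->]] := zpi_surj z; rewrite !zaddE !addrA.
Qed.

Lemma zaddC : commutative zadd.
Proof.
move=> x y; have [a [b ->]] := zpi_surj x; have [c [d ->]] := zpi_surj y.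
by rewrite !zaddE [a + c]addrC [b + d]addrC.
Qed.

Lemma zadd0 : left_id (zpi 0 0) zadd.
Proof. by move=> x; have [a [b ->]] := zpi_surj x; rewrite zaddE !add0r. Qed.

Lemma zaddN : left_inverse (zpi 0 0) zopp zadd.
Proof.
move=> x; have [a [b ->]] := zpi_surj x; rewrite zoppE zaddE.
by apply/zpi_eq; ring.
Qed.

HB.instance Definition _ := GRing.isZmodule.Build ZM zaddA zaddC zadd0 zaddN.

Lemma zmulA : associative zmul.
Proof.
move=> x y z; have [a [b ->]] := zpi_surj x; have [c [d ->]] := zpi_surj y.
by have [e [f ->]] := zpi_surj z; rewrite !zmulE; congr zpi; ring.
Qed.

Lemma zmulC : commutative zmul.
Proof.
move=> x y; have [a [b ->]] := zpi_surj x; have [c [d ->]] := zpi_surj y.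
by rewrite !zmulE; congr zpi; ring.
Qed.

Lemma zmul1 : left_id (zpi 1 0) zmul.
Proof. by move=> x; have [a [b ->]] := zpi_surj x; rewrite zmulE; congr zpi; ring. Qed.

Lemma zmulD : left_distributive zmul zadd.
Proof.
move=> x y z; have [a [b ->]] := zpi_surj x; have [c [d ->]] := zpi_surj y.
by have [e [f ->]] := zpi_surj z; rewrite !(zmulE, zaddE); congr zpi; ring.
Qed.

Lemma z1neq0 : zpi 1 0 != 0 :> ZM.
Proof. by apply/eqP => /zpi_eq /eqP; rewrite addr0 add0r oner_eq0. Qed.

HB.instance Definition _ := GRing.Zmodule_isComNzRing.Build ZM zmulA zmulC zmul1 zmulD z1neq0.

Definition nz (n : nn) : ZM := zpi n 0.

Lemma nzD a b : nz (a + b) = nz a + nz b.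
Proof. by rewrite /nz [RHS]zaddE addr0. Qed.
Lemma nzM a b : nz (a * b) = nz a * nz b.
Proof. by rewrite /nz [RHS]zmulE; congr zpi; ring. Qed.
Lemma nz0 : nz 0 = 0. Proof. by []. Qed.
Lemma nz1 : nz 1 = 1. Proof. by []. Qed.
Lemma nz_inj : injective nz.
Proof. by move=> a b /zpi_eq; rewrite !addr0. Qed.

Lemma zpiE a b : zpi a b = nz a - nz b.
Proof. by rewrite /nz [- _]zoppE [RHS]zaddE addr0 add0r. Qed.

Lemma nn_lt_sub (a b : nn) : mlt a b -> exists c : nn, a + c = b.
Proof. exact: n_lt_sub. Qed.

Lemma nn_cases (a b : nn) : (exists c, a + c = b) \/ (exists c, b + c = a).
Proof.
case: (n_lt_tri a b) => [/n_lt_sub|[->|/n_lt_sub]]; [by left| |by right].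
by left; exists 0; rewrite addr0.
Qed.

(** Subtraction of a smaller number reduces a formal difference to a number up to sign; zero
    divisors and signs are settled on this normal form. *)
Lemma zm_cases (z : ZM) : (exists n, z = nz n) \/ (exists n, z = - nz n).
Proof.
have [a [b ->]] := zpi_surj z; rewrite zpiE.
case: (nn_cases a b) => [[c <-]|[c <-]]; [right|left]; exists c; rewrite nzD; ring.
Qed.

Lemma nn_mul_eq0 (a b : nn) : a * b = 0 -> a = 0 \/ b = 0.
Proof.
move=> e; case: (n_ge0 a) => [ha|<-]; last by left.
case: (n_ge0 b) => [hb|<-]; last by right.
have := n_lt_mul hb ha; rewrite -[X in mlt _ X]/(a * b) e n_mulC n_mul0.
by move/n_lt_irr.
Qed.

Lemma nn_add_eq0 (a b : nn) : a + b = 0 -> a = 0.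
Proof.
move=> e; case: (n_ge0 a) => [ha|//].
case: (n_ge0 b) => [hb|hb]; last by move: e; rewrite -[b]hb addr0.
have := n_lt_add b ha; rewrite -[X in mlt _ X]/(a + b) e n_addC n_add0.
by move/(n_lt_trans hb)/n_lt_irr.
Qed.

Lemma zm_integral (x y : ZM) : x * y = 0 -> (x == 0) || (y == 0).
Proof.
have key (a b : nn) : nz a * nz b = 0 -> (nz a == 0) || (nz b == 0).
  rewrite -nzM -nz0 => /nz_inj /nn_mul_eq0 [->|->]; rewrite eqxx ?orbT //.
case: (zm_cases x) => -[a ->]; case: (zm_cases y) => -[b ->];
  rewrite ?mulNr ?mulrN ?oppr_eq0; try exact: key.
- by move/eqP; rewrite oppr_eq0 => /eqP; exact: key.
- by move/eqP; rewrite oppr_eq0 => /eqP; exact: key.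
- by rewrite opprK; exact: key.
Qed.

HB.instance Definition _ :=
  GRing.ComNzRing_hasMulInverse.Build ZM (@cl_mulVx ZM) (@cl_unitPl ZM) (@cl_inv_out ZM).
HB.instance Definition _ := GRing.ComUnitRing_isIntegral.Build ZM zm_integral.

Definition zge0 (x : ZM) : bool := `[< exists n, x = nz n >].

Lemma zge0P x : reflect (exists n, x = nz n) (zge0 x).
Proof. exact: asboolP. Qed.

Lemma zge0_add x y : zge0 x -> zge0 y -> zge0 (x + y).
Proof. by move=> /zge0P [a ->] /zge0P [b ->]; apply/zge0P; exists (a + b); rewrite nzD. Qed.
Lemma zge0_mul x y : zge0 x -> zge0 y -> zge0 (x * y).
Proof. by move=> /zge0P [a ->] /zge0P [b ->]; apply/zge0P; exists (a * b); rewrite nzM. Qed.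
Lemma zge0_anti x : zge0 x -> zge0 (- x) -> x = 0.
Proof.
move=> /zge0P [a ->] /zge0P [b e].
have /nn_add_eq0 -> // : a + b = 0 by apply: nz_inj; rewrite nzD -e subrr.
Qed.
Lemma zge0_total x : zge0 x || zge0 (- x).
Proof.
by case: (zm_cases x) => -[n ->]; apply/orP; [left|right]; apply/zge0P; exists n; rewrite ?opprK.
Qed.

HB.instance Definition _ := Num.IntegralDomain_isLeReal.Build ZM
  (cone_add zge0_add) (cone_mul zge0_mul) (cone_anti zge0_anti) (cone_sub_ge0 zge0)
  (cone_total zge0_total) (cone_normN zge0_anti zge0_total) (cone_ge0_norm (P := zge0))
  (cone_lt_def zge0).

Lemma nz_ge0 n : 0 <= nz n.
Proof. by rewrite -subr_ge0; apply/zge0P; exists n; rewrite !subr0. Qed.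

Lemma nz_lt a b : mlt a b <-> nz a < nz b.
Proof.
split=> [h|].
  have [c hc] := nn_lt_sub h; rewrite lt_def; apply/andP; split; last first.
    by rewrite -subr_ge0; apply/zge0P; exists c; rewrite subr0 -hc nzD addrC addKr.
  by apply/eqP => /nz_inj e; move: h; rewrite e => /n_lt_irr.
rewrite lt_def => /andP [ne]; rewrite -subr_ge0 => /zge0P [c]; rewrite subr0 => hc.
case: (n_lt_tri a b) => [//|[e|/nn_lt_sub [d hd]]]; first by rewrite e eqxx in ne.
have d0 : d = 0.
  apply: (@nn_add_eq0 _ c); apply: nz_inj.
  by rewrite nzD -hc -hd nzD nz0; ring.
by case/eqP: ne; rewrite -hd d0 addr0.
Qed.

Lemma nz_ge1 (a : nn) : a = 0 \/ 1 <= nz a.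
Proof.
case: (n_ge0 a) => [/n_discrete [/nz_lt|h]|h]; [|by right; rewrite -[a]h|by left].
by rewrite nz1 => /ltW; right.
Qed.

End Naturals.

(** * The order of a fraction field *)

Section FractionOrder.
Variable R : realDomainType.
Local Notation F := {fraction R}.
Local Notation "x %:F" := (FracField.tofrac x).

Lemma frac_surj (x : F) : exists a b : R, 0 < b /\ x = a%:F / b%:F.
Proof.
have [a [b [b0 ->]]] : exists a b : R, b != 0 /\ x = a%:F / b%:F.
  elim/quotW: x => r; exists \n_r, \d_r; split; first exact: denom_ratioP.
  rewrite !piE; apply/eqmodP => /=.
  rewrite /FracField.equivf /FracField.mulf /FracField.invf.
  by rewrite !(numden_Ratio, mulf_neq0, oner_eq0, denom_ratioP) //= mulr1 mul1r mulrC.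
case: (ltgtP b 0) => [b1|b1|e]; last by rewrite e eqxx in b0.
  exists (- a), (- b); split; first by rewrite oppr_gt0.
  by rewrite !tofracN invrN mulrNN.
by exists a, b.
Qed.

(** The representative does not matter: over a positive denominator the sign is that of the
    numerator, by [fge0E]. *)
Definition fge0 (x : F) : bool := `[< exists a b : R, [/\ 0 < b, 0 <= a & x = a%:F / b%:F] >].
Lemma frac_eq (a b c d : R) : 0 < b -> 0 < d -> a%:F / b%:F = c%:F / d%:F :> F -> a * d = c * b.
Proof.
move=> b0 d0; have nb : b%:F != 0 :> F by rewrite tofrac_eq0 gt_eqF.
have nd : d%:F != 0 :> F by rewrite tofrac_eq0 gt_eqF.
by move/eqP; rewrite eqr_div // -!tofracM tofrac_eq => /eqP.
Qed.

Lemma fge0E (a b : R) : 0 < b -> fge0 (a%:F / b%:F) = (0 <= a).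
Proof.
move=> b0; apply/asboolP/idP => [[c [d [d0 c0 /frac_eq e]]]|a0]; last by exists a, b.
have {}e := e b0 d0.
by rewrite -(pmulr_lge0 _ d0) e mulr_ge0 // ltW.
Qed.

Lemma fge0_add x y : fge0 x -> fge0 y -> fge0 (x + y).
Proof.
have [a [b [b0 ->]]] := frac_surj x; have [c [d [d0 ->]]] := frac_surj y.
have nb : b%:F != 0 :> F by rewrite tofrac_eq0 gt_eqF.
have nd : d%:F != 0 :> F by rewrite tofrac_eq0 gt_eqF.
rewrite addf_div // -!tofracM -tofracD !fge0E ?mulr_gt0 // => ha hc.
by rewrite addr_ge0 // mulr_ge0 // ltW.
Qed.

Lemma fge0_mul x y : fge0 x -> fge0 y -> fge0 (x * y).
Proof.
have [a [b [b0 ->]]] := frac_surj x; have [c [d [d0 ->]]] := frac_surj y.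
by rewrite mulf_div -!tofracM !fge0E ?mulr_gt0 //; exact: mulr_ge0.
Qed.

Lemma fge0_anti x : fge0 x -> fge0 (- x) -> x = 0.
Proof.
have [a [b [b0 ->]]] := frac_surj x.
rewrite -mulNr -tofracN !fge0E // oppr_ge0 => h h'.
have -> : a = 0 by apply/eqP; rewrite eq_le h h'.
by rewrite tofrac0 mul0r.
Qed.

Lemma fge0_total x : fge0 x || fge0 (- x).
Proof.
have [a [b [b0 ->]]] := frac_surj x.
by rewrite -mulNr -tofracN !fge0E // oppr_ge0 le_total.
Qed.

HB.instance Definition _ := Num.IntegralDomain_isLeReal.Build F
  (cone_add fge0_add) (cone_mul fge0_mul) (cone_anti fge0_anti) (cone_sub_ge0 fge0)
  (cone_total fge0_total) (cone_normN fge0_anti fge0_total) (cone_ge0_norm (P := fge0))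
  (cone_lt_def fge0).

Lemma tofrac_ge0 (a : R) : (0 <= a%:F :> F) = (0 <= a).
Proof. by rewrite -subr_ge0 -[RHS](fge0E _ ltr01) tofrac1 divr1 -[X in fge0 X]subr0 -[in RHS](subr0 a%:F). Qed.

Lemma tofrac_le (a b : R) : (a%:F <= b%:F :> F) = (a <= b).
Proof. by rewrite -subr_ge0 -tofracB tofrac_ge0 subr_ge0. Qed.

Lemma tofrac_lt (a b : R) : (a%:F < b%:F :> F) = (a < b).
Proof. by rewrite !lt_neqAle tofrac_le tofrac_eq. Qed.

End FractionOrder.

(** * Completion of an ordered field along an index set *)

Section Completion.
Variables (Q : realFieldType) (I : Type) (idx : I -> Q) (i0 : I).
Implicit Types (e : Q) (n m k : I).

(** Limits run along [idx], in the application the numbers of the model, because the standard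
    integers need not be cofinal in its rationals. *)
Definition ev (P : I -> Prop) := exists n0, forall n, idx n0 <= idx n -> P n.

Lemma ev_and P P' : ev P -> ev P' -> ev (fun n => P n /\ P' n).
Proof.
move=> [a ha] [b hb]; case: (leP (idx a) (idx b)) => ab; [exists b|exists a] => n h.
  by split; [apply: ha; exact: le_trans h|exact: hb].
by split; [exact: ha|apply: hb; exact: le_trans (ltW ab) h].
Qed.

Lemma ev_mono (P P' : I -> Prop) : (forall n, P n -> P' n) -> ev P -> ev P'.
Proof. by move=> h [a ha]; exists a => n /ha /h. Qed.

Lemma ev_all (P : I -> Prop) : (forall n, P n) -> ev P.
Proof. by exists i0. Qed.

Lemma ev_ex P : ev P -> exists n, P n.
Proof. by case=> n h; exists n; exact: h. Qed.

(** Late terms are compared with a fixed [q] instead of with each other, so that each estimate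
    concerns a single index. *)
Definition cauchy (u : I -> Q) := forall e, 0 < e -> exists q, ev (fun n => - e < u n - q < e).

Definition cseq := {u : I -> Q | cauchy u}.
HB.instance Definition _ := gen_eqMixin cseq.
HB.instance Definition _ := gen_choiceMixin cseq.

Lemma cseq_near (u : cseq) e : 0 < e -> exists q, ev (fun n => - e < sval u n - q < e).
Proof. exact: (svalP u). Qed.

Definition null (u : I -> Q) := forall e, 0 < e -> ev (fun n => - e < u n < e).

Definition crel (u v : cseq) : bool := `[< null (fun n => sval u n - sval v n) >].

Lemma crel_refl : reflexive crel.
Proof. by move=> u; apply/asboolP => e e0; apply: ev_all => n; lra. Qed.
Lemma crel_sym : symmetric crel.
Proof.
by move=> u v; apply/asboolP/asboolP => h e /h; apply: ev_mono => n; lra.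
Qed.
Lemma crel_trans : transitive crel.
Proof.
move=> v u w /asboolP h /asboolP h'; apply/asboolP => e e0.
have e2 : 0 < e / 2 by lra.
by have := ev_and (h _ e2) (h' _ e2); apply: ev_mono => n; lra.
Qed.

Canonical crel_equiv := EquivRel crel crel_refl crel_sym crel_trans.
Definition RM := {eq_quot crel}.
HB.instance Definition _ := Choice.on RM.
HB.instance Definition _ := EqQuotient.on RM.

Definition cl (u : cseq) : RM := \pi_RM u.

Lemma cl_eqP (u v : cseq) : cl u = cl v <-> null (fun n => sval u n - sval v n).
Proof.
by split=> [/eqmodP /asboolP|h] //; apply/eqmodP/asboolP.
Qed.

Lemma cl_ext (u v : cseq) : sval u =1 sval v -> cl u = cl v.
Proof. by move=> h; apply/cl_eqP => e e0; apply: ev_all => n; rewrite h; lra. Qed.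

Lemma clP (x : RM) : exists u, x = cl u.
Proof. by exists (repr x); rewrite /cl reprK. Qed.

Lemma cl_repr (x : RM) : cl (repr x) = x.
Proof. by rewrite /cl reprK. Qed.

Lemma cconst_cauchy q : cauchy (fun _ => q).
Proof. by move=> e e0; exists q; apply: ev_all => n; lra. Qed.

Lemma cadd_cauchy (u v : cseq) : cauchy (fun n => sval u n + sval v n).
Proof.
move=> e e0; have e2 : 0 < e / 2 by lra.
have [q hq] := cseq_near u e2; have [r hr] := cseq_near v e2.
by exists (q + r); have := ev_and hq hr; apply: ev_mono => n; lra.
Qed.

Lemma copp_cauchy (u : cseq) : cauchy (fun n => - sval u n).
Proof.
move=> e /(cseq_near u) [q h]; exists (- q).
by move: h; apply: ev_mono => n; lra.
Qed.

Lemma cseq_bounded (u : cseq) : exists2 b : Q, 0 < b & ev (fun n => `|sval u n| < b).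
Proof.
have [q h] := cseq_near u ltr01; exists (`|q| + 1); first by rewrite ltr_wpDl.
move: h; apply: ev_mono => n h; have := ler_normD (sval u n - q) q.
rewrite subrK => h'; apply: le_lt_trans h' _; rewrite addrC ltrD2l.
by rewrite ltr_norml.
Qed.

Lemma null_mul_bounded (u v : I -> Q) (b : Q) : 0 < b -> ev (fun n => `|u n| < b) -> null v ->
  null (fun n => u n * v n).
Proof.
move=> b0 hu hv e e0; have := ev_and hu (hv (e / b) (divr_gt0 e0 b0)).
apply: ev_mono => n []; rewrite -!ltr_norml normrM => h h'.
have -> : e = b * (e / b) by rewrite mulrC divfK // gt_eqF.
exact: ltr_pM.
Qed.

Lemma cmul_cauchy (u v : cseq) : cauchy (fun n => sval u n * sval v n).
Proof.
have [b b0 hb] := cseq_bounded u; have [c c0 hc] := cseq_bounded v.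
(* [b] and [c] bound the factors. From [d <= 1] follows [|r| < c + 1], and the two error terms below
   then total less than [(b + c + 1) * d <= e]. *)
move=> e e0; pose d := Num.min 1 (e / (b + c + 1)).
have s0 : 0 < b + c + 1 by lra.
have d0 : 0 < d by rewrite lt_min ltr01 divr_gt0.
have d1 : d <= 1 by rewrite ge_min lexx.
have de : (b + c + 1) * d <= e.
  have : d <= e / (b + c + 1) by rewrite ge_min lexx orbT.
  by rewrite ler_pdivlMr // mulrC.
have [q hq] := cseq_near u d0; have [r hr] := cseq_near v d0.
have r1 : `|r| < c + 1.
  have [n [+ +]] := ev_ex (ev_and hc hr); rewrite -ltr_norml distrC => h h'.
  have := ler_normD (sval v n) (r - sval v n); rewrite addrC subrK; lra.
exists (q * r); have := ev_and hb (ev_and hq hr); apply: ev_mono => n [h1].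
rewrite -!ltr_norml => -[h2 h3].
have -> : sval u n * sval v n - q * r = sval u n * (sval v n - r) + r * (sval u n - q) by ring.
apply: le_lt_trans (ler_normD _ _) _; rewrite !normrM; apply: lt_le_trans de.
rewrite -addrA mulrDl; apply: ltrD; exact: ltr_pM.
Qed.

Definition cconst q : cseq := exist _ _ (cconst_cauchy q).
Definition cadd u v : cseq := exist _ _ (cadd_cauchy u v).
Definition copp u : cseq := exist _ _ (copp_cauchy u).
Definition cmul u v : cseq := exist _ _ (cmul_cauchy u v).

Definition radd (x y : RM) : RM := cl (cadd (repr x) (repr y)).
Definition ropp (x : RM) : RM := cl (copp (repr x)).
Definition rmul (x y : RM) : RM := cl (cmul (repr x) (repr y)).

Lemma repr_null (u : cseq) : null (fun n => sval (repr (cl u)) n - sval u n).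
Proof. by apply/cl_eqP; rewrite cl_repr. Qed.

Lemma raddE u v : radd (cl u) (cl v) = cl (cadd u v).
Proof.
apply/cl_eqP => e e0; have e2 : 0 < e / 2 by lra.
by have := ev_and (repr_null u e2) (repr_null v e2); apply: ev_mono => n /=; lra.
Qed.

Lemma roppE u : ropp (cl u) = cl (copp u).
Proof. by apply/cl_eqP => e /(repr_null u); apply: ev_mono => n /=; lra. Qed.

Lemma null_add (u v : I -> Q) : null u -> null v -> null (fun n => u n + v n).
Proof.
move=> hu hv e e0; have e2 : 0 < e / 2 by lra.
by have := ev_and (hu _ e2) (hv _ e2); apply: ev_mono => n /=; lra.
Qed.

Lemma null_ext (u v : I -> Q) : u =1 v -> null u -> null v.
Proof. by move/funext ->. Qed.

Lemma rmulE u v : rmul (cl u) (cl v) = cl (cmul u v).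
Proof.
apply/cl_eqP => /=; set u' := repr _; set v' := repr _.
have [b b0 hb] := cseq_bounded u'; have [c c0 hc] := cseq_bounded v.
have := null_add (null_mul_bounded b0 hb (repr_null v)) (null_mul_bounded c0 hc (repr_null u)).
by apply: null_ext => n; rewrite -/u' -/v'; ring.
Qed.

Lemma raddA : associative radd.
Proof.
move=> x y z; have [u ->] := clP x; have [v ->] := clP y; have [w ->] := clP z.
by rewrite !raddE; apply: cl_ext => n /=; rewrite addrA.
Qed.
Lemma raddC : commutative radd.
Proof.
move=> x y; have [u ->] := clP x; have [v ->] := clP y.
by rewrite !raddE; apply: cl_ext => n /=; rewrite addrC.
Qed.
Lemma radd0 : left_id (cl (cconst 0)) radd.
Proof. by move=> x; have [u ->] := clP x; rewrite raddE; apply: cl_ext => n /=; rewrite add0r. Qed.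
Lemma raddN : left_inverse (cl (cconst 0)) ropp radd.
Proof. by move=> x; have [u ->] := clP x; rewrite roppE raddE; apply: cl_ext => n /=; rewrite addNr. Qed.

HB.instance Definition _ := GRing.isZmodule.Build RM raddA raddC radd0 raddN.

Lemma rmulA : associative rmul.
Proof.
move=> x y z; have [u ->] := clP x; have [v ->] := clP y; have [w ->] := clP z.
by rewrite !rmulE; apply: cl_ext => n /=; rewrite mulrA.
Qed.
Lemma rmulC : commutative rmul.
Proof.
move=> x y; have [u ->] := clP x; have [v ->] := clP y.
by rewrite !rmulE; apply: cl_ext => n /=; rewrite mulrC.
Qed.
Lemma rmul1 : left_id (cl (cconst 1)) rmul.
Proof. by move=> x; have [u ->] := clP x; rewrite rmulE; apply: cl_ext => n /=; rewrite mul1r. Qed.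
Lemma rmulD : left_distributive rmul radd.
Proof.
move=> x y z; have [u ->] := clP x; have [v ->] := clP y; have [w ->] := clP z.
by rewrite !(rmulE, raddE); apply: cl_ext => n /=; rewrite mulrDl.
Qed.
Lemma r1neq0 : cl (cconst 1) != 0.
Proof. by apply/eqP => /cl_eqP /(_ 1 ltr01) /ev_ex [n] /=; rewrite subr0 ltxx andbF. Qed.

HB.instance Definition _ := GRing.Zmodule_isComNzRing.Build RM rmulA rmulC rmul1 rmulD r1neq0.

Lemma clD u v : cl u + cl v = cl (cadd u v). Proof. exact: raddE. Qed.
Lemma clN u : - cl u = cl (copp u). Proof. exact: roppE. Qed.
Lemma clB u v : cl u - cl v = cl (cadd u (copp v)). Proof. by rewrite clN clD. Qed.
Lemma clM u v : cl u * cl v = cl (cmul u v). Proof. exact: rmulE. Qed.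
Lemma cl0E : 0 = cl (cconst 0). Proof. by []. Qed.

Lemma cl_eq0 u : cl u = 0 <-> null (sval u).
Proof.
rewrite cl0E cl_eqP; split; apply: null_ext => n /=; by rewrite subr0.
Qed.

(** Let [q] be within [e / 4] of the tail. If [|q|] exceeds [e / 2], the tail keeps its sign and a
    distance [e / 4] from 0; if this happens for no [e], the sequence is null. *)
Lemma cl_apart u : cl u <> 0 -> exists2 e, 0 < e & ev (fun n => e < sval u n) \/ ev (fun n => sval u n < - e).
Proof.
move=> h; apply: contrapT => h'; apply: h; apply/cl_eq0 => e e0.
have e4 : 0 < e / 4 by lra.
have [q hq] := cseq_near u e4.
case: (ltP (e / 2) q) => q1.
  case: h'; exists (e / 4) => //; left; move: hq; apply: ev_mono => n; lra.
case: (ltP q (- (e / 2))) => q2.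
  case: h'; exists (e / 4) => //; right; move: hq; apply: ev_mono => n; lra.
by move: hq; apply: ev_mono => n; lra.
Qed.

Lemma rm_integral (x y : RM) : x * y = 0 -> (x == 0) || (y == 0).
Proof.
have [u ->] := clP x; have [v ->] := clP y; rewrite clM => /cl_eq0 h.
case: eqP => //= /cl_apart [d d0 hd]; apply/eqP/cl_eq0 => e e0.
have := h (d * e) (mulr_gt0 d0 e0).
have {}hd : ev (fun n => d < `|sval u n|).
  case: hd; apply: ev_mono => n hn; first by apply: lt_le_trans hn (ler_norm _).
  by rewrite ltr_normr; apply/orP; right; lra.
move/(ev_and hd); apply: ev_mono => n /= []; rewrite -!ltr_norml normrM => h1 h2.
rewrite ltNge; apply/negP => h3.
by move: h2; rewrite ltNge ler_pM // ltW.
Qed.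

HB.instance Definition _ :=
  GRing.ComNzRing_hasMulInverse.Build RM (@cl_mulVx RM) (@cl_unitPl RM) (@cl_inv_out RM).
HB.instance Definition _ := GRing.ComUnitRing_isIntegral.Build RM rm_integral.

Definition rge0 (x : RM) : bool := `[< forall e, 0 < e -> ev (fun n => - e < sval (repr x) n) >].

Lemma rge0_cl u : rge0 (cl u) <-> forall e, 0 < e -> ev (fun n => - e < sval u n).
Proof.
have h := repr_null u; rewrite /rge0; set v := repr _ in h *.
split=> [/asboolP h'|h']; last (apply/asboolP); move=> e e0; have e2 : 0 < e / 2 by lra.
  by have := ev_and (h _ e2) (h' _ e2); apply: ev_mono => n; lra.
by have := ev_and (h _ e2) (h' _ e2); apply: ev_mono => n; lra.
Qed.

Lemma rge0_add x y : rge0 x -> rge0 y -> rge0 (x + y).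
Proof.
have [u ->] := clP x; have [v ->] := clP y; rewrite clD => /rge0_cl h /rge0_cl h'.
apply/rge0_cl => e e0; have e2 : 0 < e / 2 by lra.
by have := ev_and (h _ e2) (h' _ e2); apply: ev_mono => n /=; lra.
Qed.

Lemma rge0_anti x : rge0 x -> rge0 (- x) -> x = 0.
Proof.
have [u ->] := clP x; rewrite clN => /rge0_cl h /rge0_cl h'.
apply/cl_eq0 => e e0; have := ev_and (h _ e0) (h' _ e0); apply: ev_mono => n /=; lra.
Qed.

Lemma rge0_total x : rge0 x || rge0 (- x).
Proof.
have [u ->] := clP x; rewrite clN.
case: (pselect (cl u = 0)) => [/cl_eq0 h|/cl_apart [d d0 [h|h]]]; apply/orP.
- by left; apply/rge0_cl => e /h; apply: ev_mono => n; lra.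
- by left; apply/rge0_cl => e e0; move: h; apply: ev_mono => n; lra.
- by right; apply/rge0_cl => e e0; move: h; apply: ev_mono => n /=; lra.
Qed.

Lemma rge0_pos x : rge0 x -> x <> 0 -> exists2 u, x = cl u & exists2 e, 0 < e & ev (fun n => e < sval u n).
Proof.
have [u ->] := clP x => /rge0_cl h /cl_apart [d d0 [h'|h']]; first by exists u => //; exists d.
by have [n] := ev_ex (ev_and h' (h _ d0)); lra.
Qed.

Lemma rge0_mul x y : rge0 x -> rge0 y -> rge0 (x * y).
Proof.
move=> hx hy; case: (pselect (x = 0)) => [->|/(rge0_pos hx) [u -> [d d0 hd]]].
  by rewrite mul0r; apply/rge0_cl => e e0; apply: ev_all => n /=; lra.
case: (pselect (y = 0)) => [->|/(rge0_pos hy) [v -> [d' d0' hd']]].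
  by rewrite mulr0; apply/rge0_cl => e e0; apply: ev_all => n /=; lra.
rewrite clM; apply/rge0_cl => e e0; have := ev_and hd hd'; apply: ev_mono => n /= [h h'].
by apply: lt_trans (_ : 0 < _); [lra|apply: mulr_gt0; lra].
Qed.

HB.instance Definition _ := Num.IntegralDomain_isLeReal.Build RM
  (cone_add rge0_add) (cone_mul rge0_mul) (cone_anti rge0_anti) (cone_sub_ge0 rge0)
  (cone_total rge0_total) (cone_normN rge0_anti rge0_total) (cone_ge0_norm (P := rge0))
  (cone_lt_def rge0).

Definition fr (q : Q) : RM := cl (cconst q).

Lemma frD p q : fr (p + q) = fr p + fr q.
Proof. by rewrite clD; apply: cl_ext. Qed.
Lemma frN q : fr (- q) = - fr q.
Proof. by rewrite clN; apply: cl_ext. Qed.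
Lemma frM p q : fr (p * q) = fr p * fr q.
Proof. by rewrite clM; apply: cl_ext. Qed.

Lemma cl_ge0 u : (0 <= cl u) <-> forall e, 0 < e -> ev (fun n => - e < sval u n).
Proof. by rewrite -rge0_cl -[X in rge0 X]subr0. Qed.

Lemma fr_le p q : (fr p <= fr q) = (p <= q).
Proof.
rewrite -subr_ge0 -frN -frD; apply/idP/idP => [/cl_ge0 h|h].
  rewrite leNgt; apply/negP => pq; have [|n] := ev_ex (h (p - q) _); rewrite /=; lra.
apply/cl_ge0 => e e0; apply: ev_all => n /=; lra.
Qed.

Lemma cl_le_fr u q : ev (fun n => sval u n <= q) -> cl u <= fr q.
Proof.
move=> h; rewrite -subr_ge0 clB; apply/cl_ge0 => e e0; move: h; apply: ev_mono => n /=; lra.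
Qed.

Lemma fr_le_cl u q : ev (fun n => q <= sval u n) -> fr q <= cl u.
Proof.
move=> h; rewrite -subr_ge0 clB; apply/cl_ge0 => e e0; move: h; apply: ev_mono => n /=; lra.
Qed.

Lemma fr_dense (x y : RM) : x < y -> exists q, x < fr q < y.
Proof.
have [u ->] := clP x; have [v ->] := clP y; rewrite -subr_gt0 => h.
have : cl v - cl u <> 0 by move=> e; rewrite e ltxx in h.
rewrite clB => /cl_apart [d d0 [hd|hd]]; last first.
  have /cl_ge0 /(_ _ d0) hd' : 0 <= cl (cadd v (copp u)) by rewrite -clB ltW.
  by have [n /=] := ev_ex (ev_and hd hd'); lra.
(* Late terms of [u] lie below [q + d / 8] and late terms of [v] above [q + 7 d / 8], so [q + d / 2]
   separates the limits. *)
have d8 : 0 < d / 8 by lra.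
have [q hq] := cseq_near u d8; exists (q + d / 2).
have a : cl u <= fr (q + d / 8) by apply: cl_le_fr; move: hq; apply: ev_mono => n; lra.
have b : fr (q + d * (3 / 4)) <= cl v.
  by apply: fr_le_cl; have := ev_and hq hd; apply: ev_mono => n /=; lra.
apply/andP; split; [apply: le_lt_trans a _|apply: lt_le_trans b]; rewrite ltNge fr_le; lra.
Qed.

End Completion.

(** A limit is described by a single property: bounds of the late terms bound it. Off Cauchy
    sequences [lim] has the default value 0. *)
Theorem completion_exists (Q : realFieldType) (I : Type) (idx : I -> Q) (i0 : I) :
  exists (F : realDomainType) (f : Q -> F) (lim : (I -> Q) -> F),
  [/\ forall p q, f (p + q) = f p + f q,
      forall p q, f (p * q) = f p * f q,
      f 1 = 1,
      forall p q, (f p <= f q) = (p <= q)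
    & (forall x y, x < y -> exists q, x < f q < y) /\
      forall u, cauchy idx u -> forall p q,
        ev idx (fun n => p <= u n <= q) -> f p <= lim u <= f q].
Proof.
exists (RM idx i0), (@fr Q I idx i0).
exists (fun u => match pselect (cauchy idx u) with left h => cl i0 (exist _ u h) | right _ => 0 end).
split; [exact: frD|exact: frM|by []|exact: fr_le|split; first exact: fr_dense].
move=> u hu p q h; case: pselect => // hu'; apply/andP; split.
  by apply: fr_le_cl; move: h; apply: ev_mono => n /= /andP [].
by apply: cl_le_fr; move: h; apply: ev_mono => n /= /andP [].
Qed.

(** The interface through which numbers of the model are handled by ordered-field arithmetic;
    [re_surj] has the shape of the coded rationals. *)
Record rational_embedding (M : aca_model) (K : realFieldType) (i : dom M N -> K) : Prop := {
  re_add : forall a b, i (ap (ap mplus a) b) = i a + i b;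
  re_mul : forall a b, i (ap (ap mtimes a) b) = i a * i b;
  re_0 : i m0 = 0;
  re_1 : i m1 = 1;
  re_inj : injective i;
  re_lt : forall a b, mlt a b <-> i a < i b;
  re_ge1 : forall a, a = m0 \/ 1 <= i a;
  re_sub : forall a b, i a <= i b -> exists c, b = ap (ap mplus a) c;
  re_surj : forall q : K, exists a b d, q = (i a - i b) / (i d + 1) }.

Theorem rationals_exist (M : aca_model) :
  exists (K : realFieldType) (i : dom M N -> K), rational_embedding i.
Proof.
pose j := @FracField.tofrac (ZM M).
exists ({fraction (ZM M)}), (fun a => j (nz a)).
have lt_j (x y : ZM M) : (j x < j y) = (x < y) by exact: tofrac_lt.
have le_j (x y : ZM M) : (j x <= j y) = (x <= y) by exact: tofrac_le.
have inj_j : injective j by move=> x y /eqP; rewrite tofrac_eq => /eqP.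
have j1 : j 1 = 1 by exact: tofrac1.
have jD x y : j (x + y) = j x + j y by exact: tofracD.
have jB x y : j (x - y) = j x - j y by exact: tofracB.
have jM x y : j (x * y) = j x * j y by exact: tofracM.
split.
- by move=> a b; rewrite -jD -nzD.
- by move=> a b; rewrite -jM -nzM.
- exact: tofrac0.
- exact: tofrac1.
- by move=> a b /inj_j /nz_inj.
- by move=> a b; rewrite lt_j; exact: nz_lt.
- move=> a; case: (nz_ge1 (a : nn M)) => [->|h]; first by left.
  by right; rewrite -j1 le_j.
- move=> a b; rewrite le_j le_eqVlt => /orP [/eqP /nz_inj ->|/nz_lt /nn_lt_sub [c hc]].
    by exists m0; rewrite n_add0.
  by exists c; rewrite -hc.
- move=> q; have [x [y [y0 ->]]] := frac_surj q.
  have [a [b ->]] := zpi_surj x; rewrite zpiE.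
  have [[d hd]|[d hd]] := zm_cases y; last first.
    by move: y0; rewrite hd oppr_gt0 ltNge nz_ge0.
  have d1 : nz 1 <= nz d.
    by case: (nz_ge1 d) => // e; move: y0; rewrite hd e ltxx.
  have [c hc] : exists c : nn M, 1 + c = d.
    move: d1; rewrite le_eqVlt => /orP [/eqP /nz_inj <-|/nz_lt /nn_lt_sub //].
    by exists 0; rewrite addr0.
  exists a, b, c; rewrite -jB hd; congr (_ / _).
  by rewrite -hc nzD addrC -[in RHS]j1; exact: jD.
Qed.

(** * The rationals and reals of a model *)

Section Rationals.
Variables (M : aca_model) (K : realFieldType) (i : dom M N -> K).
Hypothesis hi : rational_embedding i.
Local Notation num := (dom M N).
Local Notation "a +n b" := (ap (ap mplus a) b) (at level 50, left associativity).
Local Notation "a *n b" := (ap (ap mtimes a) b) (at level 40, left associativity).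

Definition iE := (re_add hi, re_mul hi, re_0 hi, re_1 hi).

Lemma i_ge0 a : 0 <= i a.
Proof. by case: (re_ge1 hi a) => [->|]; [rewrite iE|lra]. Qed.

Lemma i_succ_le a b : i a < i b -> i a + 1 <= i b.
Proof.
move=> h; have [c hc] := re_sub hi (ltW h).
case: (re_ge1 hi c) => [c0|c1]; move: h; rewrite hc !iE; last lra.
by rewrite c0 iE addr0 ltxx.
Qed.

Definition mpair (a b : num) : num := (a +n b) *n (a +n b) +n a.

(** With [s = a + b] the code lies between [s^2] and [s^2 + s], below [(s + 1)^2]; so it determines
    [s], and then [a]. *)
Lemma mpair_inj a b a' b' : mpair a b = mpair a' b' -> a = a' /\ b = b'.
Proof.
move/(congr1 i); rewrite /mpair !iE.
have le x y x' y' : i x + i y < i x' + i y' ->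
    (i x + i y) * (i x + i y) + i x < (i x' + i y') * (i x' + i y') + i x'.
  have := i_ge0 x; have := i_ge0 y; have := i_ge0 x'; have := i_ge0 y'.
  move=> h1 h2 h3 h4 h; have : i x + i y + 1 <= i x' + i y'.
    by have := @i_succ_le (x +n y) (x' +n y'); rewrite !iE; exact.
  by nra.
case: (ltgtP (i a + i b) (i a' + i b')) => [/le h h'|/le h h'|e h]; [by rewrite h' ltxx in h|by rewrite h' ltxx in h|].
have ea : i a = i a' by move: h; rewrite e => /addrI.
by split; apply: (re_inj hi) => //; move: e; rewrite ea => /addrI.
Qed.

Definition mqcode (a b d : num) : num := mpair a (mpair b d).
Definition qv (a b d : num) : K := (i a - i b) / (i d + 1).
Definition isq (c : num) (q : K) := exists a b d, c = mqcode a b d /\ q = qv a b d.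

Lemma isq_fun c q q' : isq c q -> isq c q' -> q = q'.
Proof.
move=> [a [b [d [-> ->]]]] [a' [b' [d' [/mpair_inj [-> /mpair_inj [-> ->]] ->]]]] //.
Qed.

Lemma isq_surj q : exists c, isq c q.
Proof. by have [a [b [d ->]]] := re_surj hi q; exists (mqcode a b d), a, b, d. Qed.

Definition fval G (p : frac G) (e : env M G) : K :=
  (i (semt (fpos p) e) - i (semt (fneg p) e)) / i (semt (fden p) e).
Definition fok G (p : frac G) (e : env M G) := 0 < i (semt (fden p) e).

Lemma ratio_lt (a b a' b' d d' : K) : 0 < d -> 0 < d' ->
  (a * d' + b' * d < a' * d + b * d') = ((a - b) / d < (a' - b') / d').
Proof.
move=> d0 d0'; rewrite ltr_pdivrMr // mulrAC ltr_pdivlMr // -subr_gt0 -[RHS]subr_gt0.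
by congr (0 < _); ring.
Qed.

Lemma ratio_eq (a b a' b' d d' : K) : 0 < d -> 0 < d' ->
  (a * d' + b' * d = a' * d + b * d') <-> ((a - b) / d = (a' - b') / d').
Proof.
move=> /lt0r_neq0 n0 /lt0r_neq0 n0'; split=> [h|/eqP].
  by apply/eqP; rewrite eqr_div // mulrBl mulrBl; apply/eqP; lra.
by rewrite eqr_div // => /eqP; lra.
Qed.

Lemma sem_qlt G (p q : frac G) (e : env M G) : fok p e -> fok q e ->
  sem (qlt p q) e <-> fval p e < fval q e.
Proof. by move=> hp hq; rewrite /= (re_lt hi) !iE ratio_lt. Qed.

Lemma sem_qeq G (p q : frac G) (e : env M G) : fok p e -> fok q e ->
  sem (qeq p q) e <-> fval p e = fval q e.
Proof.
move=> hp hq; rewrite /= -ratio_eq // -!iE; split=> [->//|]; exact: (re_inj hi).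
Qed.

Lemma sem_qle G (p q : frac G) (e : env M G) : fok p e -> fok q e ->
  sem (qle p q) e <-> fval p e <= fval q e.
Proof.
move=> hp hq; rewrite le_eqVlt.
split=> [[/(sem_qlt hp hq) ->|/(sem_qeq hp hq) ->]|]; rewrite ?orbT ?eqxx //.
by case/orP => [/eqP /(sem_qeq hp hq)|/(sem_qlt hp hq)]; [right|left].
Qed.

Section FracOps.
Variables (G : ctx) (p q : frac G) (e : env M G).
Hypotheses (hp : fok p e) (hq : fok q e).

Lemma fok_add : fok (qadd p q) e. Proof. by rewrite /fok /= iE mulr_gt0. Qed.
Lemma fok_sub : fok (qsub p q) e. Proof. by rewrite /fok /= iE mulr_gt0. Qed.
Lemma fok_mul : fok (qmul p q) e. Proof. by rewrite /fok /= iE mulr_gt0. Qed.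
Lemma fok_opp : fok (qopp p) e. Proof. exact: hp. Qed.

Lemma fval_add : fval (qadd p q) e = fval p e + fval q e.
Proof.
by rewrite /fval /= !iE; field; rewrite !gt_eqF.
Qed.
Lemma fval_sub : fval (qsub p q) e = fval p e - fval q e.
Proof. by rewrite /fval /= !iE; field; rewrite !gt_eqF. Qed.
Lemma fval_mul : fval (qmul p q) e = fval p e * fval q e.
Proof. by rewrite /fval /= !iE; field; rewrite !gt_eqF. Qed.
Lemma fval_opp : fval (qopp p) e = - fval p e.
Proof. by rewrite /fval /= -mulNr opprB. Qed.
End FracOps.

Definition frac3 G : frac [:: N, N, N & G] :=
  Frac (Var (vs (vs vz))) (Var (vs vz)) (App (App Plus (Var vz)) One).

(** [A] is a function of the metatheory on fractions, so its meaning is asked for only at the triple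
    [frac3] that [dec] supplies. *)
Lemma sem_dec G (c : term G N) A (e : env M G) (P : K -> Prop) :
  (forall a b d, sem (A (frac3 G)) ((d, (b, (a, e))) : env M [:: N, N, N & G]) <-> P (qv a b d)) ->
  (sem (dec c A) e <-> exists q, isq (semt c e) q /\ P q).
Proof.
move=> h; split.
- move=> [a [b [d [h1 h2]]]]; exists (qv a b d); split; last exact/h.
  exists a, b, d; split=> //.
  by move: h1; rewrite /= !semt_up.
- move=> [q [[a [b [d [h1 ->]]]] h2]]; exists a, b, d; split; last exact/h.
  by rewrite /= !semt_up.
Qed.

Lemma sem_dec2 G (c1 c2 : term G N) A (e : env M G) (P : K -> K -> Prop) :
  (forall a b d a' b' d', sem (A (fup (frac3 G)) (frac3 _))
     ((d', (b', (a', (d, (b, (a, e)))))) : env M [:: N, N, N, N, N, N & G])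
     <-> P (qv a b d) (qv a' b' d')) ->
  (sem (dec2 c1 c2 A) e <-> exists p q, [/\ isq (semt c1 e) p, isq (semt c2 e) q & P p q]).
Proof.
move=> h; rewrite (@sem_dec _ _ _ _ (fun p => exists q, isq (semt c2 e) q /\ P p q)).
  by split=> [[p [h1 [q [h2 h3]]]]|[p [q [h1 h2 h3]]]]; exists p; [exists q|split=> //; exists q].
move=> a b d; rewrite (@sem_dec _ _ _ _ (P (qv a b d))); first by rewrite !semt_up.
by move=> a' b' d'; exact: h.
Qed.

Lemma sem_dec3 G (c1 c2 c3 : term G N) A (e : env M G) (P : K -> K -> K -> Prop) :
  (forall a b d a' b' d' a'' b'' d'', sem (A (fup (frac3 G)) (fup (frac3 [:: N, N, N & G])) (frac3 _))
     ((d'', (b'', (a'', (d', (b', (a', (d, (b, (a, e)))))))))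
        : env M [:: N, N, N, N, N, N, N, N, N & G])
     <-> P (qv a b d) (qv a' b' d') (qv a'' b'' d'')) ->
  (sem (dec3 c1 c2 c3 A) e <->
   exists p q r, isq (semt c1 e) p /\ isq (semt c2 e) q /\ isq (semt c3 e) r /\ P p q r).
Proof.
move=> h; rewrite (@sem_dec _ _ _ _ (fun p => exists q, isq (semt c2 e) q /\ exists r, isq (semt c3 e) r /\ P p q r)).
  split=> [[p [h1 [q [h2 [r [h3 h4]]]]]]|[p [q [r [h1 [h2 [h3 h4]]]]]]]; exists p; first by exists q, r.
  by split=> //; exists q; split=> //; exists r.
move=> a b d; rewrite (@sem_dec _ _ _ _ (fun q => exists r, isq (semt c3 e) r /\ P (qv a b d) q r)).
  by rewrite !semt_up.
move=> a' b' d'; rewrite (@sem_dec _ _ _ _ (P (qv a b d) (qv a' b' d'))); first by rewrite !semt_up.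
by move=> a'' b'' d''; exact: h.
Qed.

Definition P2 (n : num) : num := semt (pow2 (Var vz)) ((n, tt) : env M [:: N]).
Definition ep (n : num) : K := (i (P2 n))^-1.

Lemma P2_0 : P2 m0 = m1. Proof. by rewrite /P2 /= R_0. Qed.
Lemma P2_S n : P2 (n +n m1) = P2 n +n P2 n.
Proof. by rewrite /P2 /= R_S S_eq S_eq K_eq. Qed.

Lemma P2_gt n : i n < i (P2 n).
Proof.
apply/(re_lt hi); move: n; apply: arith_ind.
- by apply: Arith_lt; rep.
- by rewrite P2_0; apply/(re_lt hi); rewrite !iE ltr01.
- move=> n /(re_lt hi) h; apply/(re_lt hi); rewrite P2_S !iE.
  have h' := i_succ_le h; have := i_ge0 n; lra.
Qed.

Lemma P2_gt0 n : 0 < i (P2 n).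
Proof. by have := P2_gt n; have := i_ge0 n; lra. Qed.

Lemma ep_gt0 n : 0 < ep n. Proof. by rewrite invr_gt0 P2_gt0. Qed.
Lemma ep_0 : ep m0 = 1. Proof. by rewrite /ep P2_0 iE invr1. Qed.
Lemma ep_S n : ep n = ep (n +n m1) + ep (n +n m1).
Proof. rewrite /ep P2_S !iE; field.
by have h := P2_gt0 n; apply/andP; split; apply: lt0r_neq0; lra.
Qed.

Lemma P2_add (n k : num) : P2 (n +n k) = P2 n *n P2 k.
Proof.
move: k; apply: arith_ind.
- by apply: Arith_eq; rep.
- by rewrite n_add0 P2_0 n_mul1.
- by move=> k h; rewrite n_addA !P2_S h n_mulD.
Qed.

Lemma ep_add n k : ep (n +n k) * i (P2 k) = ep n.
Proof.
rewrite /ep P2_add iE; field.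
by have h := P2_gt0 n; have h' := P2_gt0 k; rewrite !lt0r_neq0.
Qed.

(** A positive [(a - b) / (d + 1)] is at least [1 / (d + 1)], hence at least [2^-d] because
    [d + 1 <= 2^d]; one more halving makes the inequality strict. *)
Lemma ep_small (q : K) : 0 < q -> exists n, ep n < q.
Proof.
move=> q0; have [a [b [d e]]] := re_surj hi q.
have d0 : 0 < i d + 1 by have := i_ge0 d; lra.
have ab : i b + 1 <= i a.
  apply: i_succ_le; move: q0; rewrite e => q0.
  by rewrite -subr_gt0 -(pmulr_lgt0 _ (_ : 0 < (i d + 1)^-1)) // invr_gt0.
exists (d +n m1); have := ep_S d; have := ep_gt0 (d +n m1).
suff : ep d <= q by lra.
rewrite e /ep -div1r ler_pdivrMr ?P2_gt0 // mulrAC ler_pdivlMr // mul1r.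
apply: (@le_trans _ _ (i (P2 d))); first by apply: i_succ_le; exact: P2_gt.
by rewrite ler_peMl ?(ltW (P2_gt0 d)) //; lra.
Qed.

(** Here and below, the formulas on reals are restated with codes replaced by the elements of [K]
    that they denote. *)
Definition isReal_M (x : dom M T1) := forall n k, exists p q,
  [/\ isq (ap x n) p, isq (ap x (n +n k)) q & p - q < ep n /\ q - p < ep n].
Definition eqR_M (x y : dom M T1) := forall n, exists p q,
  [/\ isq (ap x n) p, isq (ap y n) q & p - q <= 2 * ep n /\ q - p <= 2 * ep n].
Definition ltR_M (x y : dom M T1) := exists n, exists p q,
  [/\ isq (ap x n) p, isq (ap y n) q & p + 2 * ep n < q].
Definition leR_M (x y : dom M T1) := forall n, exists p q,
  [/\ isq (ap x n) p, isq (ap y n) q & p <= q + 2 * ep n].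
Definition isSum_M (x y z : dom M T1) := forall n, exists p q r,
  isq (ap x (n +n m1)) p /\ isq (ap y (n +n m1)) q /\ isq (ap z n) r /\ r = p + q.
Definition isDiff_M (x y z : dom M T1) := forall n, exists p q r,
  isq (ap x (n +n m1)) p /\ isq (ap y (n +n m1)) q /\ isq (ap z n) r /\ r = p - q.
Definition isAbs_M (x z : dom M T1) := forall n, exists p r,
  [/\ isq (ap x n) p, isq (ap z n) r & r = `|p|].
Definition isProd_M (x y z : dom M T1) := exists k,
  (exists p q, [/\ isq (ap x m0) p, isq (ap y m0) q & `|p| + `|q| + 2 <= i (P2 k)]) /\
  forall n, exists p q r,
  isq (ap x (n +n k)) p /\ isq (ap y (n +n k)) q /\ isq (ap z n) r /\ r = p * q.

Lemma all_iff T (P Q : T -> Prop) : (forall a, P a <-> Q a) -> (forall a, P a) <-> (forall a, Q a).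
Proof. by move=> h; split=> h' a; apply/h. Qed.
Lemma ex_iff T (P Q : T -> Prop) : (forall a, P a <-> Q a) -> (exists a, P a) <-> (exists a, Q a).
Proof. by move=> h; split=> -[a h']; exists a; apply/h. Qed.

Lemma sem_and G (A B : form G) (e : env M G) (P Q : Prop) :
  (sem A e <-> P) -> (sem B e <-> Q) -> sem (And A B) e <-> P /\ Q.
Proof. by move=> hA hB; split=> -[/hA a /hB b]. Qed.
Lemma sem_or G (A B : form G) (e : env M G) (P Q : Prop) :
  (sem A e <-> P) -> (sem B e <-> Q) -> sem (Or A B) e <-> P \/ Q.
Proof. by move=> hA hB; split=> -[/hA|/hB] h; [left|right|left|right]. Qed.

Lemma sem_qlt_val G (p q : frac G) (e : env M G) a b : fok p e -> fok q e ->
  fval p e = a -> fval q e = b -> sem (qlt p q) e <-> a < b.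
Proof. by move=> hp hq <- <-; exact: sem_qlt. Qed.
Lemma sem_qle_val G (p q : frac G) (e : env M G) a b : fok p e -> fok q e ->
  fval p e = a -> fval q e = b -> sem (qle p q) e <-> a <= b.
Proof. by move=> hp hq <- <-; exact: sem_qle. Qed.
Lemma sem_qeq_val G (p q : frac G) (e : env M G) a b : fok p e -> fok q e ->
  fval p e = a -> fval q e = b -> sem (qeq p q) e <-> a = b.
Proof. by move=> hp hq <- <-; exact: sem_qeq. Qed.

Ltac fok_auto := repeat first
  [ apply: fok_add | apply: fok_sub | apply: fok_mul | apply: fok_opp
  | by rewrite /fok /= ?iE; first [exact: ltr01 | exact: P2_gt0 | apply: ltr_wpDl; [exact: i_ge0|exact: ltr01]]].
Ltac fval_auto := repeat first
  [ rewrite fval_sub; [|by fok_auto|by fok_auto] | rewrite fval_add; [|by fok_auto|by fok_auto]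
  | rewrite fval_mul; [|by fok_auto|by fok_auto] | rewrite fval_opp];
  rewrite /fval /qv /ep /= ?iE ?subr0 ?div1r ?invr1 ?mulr1.
Ltac leaf := repeat first [apply: sem_and | apply: sem_or];
  (first [apply: sem_qlt_val | apply: sem_qle_val | apply: sem_qeq_val];
   [by fok_auto|by fok_auto|by fval_auto|by fval_auto]).

Lemma and_iff (A B P Q : Prop) : (A <-> P) -> (B <-> Q) -> (A /\ B) <-> (P /\ Q).
Proof. by move=> hA hB; split=> -[/hA a /hB b]. Qed.

Section SemR.
Variables (G : ctx) (e : env M G).

Lemma sem_isReal (x : term G T1) : sem (isReal x) e <-> isReal_M (semt x e).
Proof.
rewrite /isReal /isReal_M; cbn [sem all].
apply: all_iff => n; apply: all_iff => k.
etransitivity; first by apply: (@sem_dec2 _ _ _ _ _ (fun p q => p - q < ep n /\ q - p < ep n)) => a b d a' b' d'; leaf.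
by rewrite /= !semt_up.
Qed.

Lemma sem_eqR (x y : term G T1) : sem (eqR x y) e <-> eqR_M (semt x e) (semt y e).
Proof.
rewrite /eqR /eqR_M; cbn [sem all]; apply: all_iff => n.
etransitivity; first by apply: (@sem_dec2 _ _ _ _ _ (fun p q => p - q <= 2 * ep n /\ q - p <= 2 * ep n)) => a b d a' b' d'; leaf.
by rewrite /= !semt_up.
Qed.

Lemma sem_ltR (x y : term G T1) : sem (ltR x y) e <-> ltR_M (semt x e) (semt y e).
Proof.
rewrite /ltR /ltR_M; cbn [sem ex]; apply: ex_iff => n.
etransitivity; first by apply: (@sem_dec2 _ _ _ _ _ (fun p q => p + 2 * ep n < q)) => a b d a' b' d'; leaf.
by rewrite /= !semt_up.
Qed.

Lemma sem_leR (x y : term G T1) : sem (leR x y) e <-> leR_M (semt x e) (semt y e).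
Proof.
rewrite /leR /leR_M; cbn [sem all]; apply: all_iff => n.
etransitivity; first by apply: (@sem_dec2 _ _ _ _ _ (fun p q => p <= q + 2 * ep n)) => a b d a' b' d'; leaf.
by rewrite /= !semt_up.
Qed.

Lemma sem_isSum (x y z : term G T1) : sem (isSum x y z) e <-> isSum_M (semt x e) (semt y e) (semt z e).
Proof.
rewrite /isSum /isSum_M; cbn [sem all]; apply: all_iff => n.
etransitivity; first by apply: (@sem_dec3 _ _ _ _ _ _ (fun p q r => r = p + q)) => a b d a' b' d' a'' b'' d''; leaf.
by rewrite /= !semt_up.
Qed.

Lemma sem_isDiff (x y z : term G T1) : sem (isDiff x y z) e <-> isDiff_M (semt x e) (semt y e) (semt z e).
Proof.
rewrite /isDiff /isDiff_M; cbn [sem all]; apply: all_iff => n.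
etransitivity; first by apply: (@sem_dec3 _ _ _ _ _ _ (fun p q r => r = p - q)) => a b d a' b' d' a'' b'' d''; leaf.
by rewrite /= !semt_up.
Qed.

Lemma abs_cases (p r : K) : (0 <= p /\ r = p) \/ (p <= 0 /\ r = - p) <-> r = `|p|.
Proof.
split=> [[[h ->]|[h ->]]|->]; [by rewrite ger0_norm|by rewrite ler0_norm|].
by case: (leP 0 p) => h; [left; rewrite ger0_norm|right; rewrite ltr0_norm // ltW].
Qed.

Lemma sem_isAbs (x z : term G T1) : sem (isAbs x z) e <-> isAbs_M (semt x e) (semt z e).
Proof.
rewrite /isAbs /isAbs_M; cbn [sem all]; apply: all_iff => n.
etransitivity.
  apply: (@sem_dec2 _ _ _ _ _ (fun p r => r = `|p|)) => a b d a' b' d'.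
  by rewrite -abs_cases; leaf.
by rewrite /= !semt_up.
Qed.

(** [isProd] expresses its bound without absolute values, by one inequality for each choice of the
    two signs. *)
Lemma abs_bound (p q b : K) :
  p + q + 2 <= b /\ p - q + 2 <= b /\ q - p + 2 <= b /\ - (p + q) + 2 <= b
  <-> `|p| + `|q| + 2 <= b.
Proof.
split=> [[h1 [h2 [h3 h4]]]|h].
  by case: (ger0P p) => hp; case: (ger0P q) => hq; lra.
have hp := ler_norm p; have hq := ler_norm q.
have := ler_norm (- p); have := ler_norm (- q); rewrite !normrN => hq' hp'.
by do 3?split; lra.
Qed.

Lemma sem_isProd (x y z : term G T1) : sem (isProd x y z) e <-> isProd_M (semt x e) (semt y e) (semt z e).
Proof.
rewrite /isProd /isProd_M; cbn [sem ex]; apply: ex_iff => k; apply: and_iff.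
  etransitivity.
    apply: (@sem_dec2 _ _ _ _ _ (fun p q => `|p| + `|q| + 2 <= i (P2 k))) => a b d a' b' d'.
    by rewrite -abs_bound; leaf.
  by rewrite /= !semt_up.
cbn [sem all]; apply: all_iff => n.
etransitivity.
  by apply: (@sem_dec3 _ _ _ _ _ _ (fun p q r => r = p * q)) => a b d a' b' d' a'' b'' d''; leaf.
by rewrite /= !semt_up.
Qed.
End SemR.
End Rationals.

Record real_embedding (K : realFieldType) (I : Type) (idx : I -> K) (F : realDomainType)
    (f : K -> F) (lim : (I -> K) -> F) : Prop := {
  fr_add : forall p q, f (p + q) = f p + f q;
  fr_mul : forall p q, f (p * q) = f p * f q;
  fr_1 : f 1 = 1;
  fr_mono : forall p q, (f p <= f q) = (p <= q);
  fr_dense_in : forall x y, x < y -> exists q, x < f q < y;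
  fr_lim : forall u, cauchy idx u -> forall p q,
    ev idx (fun n => p <= u n <= q) -> f p <= lim u <= f q }.

(** * Reals of the model as elements of an ordered ring *)

Section Reals.
Variables (M : aca_model) (K : realFieldType) (i : dom M N -> K).
Hypothesis hi : rational_embedding i.
Variables (F : realDomainType) (f : K -> F) (lim : (dom M N -> K) -> F).
Hypothesis hf : real_embedding i f lim.
Local Notation num := (dom M N).
Local Notation "a +n b" := (ap (ap mplus a) b) (at level 50, left associativity).
Local Notation "a *n b" := (ap (ap mtimes a) b) (at level 40, left associativity).
Local Notation isq := (isq i).
Local Notation ep := (ep i).
Local Notation isReal_M := (isReal_M i).
Local Notation eqR_M := (eqR_M i).
Local Notation ltR_M := (ltR_M i).
Local Notation leR_M := (leR_M i).
Local Notation isSum_M := (isSum_M i).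
Local Notation isDiff_M := (isDiff_M i).
Local Notation isAbs_M := (isAbs_M i).
Local Notation isProd_M := (isProd_M i).
Local Notation iE := (iE hi).

Lemma f0 : f 0 = 0.
Proof. by apply: (@addrI _ (f 0)); rewrite -(fr_add hf) !addr0. Qed.
Lemma fN p : f (- p) = - f p.
Proof. by apply: (@addrI _ (f p)); rewrite -(fr_add hf) !subrr f0. Qed.
Lemma fB p q : f (p - q) = f p - f q.
Proof. by rewrite (fr_add hf) fN. Qed.
Lemma f_lt p q : (f p < f q) = (p < q).
Proof. by rewrite ltNge (fr_mono hf) -ltNge. Qed.
Lemma f_abs p : f `|p| = `|f p|.
Proof.
case: (ger0P p) => h; first by rewrite ger0_norm // -f0 (fr_mono hf).
by rewrite fN ltr0_norm // -f0 f_lt.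
Qed.

(** By density, a positive gap in [F] contains the image of a positive element of [K]. *)
Lemma le_approx (A B : F) : (forall e : K, 0 < e -> A <= B + f e) -> A <= B.
Proof.
move=> h; rewrite leNgt; apply/negP; rewrite -subr_gt0 => /(fr_dense_in hf) [q /andP [q0 q1]].
by have := h q; rewrite -f_lt f0 q0 => /(_ isT); lra.
Qed.

Lemma eq_approx (A B : F) : (forall e : K, 0 < e -> `|A - B| <= f e) -> A = B.
Proof.
move=> h; apply/eqP; rewrite eq_le; apply/andP; split; apply: le_approx => e /h;
  by rewrite ler_norml; lra.
Qed.

(* 0 when [x n] is not the code of a rational. *)
Definition approx (x : dom M T1) (n : num) : K :=
  match pselect (exists q, isq (ap x n) q) with left h => sval (cid h) | right _ => 0 end.

Lemma approx_isq x n q : isq (ap x n) q -> approx x n = q.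
Proof.
move=> h; rewrite /approx; case: pselect => [h'|[]]; last by exists q.
by case: cid => q' /= hq'; exact: isq_fun hi _ _ _ hq' h.
Qed.

Definition rl (x : dom M T1) : F := lim (approx x).

Lemma real_isq x n : isReal_M x -> isq (ap x n) (approx x n).
Proof. by move=> /(_ n m0) [p [q [h _ _]]]; rewrite (approx_isq h). Qed.

Lemma real_regular x n m : isReal_M x -> i n <= i m -> `|approx x n - approx x m| < ep n.
Proof.
move=> hx /(re_sub hi) [k ->]; have [p [q [h h' [a b]]]] := hx n k.
by rewrite (approx_isq h) (approx_isq h') ltr_norml; lra.
Qed.

Lemma mk_real x : (forall n, exists q, isq (ap x n) q) ->
  (forall n m, i n <= i m -> `|approx x n - approx x m| < ep n) -> isReal_M x.
Proof.
move=> hd hr n k; have [p hp] := hd n; have [q hq] := hd (n +n k); exists p, q; split=> //.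
have := hr n (n +n k); rewrite (approx_isq hp) (approx_isq hq) iE => /(_ _).
by have := i_ge0 hi k; rewrite ltr_norml => h /(_ _); lra.
Qed.

Lemma real_cauchy x : isReal_M x -> cauchy i (approx x).
Proof.
move=> hx e /(ep_small hi) [n hn]; exists (approx x n), n => m /(real_regular hx).
by rewrite ltr_norml; lra.
Qed.

Lemma real_approx x n : isReal_M x -> `|rl x - f (approx x n)| <= f (ep n).
Proof.
move=> hx; have := fr_lim hf (real_cauchy hx) (p := approx x n - ep n) (q := approx x n + ep n).
rewrite fB (fr_add hf) ler_norml => /(_ _) h.
have : f (approx x n) - f (ep n) <= rl x <= f (approx x n) + f (ep n); last lra.
apply: h; exists n => m /(real_regular hx).
by rewrite ltr_norml; lra.
Qed.

Lemma ltR_rl x y : isReal_M x -> isReal_M y -> ltR_M x y <-> rl x < rl y.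
Proof.
move=> hx hy; split.
  move=> [n [p [q [/approx_isq hp /approx_isq hq h]]]].
  have := real_approx n hx; have := real_approx n hy; rewrite hp hq !ler_norml.
  have : f (p + 2 * ep n) < f q by rewrite f_lt.
  by have -> : 2 * ep n = ep n + ep n by [ring]; rewrite !(fr_add hf); lra.
move=> /[dup] /(fr_dense_in hf) [q1 /andP [h1 h2]] _.
have [q2 /andP [h3 h4]] := fr_dense_in hf h2.
(* With [ep n] below a quarter of the gap, [approx x n + 2 ep n < q1 + 3 ep n < q2 - ep n < approx y
   n]. *)
have q12 : 0 < (q2 - q1) / 4 by move: h3; rewrite f_lt; lra.
have [n hn] := ep_small hi q12.
exists n, (approx x n), (approx y n); split; try exact: real_isq.
have a : approx x n < q1 + ep n.
  by rewrite -f_lt (fr_add hf); have := real_approx n hx; rewrite ler_norml; lra.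
have b : q2 < approx y n + ep n.
  by rewrite -f_lt (fr_add hf); have := real_approx n hy; rewrite ler_norml; lra.
lra.
Qed.

Lemma leR_rl x y : isReal_M x -> isReal_M y -> leR_M x y <-> rl x <= rl y.
Proof.
move=> hx hy; rewrite leNgt; split=> [h|/negP h].
  apply/negP => /(ltR_rl hy hx) [n [p [q [hp hq hpq]]]].
  have [p' [q' [hp' hq' hpq']]] := h n.
  by move: hpq'; rewrite (isq_fun hi hp' hq) (isq_fun hi hq' hp); lra.
move=> n; exists (approx x n), (approx y n); split; try exact: real_isq.
rewrite leNgt; apply/negP => h'; apply: h; apply/(ltR_rl hy hx).
by exists n, (approx y n), (approx x n); split; try exact: real_isq.
Qed.

Lemma eqR_rl x y : isReal_M x -> isReal_M y -> eqR_M x y <-> rl x = rl y.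
Proof.
move=> hx hy; split=> [h|e].
  apply/eqP; rewrite eq_le; apply/andP; split.
    apply/(leR_rl hx hy) => n; have [p [q [hp hq h']]] := h n.
    by exists p, q; split=> //; lra.
  apply/(leR_rl hy hx) => n; have [p [q [hp hq h']]] := h n.
  by exists q, p; split=> //; lra.
have /(leR_rl hx hy) h1 : rl x <= rl y by rewrite e.
have /(leR_rl hy hx) h2 : rl y <= rl x by rewrite e.
move=> n; have [p [q [hp hq h]]] := h1 n; have [q' [p' [hq' hp' h']]] := h2 n.
by exists p, q; split=> //; move: h'; rewrite (isq_fun hi hp' hp) (isq_fun hi hq' hq); lra.
Qed.

(** The limit is within [ep n] of the approximation, and this is within [2 ep n] of [A];
    [ep n < e / 4] brings the total below [e]. *)
Lemma rl_unique x (A : F) : isReal_M x ->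
  (forall n, `|f (approx x n) - A| <= f (ep n) + f (ep n)) -> rl x = A.
Proof.
move=> hx h; apply: eq_approx => e e0.
have e4 : 0 < e / 4 by lra.
have [n hn] := ep_small hi e4.
have : f (ep n + ep n + (ep n + ep n)) < f e by rewrite f_lt; lra.
have := h n; have := real_approx n hx; rewrite !(fr_add hf) !ler_norml; lra.
Qed.

Lemma isSum_rl x y z : isReal_M x -> isReal_M y -> isSum_M x y z -> isReal_M z /\ rl z = rl x + rl y.
Proof.
move=> hx hy h.
have hv n : isq (ap z n) (approx z n) /\ approx z n = approx x (n +n m1) + approx y (n +n m1).
  have [p [q [r [/approx_isq <- [/approx_isq <- [hr <-]]]]]] := h n.
  by rewrite (approx_isq hr).
have hz : isReal_M z.
  apply: mk_real => [n|n m nm]; first by exists (approx z n); case: (hv n).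
  have nm1 : i (n +n m1) <= i (m +n m1) by rewrite !iE; lra.
  (* The index shift in [isSum] pays for adding two errors, since [ep n] is twice [ep] at the next
     index. *)
  have := real_regular hx nm1; have := real_regular hy nm1.
  by rewrite (hv n).2 (hv m).2 (ep_S hi n) !ltr_norml; lra.
split=> //; apply: rl_unique => // n.
have := real_approx (n +n m1) hx; have := real_approx (n +n m1) hy.
have := ep_gt0 hi (n +n m1); rewrite -f_lt f0.
by rewrite (hv n).2 (ep_S hi n) !(fr_add hf) !ler_norml; lra.
Qed.

Lemma isDiff_rl x y z : isReal_M x -> isReal_M y -> isDiff_M x y z -> isReal_M z /\ rl z = rl x - rl y.
Proof.
move=> hx hy h.
have hv n : isq (ap z n) (approx z n) /\ approx z n = approx x (n +n m1) - approx y (n +n m1).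
  have [p [q [r [/approx_isq <- [/approx_isq <- [hr <-]]]]]] := h n.
  by rewrite (approx_isq hr).
have hz : isReal_M z.
  apply: mk_real => [n|n m nm]; first by exists (approx z n); case: (hv n).
  have nm1 : i (n +n m1) <= i (m +n m1) by rewrite !iE; lra.
  have := real_regular hx nm1; have := real_regular hy nm1.
  by rewrite (hv n).2 (hv m).2 (ep_S hi n) !ltr_norml; lra.
split=> //; apply: rl_unique => // n.
have := real_approx (n +n m1) hx; have := real_approx (n +n m1) hy.
have := ep_gt0 hi (n +n m1); rewrite -f_lt f0.
by rewrite (hv n).2 (ep_S hi n) fB !(fr_add hf) !ler_norml; lra.
Qed.

Lemma isAbs_rl x z : isReal_M x -> isAbs_M x z -> isReal_M z /\ rl z = `|rl x|.
Proof.
move=> hx h.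
have hv n : isq (ap z n) (approx z n) /\ approx z n = `|approx x n|.
  by have [p [r [/approx_isq <- hr <-]]] := h n; rewrite (approx_isq hr).
have hz : isReal_M z.
  apply: mk_real => [n|n m nm]; first by exists (approx z n); case: (hv n).
  rewrite (hv n).2 (hv m).2; apply: le_lt_trans (real_regular hx nm).
  exact: ler_dist_dist.
split=> //; apply: rl_unique => // n.
rewrite (hv n).2 f_abs; apply: le_trans (ler_dist_dist _ _) _; rewrite distrC.
apply: le_trans (real_approx n hx) _; rewrite lerDl.
by have := ep_gt0 hi n; rewrite -f_lt f0; lra.
Qed.

Lemma real_bound x n : isReal_M x -> `|approx x n| < `|approx x m0| + 1.
Proof.
move=> hx; have h0 : i m0 <= i n by rewrite iE i_ge0.
have := real_regular hx h0; rewrite ep_0 // distrC => h.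
have := ler_normD (approx x m0) (approx x n - approx x m0); rewrite addrC subrK; lra.
Qed.

Lemma rl_bound x : isReal_M x -> `|rl x| <= f (`|approx x m0| + 1).
Proof.
move=> hx; have := real_approx m0 hx; rewrite ep_0 // (fr_add hf) f_abs => h.
have := ler_normD (f (approx x m0)) (rl x - f (approx x m0)); rewrite addrC subrK; lra.
Qed.

(** Since [ep m0 = 1], the numbers [a] and [b] bound all approximations of the factors. The shift
    [k] satisfies [a + b <= 2^k], which brings the error of the product down to [ep n]. *)
Lemma isProd_rl x y z : isReal_M x -> isReal_M y -> isProd_M x y z -> isReal_M z /\ rl z = rl x * rl y.
Proof.
move=> hx hy [k [[p [q [/approx_isq <- /approx_isq <- hB]]] h]].
set a := `|approx x m0| + 1; set b := `|approx y m0| + 1.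
have {}hB : a + b <= i (P2 k) by rewrite /a /b; lra.
have abn n : (a + b) * ep (n +n k) <= ep n.
  by rewrite -(ep_add hi n k) mulrC ler_pM2l // ep_gt0.
have xa n : `|approx x n| < a by exact: real_bound.
have yb n : `|approx y n| < b by exact: real_bound.
have hv n : isq (ap z n) (approx z n) /\ approx z n = approx x (n +n k) * approx y (n +n k).
  have {p q} [p [q [r [/approx_isq <- [/approx_isq <- [hr <-]]]]]] := h n.
  by rewrite (approx_isq hr).
have hz : isReal_M z.
  apply: mk_real => [n|n m nm]; first by exists (approx z n); case: (hv n).
  have nmk : i (n +n k) <= i (m +n k) by rewrite !iE; lra.
  rewrite (hv n).2 (hv m).2.
  set x1 := approx x _; set y1 := approx y _; set x2 := approx x _; set y2 := approx y _.
  have -> : x1 * y1 - x2 * y2 = x1 * (y1 - y2) + y2 * (x1 - x2) by ring.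
  apply: le_lt_trans (ler_normD _ _) _; rewrite !normrM.
  apply: lt_le_trans (abn n); rewrite mulrDl; apply: ltrD.
    by apply: ltr_pM => //; [exact: xa|exact: real_regular].
  by apply: ltr_pM => //; [exact: yb|exact: real_regular].
split=> //; apply: rl_unique => // n; rewrite (hv n).2 (fr_mul hf).
set x1 := approx x _; set y1 := approx y _.
have -> : f x1 * f y1 - rl x * rl y = f x1 * (f y1 - rl y) + rl y * (f x1 - rl x) by ring.
apply: le_trans (ler_normD _ _) _; rewrite !normrM.
apply: (@le_trans _ _ (f ((a + b) * ep (n +n k)))).
  rewrite mulrDl (fr_add hf) !(fr_mul hf); apply: lerD; apply: ler_pM => //.
  - by rewrite -f_abs (fr_mono hf) ltW // xa.
  - by rewrite distrC; exact: real_approx.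
  - exact: rl_bound.
  - by rewrite distrC; exact: real_approx.
apply: (@le_trans _ _ (f (ep n))); first by rewrite (fr_mono hf).
by have := ep_gt0 hi n; rewrite -f_lt f0; lra.
Qed.

Definition cst (c : num) : dom M T1 := ap (mK N N) c.

Lemma cst_real c q : isq c q -> isReal_M (cst c) /\ rl (cst c) = f q.
Proof.
move=> h; have hv n : isq (ap (cst c) n) q by rewrite /cst K_eq.
have hr : isReal_M (cst c).
  apply: mk_real => [n|n m _]; first by exists q.
  by rewrite !(approx_isq (hv _)) subrr normr0 ep_gt0.
split=> //; apply: rl_unique => // n; rewrite (approx_isq (hv n)) subrr normr0.
by have := ep_gt0 hi n; rewrite -f_lt f0; lra.
Qed.

End Reals.

(** * Arithmetical formulas and operations on reals *)

Fixpoint arith_form (G : ctx) (A : form G) : bool :=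
  match A with
  | Bot _ | Eq0 _ _ _ | Lt0 _ _ _ => true
  | And _ A B | Or _ A B | Imp _ A B => arith_form A && arith_form B
  | All _ s A | Ex _ s A => match s with N => true | _ => false end && arith_form A
  end.

Section ArithmeticalFormulas.
Variable M : aca_model.

Lemma Rep_semt G s (t : term G s) : Rep (M := M) (semt t).
Proof.
by elim: t => {s} [s v|||||s t|r s t||s t f hf u hu] /=; try exact: Rep_const;
  [exact: Rep_var|exact: Rep_app].
Qed.

Lemma Arith_sem G (A : form G) : arith_form A -> Arith (M := M) (sem A).
Proof.
have eta (D : ctx) (P : env M (N :: D) -> Prop) :
    Arith P -> Arith (fun e : env M (N :: D) => P (e.1, e.2)).
  by apply: Arith_iff => -[].
elim: A => {G} [G|G t u|G t u|G A IHA B IHB|G A IHA B IHB|G A IHA B IHB|G s A IH|G s A IH] /=.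
- by move=> _; exact: Arith_const.
- by move=> _; apply: Arith_eq; exact: Rep_semt.
- by move=> _; apply: Arith_lt; exact: Rep_semt.
- by case/andP => /IHA hA /IHB hB; exact: Arith_and.
- by case/andP => /IHA hA /IHB hB; exact: Arith_or.
- by case/andP => /IHA hA /IHB hB; exact: Arith_imp.
- case: s A IH => //= A IH /IH h.
  by apply: (Arith_all (P := fun e n => sem A (n, e))); exact: eta.
- case: s A IH => //= A IH /IH h.
  by apply: (Arith_ex (P := fun e n => sem A (n, e))); exact: eta.
Qed.

Section Substitution.
Variables (G D : ctx) (sigma : env M G -> env M D).
Hypothesis Rsigma : forall s (v : var D s), Rep (fun e => lookup v (sigma e)).

Lemma Rep_subst s (phi : env M D -> dom M s) : Rep phi -> Rep (fun e => phi (sigma e)).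
Proof.
by elim=> {s phi} [s v|s c|s t f u _ hf _ hu]; [exact: Rsigma|exact: Rep_const|exact: Rep_app].
Qed.

Lemma Arith_subst (P : env M D -> Prop) : Arith P -> Arith (fun e => P (sigma e)).
Proof.
move=> [chi [Rchi h]]; exists (fun e => chi (sigma e)); split; first exact: Rep_subst.
by move=> e; exact: h.
Qed.
End Substitution.

Lemma Rep_subst2 G s t r (phi : env M [:: s; t] -> dom M r) (f : env M G -> dom M s) (g : env M G -> dom M t) :
  Rep phi -> Rep f -> Rep g -> Rep (fun e => phi (f e, (g e, tt))).
Proof.
move=> Rphi Rf Rg; apply: (@Rep_subst G [:: s; t] (fun e => (f e, (g e, tt)))) => //.
by do 2?apply: var_case => //; move=> r' v; case: (var_nil v).
Qed.

Lemma Arith_subst1 G s (P : env M [:: s] -> Prop) (f : env M G -> dom M s) :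
  Arith P -> Rep f -> Arith (fun e => P (f e, tt)).
Proof.
move=> AP Rf; apply: (@Arith_subst G [:: s] (fun e => (f e, tt))) => //.
by apply: var_case => // r v; case: (var_nil v).
Qed.

Lemma Arith_subst2 G s t (P : env M [:: s; t] -> Prop) (f : env M G -> dom M s) (g : env M G -> dom M t) :
  Arith P -> Rep f -> Rep g -> Arith (fun e => P (f e, (g e, tt))).
Proof.
move=> AP Rf Rg; apply: (@Arith_subst G [:: s; t] (fun e => (f e, (g e, tt)))) => //.
by do 2?apply: var_case => //; move=> r' v; case: (var_nil v).
Qed.

Lemma Arith_subst3 G s t r (P : env M [:: s; t; r] -> Prop)
    (f : env M G -> dom M s) (g : env M G -> dom M t) (h : env M G -> dom M r) :
  Arith P -> Rep f -> Rep g -> Rep h -> Arith (fun e => P (f e, (g e, (h e, tt)))).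
Proof.
move=> AP Rf Rg Rh; apply: (@Arith_subst G [:: s; t; r] (fun e => (f e, (g e, (h e, tt))))) => //.
by do 3?apply: var_case => //; move=> r' v; case: (var_nil v).
Qed.
End ArithmeticalFormulas.

Section RealArith.
Variables (M : aca_model) (K : realFieldType) (i : dom M N -> K).
Hypothesis hi : rational_embedding i.
Local Notation num := (dom M N).
Variable G : ctx.
Implicit Types x y z : env M G -> dom M T1.

Local Notation v0 := (Var vz).
Local Notation v1 := (Var (vs vz)).
Local Notation v2 := (Var (vs (vs vz))).

(** The formulas treated from here on quantify over numbers only, which [erefl] verifies by
    computation. *)
Lemma Arith_isReal x : Rep x -> Arith (fun e => isReal_M i (x e)).
Proof.
move=> Rx; apply: (Arith_iff _ (Arith_subst1 (Arith_sem M (A := isReal (v0 : term [:: T1] _)) erefl) Rx)).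
by move=> e; rewrite (sem_isReal hi).
Qed.

Lemma Arith_eqR x y : Rep x -> Rep y -> Arith (fun e => eqR_M i (x e) (y e)).
Proof.
move=> Rx Ry.
apply: (Arith_iff _ (Arith_subst2 (Arith_sem M (A := eqR (v0 : term [:: T1; T1] _) v1) erefl) Rx Ry)).
by move=> e; rewrite (sem_eqR hi).
Qed.

Lemma Arith_ltR x y : Rep x -> Rep y -> Arith (fun e => ltR_M i (x e) (y e)).
Proof.
move=> Rx Ry.
apply: (Arith_iff _ (Arith_subst2 (Arith_sem M (A := ltR (v0 : term [:: T1; T1] _) v1) erefl) Rx Ry)).
by move=> e; rewrite (sem_ltR hi).
Qed.

Lemma Arith_leR x y : Rep x -> Rep y -> Arith (fun e => leR_M i (x e) (y e)).
Proof.
move=> Rx Ry.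
apply: (Arith_iff _ (Arith_subst2 (Arith_sem M (A := leR (v0 : term [:: T1; T1] _) v1) erefl) Rx Ry)).
by move=> e; rewrite (sem_leR hi).
Qed.

Lemma Arith_isSum x y z : Rep x -> Rep y -> Rep z -> Arith (fun e => isSum_M i (x e) (y e) (z e)).
Proof.
move=> Rx Ry Rz.
apply: (Arith_iff _ (Arith_subst3 (Arith_sem M (A := isSum (v0 : term [:: T1; T1; T1] _) v1 v2) erefl) Rx Ry Rz)).
by move=> e; rewrite (sem_isSum hi).
Qed.

Lemma Arith_isDiff x y z : Rep x -> Rep y -> Rep z -> Arith (fun e => isDiff_M i (x e) (y e) (z e)).
Proof.
move=> Rx Ry Rz.
apply: (Arith_iff _ (Arith_subst3 (Arith_sem M (A := isDiff (v0 : term [:: T1; T1; T1] _) v1 v2) erefl) Rx Ry Rz)).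
by move=> e; rewrite (sem_isDiff hi).
Qed.
End RealArith.

Section Functionals.
Variables (M : aca_model) (K : realFieldType) (i : dom M N -> K).
Hypothesis hi : rational_embedding i.
Local Notation num := (dom M N).
Local Notation "a +n b" := (ap (ap mplus a) b) (at level 50, left associativity).

Lemma Rep_cst G (g : env M G -> num) : Rep g -> Rep (fun e => cst (g e)).
Proof. by move=> Rg; apply: Rep_app => //; exact: Rep_const. Qed.

(** Turns an operation given by its graph into an object of the model. The value at [n] depends on
    two codes only, and the operation on codes is read off from [R] at constant sequences, where it
    is known to be arithmetical. *)
Lemma pointwise_functional (op : K -> K -> K) (R : dom M T1 -> dom M T1 -> dom M T1 -> Prop) :
  (forall x y z, R x y z <-> forall n, exists p q r, isq i (ap x (n +n m1)) p /\
     isq i (ap y (n +n m1)) q /\ isq i (ap z n) r /\ r = op p q) ->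
  (forall G (x y z : env M G -> dom M T1), Rep x -> Rep y -> Rep z ->
     Arith (fun e => R (x e) (y e) (z e))) ->
  exists S : dom M (T1 ⟶ T1 ⟶ T1)%ty, forall x y, isReal_M i x -> isReal_M i y -> R x y (ap (ap S x) y).
Proof.
move=> hR AR.
(* The premise makes the choice total on numbers that do not code rationals. *)
pose P (e : env M [:: N; N]) (r : num) :=
  (exists r', R (cst e.1) (cst e.2.1) (cst r')) -> R (cst e.1) (cst e.2.1) (cst r).
have [||phi [Rphi hphi _]] := @arith_choice M [:: N; N] P.
- apply: Arith_imp; last by apply: AR; apply: Rep_cst; rep.
  by apply: Arith_ex; apply: AR; apply: Rep_cst; rep.
- move=> e; case: (pselect (exists r', R (cst e.1) (cst e.2.1) (cst r'))) => [[r hr]|h]; first by exists r.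
  by exists m0.
have [|S hS] := @Rep_fun3 M T1 T1 N N (fun x y n => phi (ap x (n +n m1), (ap y (n +n m1), tt))).
  by apply: (Rep_subst2 (f := fun e : env M [:: N; T1; T1] => ap e.2.2.1 (e.1 +n m1))
    (g := fun e => ap e.2.1 (e.1 +n m1))) => //; rep.
exists S => x y hx hy; apply/hR => n; rewrite hS.
set a := ap x _; set b := ap y _.
have ha : isq i a (approx i x (n +n m1)) := real_isq hi _ hx.
have hb : isq i b (approx i y (n +n m1)) := real_isq hi _ hy.
have [c hc] := isq_surj hi (op (approx i x (n +n m1)) (approx i y (n +n m1))).
have /= hP := hphi (a, (b, tt)).
suff /hP /hR /(_ n) : exists r', R (cst a) (cst b) (cst r') by rewrite /cst !K_eq.
exists c; apply/hR => k; rewrite /cst !K_eq.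
by do 3!eexists; do 3?split; [exact: ha|exact: hb|exact: hc|].
Qed.

Lemma real_add : exists S : dom M (T1 ⟶ T1 ⟶ T1)%ty,
  forall x y, isReal_M i x -> isReal_M i y -> isSum_M i x y (ap (ap S x) y).
Proof.
apply: (@pointwise_functional +%R) => [//|G x y z]; exact: Arith_isSum.
Qed.

Lemma real_sub : exists S : dom M (T1 ⟶ T1 ⟶ T1)%ty,
  forall x y, isReal_M i x -> isReal_M i y -> isDiff_M i x y (ap (ap S x) y).
Proof.
apply: (@pointwise_functional (fun p q => p - q)) => [//|G x y z]; exact: Arith_isDiff.
Qed.

(** If no solution were least, induction on [n] would show that no number below [n] is a
    solution. *)
Lemma arith_least (P : num -> Prop) : Arith (G := [:: N]) (fun e => P e.1) ->
  (exists n, P n) -> exists n, P n /\ forall m, i m < i n -> ~ P m.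
Proof.
move=> AP hP; apply: contrapT => h.
have key : forall n m, i m < i n -> ~ P m.
  apply: arith_ind.
  - apply: Arith_iff (_ : Arith (fun e : env M [:: N] => forall m, mlt m e.1 -> ~ P m)).
      by move=> e; split=> h' m /(re_lt hi) /h'.
    apply: Arith_all; apply: Arith_imp; first by apply: Arith_lt; rep.
    apply: Arith_not; apply: (Arith_subst1 (P := fun e : env M [:: N] => P e.1) (f := fun e : env M [:: N; N] => e.1)) => //; rep.
  - by move=> m; rewrite (re_0 hi) ltNge i_ge0.
  - move=> n IH m; rewrite (re_add hi) (re_1 hi) => hm hPm.
    apply: h; exists m; split=> // k hk; apply: IH.
    rewrite ltNge; apply/negP => nk.
    have := i_succ_le hi hk; lra.
case: hP => n hn; apply: (key (n +n m1) n) => //.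
by rewrite (re_add hi) (re_1 hi) ltrDl ltr01.
Qed.

End Functionals.

(** * The formulas on integrals, read in the model *)

Section Integrals.
Variables (M : aca_model) (K : realFieldType) (i : dom M N -> K).
Hypothesis hi : rational_embedding i.
Local Notation num := (dom M N).
Local Notation real := (dom M T1).
Local Notation seq := (dom M (N ⟶ T1)%ty).
Local Notation fn := (dom M (T1 ⟶ T1)%ty).
Local Notation "a +n b" := (ap (ap mplus a) b) (at level 50, left associativity).
Local Notation "f @ x" := (ap f x) (at level 38, left associativity).

Definition nle (a b : num) := mlt a b \/ a = b.
Definition zeroM : real := cst (mqcode m0 m0 m0).
Definition oneM : real := cst (mqcode m1 m0 m0).

Lemma zeroM_ap n : ap zeroM n = mqcode m0 m0 m0.
Proof. exact: K_eq. Qed.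

Definition inI_M (x : real) := isReal_M i x /\ leR_M i zeroM x /\ leR_M i x oneM.
Definition funR_M (F : fn) :=
  (forall x, isReal_M i x -> isReal_M i (F @ x)) /\
  forall x, isReal_M i x -> forall y, isReal_M i y -> eqR_M i x y -> eqR_M i (F @ x) (F @ y).
Definition funRpos_M (F : fn) := funR_M F /\ forall x, isReal_M i x -> ltR_M i zeroM (F @ x).
Definition funI_M (F : fn) :=
  (forall x, inI_M x -> isReal_M i (F @ x)) /\
  forall x y, inI_M x /\ inI_M y /\ eqR_M i x y -> eqR_M i (F @ x) (F @ y).
Definition tp_M (k : num) (c t : seq) :=
  (forall j, nle j (k +n m1) -> isReal_M i (c @ j)) /\
  eqR_M i (c @ m0) zeroM /\
  eqR_M i (c @ (k +n m1)) oneM /\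
  forall j, nle j k -> isReal_M i (t @ j) /\ ltR_M i (c @ j) (c @ (j +n m1)) /\
    leR_M i (c @ j) (t @ j) /\ leR_M i (t @ j) (c @ (j +n m1)).
Definition fine_M (g : fn) (k : num) (c t : seq) :=
  forall j, nle j k -> forall y, isReal_M i y ->
    leR_M i (c @ j) y /\ leR_M i y (c @ (j +n m1)) ->
    exists l u, isDiff_M i (t @ j) (g @ (t @ j)) l /\ isSum_M i (t @ j) (g @ (t @ j)) u /\
      leR_M i l y /\ leR_M i y u.
Definition isMesh_M (k : num) (c : seq) (m : real) :=
  isReal_M i m /\
  (forall j, nle j k -> exists l, isDiff_M i (c @ (j +n m1)) (c @ j) l /\ leR_M i l m) /\
  exists j, nle j k /\ exists l, isDiff_M i (c @ (j +n m1)) (c @ j) l /\ eqR_M i l m.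
Definition isRSum_M (f : fn) (k : num) (c t : seq) (S : real) :=
  isReal_M i S /\ exists s : seq,
    (forall j, nle j (k +n m1) -> isReal_M i (s @ j)) /\
    eqR_M i (s @ m0) zeroM /\
    (forall j, nle j k -> exists l p u,
       isDiff_M i (c @ (j +n m1)) (c @ j) l /\ isProd_M i (f @ (t @ j)) l p /\
       isSum_M i (s @ j) p u /\ eqR_M i (s @ (j +n m1)) u) /\
    eqR_M i S (s @ (k +n m1)).
Definition distltR_M (x y e : real) :=
  exists d a, isDiff_M i x y d /\ isAbs_M i d a /\ ltR_M i a e.
Definition rsum_near_M (f : fn) (k : num) (c t : seq) (A e : real) :=
  exists S, isRSum_M f k c t S /\ distltR_M S A e.
Definition RiemannInt_M (f : fn) (A : real) :=
  isReal_M i A /\ forall e, isReal_M i e -> ltR_M i zeroM e ->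
    exists d, isReal_M i d /\ ltR_M i zeroM d /\ forall k c t, tp_M k c t ->
      (exists m, isMesh_M k c m /\ leR_M i m d) -> rsum_near_M f k c t A e.
Definition GaugeInt_M (f : fn) (A : real) :=
  isReal_M i A /\ forall e, isReal_M i e -> ltR_M i zeroM e ->
    exists g, funRpos_M g /\ forall k c t, tp_M k c t -> fine_M g k c t -> rsum_near_M f k c t A e.
Definition HBU_M := forall P : fn, funRpos_M P -> exists (k : num) (y : seq),
  (forall j, mlt j k -> inI_M (y @ j)) /\
  forall x, inI_M x -> exists j, mlt j k /\ exists l u,
    isDiff_M i (y @ j) (P @ (y @ j)) l /\ isSum_M i (y @ j) (P @ (y @ j)) u /\
    ltR_M i l x /\ ltR_M i x u.
Definition Uniqueness_M := forall f : fn, funI_M f /\ (exists A, GaugeInt_M f A) ->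
  forall A B, GaugeInt_M f A /\ GaugeInt_M f B -> eqR_M i A B.
Definition Consistency_M := forall f : fn, funI_M f /\ (exists A, RiemannInt_M f A) ->
  (exists A, GaugeInt_M f A) /\
  forall A B, RiemannInt_M f A /\ GaugeInt_M f B -> eqR_M i A B.

Lemma imp_iff (A B P Q : Prop) : (A <-> P) -> (B <-> Q) -> (A -> B) <-> (P -> Q).
Proof. by move=> hA hB; split=> h /hA /h /hB. Qed.

Ltac sem_logic := cbn [sem Defs.all Defs.ex allR exR le0 inst];
  repeat match goal with
  | |- (_ /\ _) <-> _ => apply: and_iff
  | |- (exists _, _) <-> _ => apply: ex_iff => ?
  | |- (_ -> _) <-> _ => apply: imp_iff
  | |- (forall _, _) <-> _ => apply: all_iff => ?
  end.
Ltac sem_atom := first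
  [ rewrite (sem_isReal hi) | rewrite (sem_eqR hi) | rewrite (sem_ltR hi) | rewrite (sem_leR hi)
  | rewrite (sem_isSum hi) | rewrite (sem_isDiff hi) | rewrite (sem_isAbs hi) | rewrite (sem_isProd hi)
  | idtac ]; by rewrite /= ?semt_up.

Section SemI.
Variables (G : ctx) (e : env M G).

Lemma sem_inI (x : term G T1) : sem (inI x) e <-> inI_M (semt x e).
Proof. by rewrite /inI /inI_M; sem_logic; sem_atom. Qed.

Lemma sem_funR (F : term G (T1 ⟶ T1)%ty) : sem (funR F) e <-> funR_M (semt F e).
Proof. by rewrite /funR /funR_M; sem_logic; sem_atom. Qed.

Lemma sem_funRpos (F : term G (T1 ⟶ T1)%ty) : sem (funRpos F) e <-> funRpos_M (semt F e).
Proof. by rewrite /funRpos /funRpos_M; sem_logic; [exact: sem_funR|sem_atom|sem_atom]. Qed.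
End SemI.

Lemma sem_funI G (e : env M G) (F : term G (T1 ⟶ T1)%ty) : sem (funI F) e <-> funI_M (semt F e).
Proof.
by rewrite /funI /funI_M; sem_logic; first [sem_atom | rewrite sem_inI /= ?semt_up].
Qed.

Section SemTP.
Variables (G : ctx) (e : env M G).

Lemma sem_tp k c t : sem (tp k c t) e <-> tp_M (semt k e) (semt c e) (semt t e).
Proof. by rewrite /tp /tp_M; sem_logic; sem_atom. Qed.

Lemma sem_fine g k c t :
  sem (fine g k c t) e <-> fine_M (semt g e) (semt k e) (semt c e) (semt t e).
Proof. by rewrite /fine /fine_M; sem_logic; sem_atom. Qed.

Lemma sem_isMesh k c m : sem (isMesh k c m) e <-> isMesh_M (semt k e) (semt c e) (semt m e).
Proof. by rewrite /isMesh /isMesh_M; sem_logic; sem_atom. Qed.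

Lemma sem_isRSum f k c t S : sem (isRSum f k c t S) e <->
  isRSum_M (semt f e) (semt k e) (semt c e) (semt t e) (semt S e).
Proof. by rewrite /isRSum /isRSum_M; sem_logic; sem_atom. Qed.

Lemma sem_distltR x y d : sem (distltR x y d) e <-> distltR_M (semt x e) (semt y e) (semt d e).
Proof. by rewrite /distltR /distltR_M; sem_logic; sem_atom. Qed.
End SemTP.

Lemma sem_rsum_near G (e : env M G) f k c t A d : sem (rsum_near f k c t A d) e <->
  rsum_near_M (semt f e) (semt k e) (semt c e) (semt t e) (semt A e) (semt d e).
Proof.
rewrite /rsum_near /rsum_near_M; sem_logic; first by rewrite sem_isRSum /= !semt_up.
by rewrite sem_distltR /= !semt_up.
Qed.

Ltac sem_atom2 := first
  [ rewrite sem_funRpos | rewrite sem_tp | rewrite sem_fine | rewrite sem_isMesh | rewrite sem_rsum_near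
  | rewrite sem_inI | rewrite sem_funI
  | rewrite (sem_isReal hi) | rewrite (sem_eqR hi) | rewrite (sem_ltR hi) | rewrite (sem_leR hi)
  | rewrite (sem_isSum hi) | rewrite (sem_isDiff hi) | idtac ]; by rewrite /= ?semt_up.

Lemma sem_RiemannInt G (e : env M G) f A : sem (RiemannInt f A) e <-> RiemannInt_M (semt f e) (semt A e).
Proof. by rewrite /RiemannInt /RiemannInt_M; sem_logic; sem_atom2. Qed.

Lemma sem_GaugeInt G (e : env M G) f A : sem (GaugeInt f A) e <-> GaugeInt_M (semt f e) (semt A e).
Proof. by rewrite /GaugeInt /GaugeInt_M; sem_logic; sem_atom2. Qed.

Lemma sem_HBU : sem (M := M) HBU tt <-> HBU_M.
Proof. by rewrite /HBU /HBU_M; sem_logic; sem_atom2. Qed.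

Lemma sem_Uniqueness : sem (M := M) GaugeUniqueness tt <-> Uniqueness_M.
Proof.
rewrite /GaugeUniqueness /GaugeIntegrable /Uniqueness_M; sem_logic;
  first [rewrite sem_GaugeInt /= ?semt_up // | sem_atom2].
Qed.

Lemma sem_Consistency : sem (M := M) RiemannGaugeConsistency tt <-> Consistency_M.
Proof.
rewrite /RiemannGaugeConsistency /GaugeIntegrable /RiemannIntegrable /Consistency_M; sem_logic;
  first [rewrite sem_GaugeInt /= ?semt_up // | rewrite sem_RiemannInt /= ?semt_up // | sem_atom2].
Qed.
End Integrals.

Ltac arith hi := repeat first
  [ apply: (Arith_ltR hi) | apply: (Arith_leR hi) | apply: (Arith_isReal hi) | apply: (Arith_eqR hi)
  | apply: Arith_eq | apply: Arith_lt
  | apply: Arith_not | apply: Arith_and | apply: Arith_or | apply: Arith_imp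
  | apply: Arith_all | apply: Arith_ex | apply: Arith_const ];
  try (rep; fail).

(* [lra] fails on hypotheses that are equations in types without decidable equality. *)
Ltac nlra := repeat match goal with h : @eq (dom _ _) _ _ |- _ => clear h end; lra.

(** * The equivalences *)

Section Equivalence.
Variables (M : aca_model) (K : realFieldType) (i : dom M N -> K).
Hypothesis hi : rational_embedding i.
Variables (F : realDomainType) (f : K -> F) (lim : (dom M N -> K) -> F).
Hypothesis hf : real_embedding i f lim.
Local Notation num := (dom M N).
Local Notation real := (dom M T1).
Local Notation seq := (dom M (N ⟶ T1)%ty).
Local Notation fn := (dom M (T1 ⟶ T1)%ty).
Local Notation "a +n b" := (ap (ap mplus a) b) (at level 50, left associativity).
Local Notation "f @ x" := (ap f x) (at level 38, left associativity).
Local Notation zeroM := (zeroM M).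
Local Notation oneM := (oneM M).
Local Notation rl := (rl i lim).
Local Notation isReal := (isReal_M i).
Local Notation leR := (leR_M i).
Local Notation ltR := (ltR_M i).
Local Notation eqR := (eqR_M i).
Local Notation iE := (iE hi).
Local Notation ltE := (ltR_rl hi hf).
Local Notation leE := (leR_rl hi hf).
Local Notation eqE := (eqR_rl hi hf).

Lemma nleE a b : nle a b <-> i a <= i b.
Proof.
rewrite le_eqVlt; split=> [[/(re_lt hi) ->|->]|/orP [/eqP /(re_inj hi) ->|/(re_lt hi)]];
  by [rewrite orbT|rewrite eqxx|right|left].
Qed.

Lemma pred_ex (n : num) : n = m0 \/ exists m, n = m +n m1.
Proof.
case: (re_ge1 hi n) => [|h]; [by left|right].
by have [|c ->] := @re_sub _ _ _ hi m1 n; [rewrite iE|exists c; rewrite n_addC].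
Qed.

Lemma zero_isq : isq i (mqcode (m0 : num) m0 m0) 0.
Proof. by exists m0, m0, m0; split=> //; rewrite /qv !iE subr0 mul0r. Qed.
Lemma one_isq : isq i (mqcode (m1 : num) m0 m0) 1.
Proof. by exists m1, m0, m0; split=> //; rewrite /qv !iE subr0 add0r divr1. Qed.

Lemma zero_real : isReal zeroM.
Proof. exact: (cst_real hi hf zero_isq).1. Qed.
Lemma one_real : isReal oneM.
Proof. exact: (cst_real hi hf one_isq).1. Qed.
Lemma zero_rl : rl zeroM = 0.
Proof. by rewrite (cst_real hi hf zero_isq).2 (f0 hf). Qed.
Lemma one_rl : rl oneM = 1.
Proof. by rewrite (cst_real hi hf one_isq).2 (fr_1 hf). Qed.

Lemma inIE x : inI_M i x <-> isReal x /\ 0 <= rl x <= 1.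
Proof.
have zr := zero_real; have or := one_real; split.
  by move=> [hx [/(leE zr hx) + /(leE hx or)]]; rewrite zero_rl one_rl => -> ->.
move=> [hx /andP [h h']]; split=> //; split; first by apply/(leE zr hx); rewrite zero_rl.
by apply/(leE hx or); rewrite one_rl.
Qed.

(* [invc n] codes the rational 1 / (n + 1). *)
Definition invc (n : num) : num := mqcode m1 m0 n.

Lemma invc_real n : isReal (cst (invc n)) /\ rl (cst (invc n)) = f ((i n + 1)^-1).
Proof. by apply: (cst_real hi hf); exists m1, m0, n; split=> //; rewrite /qv !iE subr0 div1r. Qed.

Lemma invc_gt0 n : 0 < rl (cst (invc n)).
Proof.
rewrite (invc_real n).2 -(f0 hf) (f_lt hf) invr_gt0.
by have := i_ge0 hi n; nlra.
Qed.

(** At the number [2^m] the value is [1 / (2^m + 1)], which lies below [2^-m]. *)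
Lemma invc_small (z : F) : 0 < z -> exists n, rl (cst (invc n)) < z.
Proof.
move=> /(fr_dense_in hf) [q /andP []]; rewrite -(f0 hf) (f_lt hf) => q0 qz.
have [n hn] := ep_small hi q0; exists (P2 n); rewrite (invc_real _).2.
apply: lt_trans qz; rewrite (f_lt hf); apply: lt_trans hn.
by rewrite ltf_pV2 ?posrE ?ltrDl ?ltr01 //; have := P2_gt0 hi n; nlra.
Qed.

Section TaggedPartition.
Variables (k : num) (c t : seq).
Hypothesis tpP : tp_M i k c t.

Lemma tp_c_real j : i j <= i k + 1 -> isReal (c @ j).
Proof. by case: tpP => h _ hj; apply: h; apply/nleE; rewrite !iE. Qed.

Lemma tp_c0 : rl (c @ m0) = 0.
Proof.
case: tpP => _ [h _]; rewrite -zero_rl; apply/eqE => //; last exact: zero_real.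
by apply: tp_c_real; rewrite iE; have := i_ge0 hi k; nlra.
Qed.

Lemma tp_c1 : rl (c @ (k +n m1)) = 1.
Proof.
case: tpP => _ [_ [h _]]; rewrite -one_rl; apply/eqE => //; last exact: one_real.
by apply: tp_c_real; rewrite !iE.
Qed.

Lemma tp_step j : i j <= i k -> [/\ isReal (t @ j), rl (c @ j) < rl (c @ (j +n m1))
  & rl (c @ j) <= rl (t @ j) <= rl (c @ (j +n m1))].
Proof.
move=> hj; case: tpP => _ [_ [_ h]]; have [ht [h1 [h2 h3]]] := h j ((nleE j k).2 hj).
have cj : isReal (c @ j) by apply: tp_c_real; nlra.
have cj1 : isReal (c @ (j +n m1)) by apply: tp_c_real; rewrite !iE; nlra.
split=> //; first exact/(ltE cj cj1).
by apply/andP; split; [exact/(leE cj ht)|exact/(leE ht cj1)].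
Qed.

(** The induction is internal to the model, so its predicate is the arithmetical [leR] and not an
    inequality between values of [rl]. *)
Lemma tp_c_ge0 j : i j <= i k + 1 -> 0 <= rl (c @ j).
Proof.
have /(_ j) : forall j, nle j (k +n m1) -> leR zeroM (c @ j).
  apply: arith_ind.
  - by rewrite /nle; arith hi.
  - move=> /nleE h0; have r0 : isReal (c @ m0) by apply: tp_c_real; move: h0; rewrite !iE.
    by apply/(leE zero_real r0); rewrite zero_rl tp_c0.
  - move=> n IH /nleE hn; rewrite !iE in hn.
    have r0 : isReal (c @ n) by apply: tp_c_real; nlra.
    have r1 : isReal (c @ (n +n m1)) by apply: tp_c_real; rewrite !iE; nlra.
    have /(leE zero_real r0) h : leR zeroM (c @ n) by apply: IH; apply/nleE; rewrite !iE; nlra.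
    apply/(leE zero_real r1); apply: le_trans h _.
    by have [|_ h' _] := @tp_step n; [nlra|exact: ltW].
rewrite nleE !iE => h hj; have /leE := h hj; rewrite zero_rl; apply; first exact: zero_real.
exact: tp_c_real.
Qed.

(** The value 1 is known at the last division point, so the induction is on the distance [d] to
    it. *)
Lemma tp_c_le1 j : i j <= i k + 1 -> rl (c @ j) <= 1.
Proof.
move=> hj; have [|d hd] := @re_sub _ _ _ hi j (k +n m1); first by rewrite !iE.
have /(_ d j hd) : forall d j, k +n m1 = j +n d -> leR (c @ j) oneM.
  move=> {j hj d hd}; apply: arith_ind.
  - by arith hi.
  - move=> j; rewrite n_add0 => <-; apply/leE; last by rewrite tp_c1 one_rl.
      by apply: tp_c_real; rewrite !iE.
    exact: one_real.
  - move=> n IH j hj; have /IH h : k +n m1 = (j +n m1) +n n.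
      by rewrite hj -n_addA [m1 +n n]n_addC.
    have := congr1 i hj; rewrite !iE => hj'; have n0 := i_ge0 hi n.
    have r0 : isReal (c @ j) by apply: tp_c_real; nlra.
    have r1 : isReal (c @ (j +n m1)) by apply: tp_c_real; rewrite !iE; nlra.
    move/(leE r1 one_real): h => h; apply/(leE r0 one_real).
    by apply: le_trans h; have [|_ h' _] := @tp_step j; [nlra|exact: ltW].
by move/leE; rewrite one_rl; apply; [exact: tp_c_real|exact: one_real].
Qed.

(** Take the least [j] whose right division point reaches [x]; minimality keeps the left one from
    exceeding [x]. *)
Lemma tp_locate x : isReal x -> 0 <= rl x <= 1 ->
  exists j, i j <= i k /\ rl (c @ j) <= rl x <= rl (c @ (j +n m1)).
Proof.
move=> hx /andP [x0 x1].
have rk : isReal (c @ (k +n m1)) by apply: tp_c_real; rewrite !iE.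
have hk : leR x (c @ (k +n m1)) by apply/(leE hx rk); rewrite tp_c1.
have [||j [hj hmin]] := @arith_least M K i hi (fun j => leR x (c @ (j +n m1))).
- by arith hi.
- by exists k.
have jk : i j <= i k by rewrite leNgt; apply/negP => /hmin; exact.
exists j; split=> //.
have r1 : isReal (c @ (j +n m1)) by apply: tp_c_real; rewrite !iE; nlra.
move/(leE hx r1): hj => ->; rewrite andbT.
case: (pred_ex j) => [->|[n e]]; first by rewrite tp_c0.
have r0 : isReal (c @ j) by apply: tp_c_real; nlra.
rewrite leNgt; apply/negP => h; apply: (hmin n); first by rewrite e !iE ltrDl ltr01.
by rewrite -e; apply/(leE hx r0); exact: ltW.
Qed.

End TaggedPartition.

Section SubAdd.
Variables (SUB ADD : dom M (T1 ⟶ T1 ⟶ T1)%ty).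
Hypothesis SUBP : forall x y, isReal x -> isReal y -> isDiff_M i x y (SUB @ x @ y).
Hypothesis ADDP : forall x y, isReal x -> isReal y -> isSum_M i x y (ADD @ x @ y).

Lemma sub_rl x y : isReal x -> isReal y -> isReal (SUB @ x @ y) /\ rl (SUB @ x @ y) = rl x - rl y.
Proof. by move=> hx hy; apply: (isDiff_rl hi hf hx hy); exact: SUBP. Qed.
Lemma add_rl x y : isReal x -> isReal y -> isReal (ADD @ x @ y) /\ rl (ADD @ x @ y) = rl x + rl y.
Proof. by move=> hx hy; apply: (isSum_rl hi hf hx hy); exact: ADDP. Qed.


(** A point strictly between two division points lies in the open gauge interval of the tag. The
    division points themselves may be end points of the closed gauge intervals, so they are made
    centres too. *)
Lemma fine_cover (g : fn) k c t : funRpos_M i g -> tp_M i k c t -> fine_M i g k c t ->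
  exists (k' : num) (y : seq), (forall j, mlt j k' -> inI_M i (y @ j)) /\
  forall x, inI_M i x -> exists j, mlt j k' /\ exists l u,
    isDiff_M i (y @ j) (g @ (y @ j)) l /\ isSum_M i (y @ j) (g @ (y @ j)) u /\
    ltR l x /\ ltR x u.
Proof.
move=> [[gr ge] gpos] tpP hfine.
pose k1 := k +n m1; pose k2 := k1 +n m1.
(* Positions up to [k1] hold the [k + 2] division points, and positions from [k2] on hold the tags.
   The family is built value by value, since the choice yields numbers. *)
have [y [yc yt]] : exists y : seq, (forall j, i j <= i k1 -> y @ j = c @ j)
    /\ forall j, y @ (k2 +n j) = t @ j.
  pose P (e : env M [:: N; N]) v :=
    (nle e.2.1 k1 -> v = c @ e.2.1 @ e.1) /\ forall m, e.2.1 = k2 +n m -> v = t @ m @ e.1.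
  have [||phi [Rphi hphi _]] := @arith_choice M [:: N; N] P.
  - by rewrite /P /nle; arith hi.
  - move=> [n [j []]]; rewrite /P /=; case: (lerP (i j) (i k1)) => h.
      exists (c @ j @ n); split=> // m e; exfalso; move: h; rewrite e /k2 !iE.
      by have := i_ge0 hi m; nlra.
    have [|m hm] := @re_sub _ _ _ hi k2 j; first by rewrite /k2 (re_add hi) (re_1 hi); exact: (i_succ_le hi).
    exists (t @ m @ n); split=> [/nleE h'|m' e']; first by exfalso; nlra.
    suff -> : m = m' by [].
    by apply: (re_inj hi); have := congr1 i hm; rewrite e' !iE; nlra.
  have [|y hy] := @Rep_fun2 M N N N (fun j n => phi (n, (j, tt))).
    by have -> : (fun e : env M [:: N; N] => phi (e.1, (e.2.1, tt))) = phi
      by apply: funext => -[a [b []]].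
  exists y; split=> j; last first.
    by apply: dom_ext => n; rewrite hy; exact: (hphi (n, (k2 +n j, tt))).2.
  by move=> hj; apply: dom_ext => n; rewrite hy; apply: (hphi (n, (j, tt))).1; apply/nleE.
have cI j : i j <= i k + 1 -> inI_M i (c @ j).
  move=> hj; apply/inIE; split; first exact: tp_c_real tpP _ hj.
  by rewrite (tp_c_ge0 tpP) // (tp_c_le1 tpP).
have tI j : i j <= i k -> inI_M i (t @ j).
  move=> hj; have [tr _ /andP [h1 h2]] := tp_step tpP hj; apply/inIE; split=> //.
  have /inIE [_ /andP [h3 _]] : inI_M i (c @ j) by apply: cI; nlra.
  have /inIE [_ /andP [_ h4]] : inI_M i (c @ (j +n m1)) by apply: cI; rewrite !iE; nlra.
  by apply/andP; split; [exact: le_trans h3 h1|exact: le_trans h2 h4].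
(* A centre equal to [x] as a real covers [x], because the gauge is positive. *)
have around x z : inI_M i x -> inI_M i z -> rl z = rl x -> exists l u,
    isDiff_M i z (g @ z) l /\ isSum_M i z (g @ z) u /\ ltR l x /\ ltR x u.
  move=> /inIE [xr _] /inIE [zr _] e; have gz := gr z zr.
  have gp : 0 < rl (g @ z) by rewrite -zero_rl; apply/(ltE zero_real gz); exact: gpos.
  have [lr le] := sub_rl zr gz; have [ur ue] := add_rl zr gz.
  exists (SUB @ z @ (g @ z)), (ADD @ z @ (g @ z)); do 3?split; [exact: SUBP|exact: ADDP| |].
    by apply/ltE => //; rewrite le e; nlra.
  by apply/ltE => //; rewrite ue e; nlra.
exists (k2 +n k1), y; split.
  move=> j /(re_lt hi); rewrite !iE => hj; case: (lerP (i j) (i k1)) => h.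
    by rewrite yc //; apply: cI; move: h; rewrite !iE.
  have [|m hm] := @re_sub _ _ _ hi k2 j; first by rewrite /k2 (re_add hi) (re_1 hi); exact: (i_succ_le hi).
  rewrite hm yt; apply: tI; have hm' := congr1 i hm; rewrite !iE in hm'.
  have : i m < i k1 by rewrite !iE; nlra.
  rewrite leNgt; move=> h1; apply/negP => /(i_succ_le hi).
  by move: h1; rewrite !iE; nlra.
move=> x xI; have /inIE [xr x01] := xI; have [j [jk /andP [h1 h2]]] := tp_locate tpP xr x01.
have j0 := i_ge0 hi j.
have c0I : inI_M i (c @ j) by apply: cI; nlra.
have c1I : inI_M i (c @ (j +n m1)) by apply: cI; rewrite !iE; nlra.
move: h1; rewrite le_eqVlt => /orP [/eqP h1|h1].
  exists j; split; first by apply/(re_lt hi); rewrite !iE; nlra.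
  by rewrite yc ?iE; [exact: around|nlra].
move: h2; rewrite le_eqVlt => /orP [/eqP h2|h2].
  exists (j +n m1); split; first by apply/(re_lt hi); rewrite !iE; nlra.
  by rewrite yc ?iE; [exact: around|nlra].
exists (k2 +n j); split; first by apply/(re_lt hi); rewrite !iE; nlra.
rewrite yt; have [tr cc _] := tp_step tpP jk; have gt := gr _ tr.
have /inIE [c0r _] := c0I; have /inIE [c1r _] := c1I.
(* Fineness is applied at both end points: the left one gives the lower bound, the right one the
   upper bound. *)
have [l [u [hl [hu [h3 h4]]]]] : exists l u, isDiff_M i (t @ j) (g @ (t @ j)) l /\
    isSum_M i (t @ j) (g @ (t @ j)) u /\ leR l (c @ j) /\ leR (c @ j) u.
  apply: hfine => //; first exact/nleE.
  by split; apply/leE => //; exact: ltW.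
have [l' [u' [hl' [hu' [h3' h4']]]]] : exists l u, isDiff_M i (t @ j) (g @ (t @ j)) l /\
    isSum_M i (t @ j) (g @ (t @ j)) u /\ leR l (c @ (j +n m1)) /\ leR (c @ (j +n m1)) u.
  apply: hfine => //; first exact/nleE.
  by split; apply/leE => //; exact: ltW.
have [lr _] := isDiff_rl hi hf tr gt hl; have [ur' _] := isSum_rl hi hf tr gt hu'.
exists l, u'; do 3?split=> //.
  by apply/(ltE lr xr); apply: le_lt_trans h1; apply/(leE lr c0r).
by apply/(ltE xr ur'); apply: lt_le_trans h2 _; apply/(leE c1r ur').
Qed.

(** * Gauges without fine partitions *)

Definition zero_fun : fn := ap (mK T1 T1) zeroM.

Lemma zero_funI : funI_M i zero_fun.
Proof.
split=> [x _|x y _]; rewrite /zero_fun !K_eq; first exact: zero_real.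
by apply/eqE => //; exact: zero_real.
Qed.

Lemma gauge_vacuous (g h : fn) (A : real) : funRpos_M i g -> isReal A ->
  (~ exists k c t, tp_M i k c t /\ fine_M i g k c t) -> GaugeInt_M i h A.
Proof.
move=> gpos Ar hn; split=> // e _ _; exists g; split=> // k c t h1 h2.
by case: hn; exists k, c, t.
Qed.

(** A gauge with a fine partition has a finite cover by [fine_cover], so only gauges without one
    remain to be refuted. *)
Lemma HBU_of_separation :
  (forall g : fn, funRpos_M i g -> (~ exists k c t, tp_M i k c t /\ fine_M i g k c t) -> False) ->
  HBU_M i.
Proof.
move=> h P hP; have [k [c [t [h1 h2]]]] := contrapT (h P hP).
exact: fine_cover hP h1 h2.
Qed.

Lemma not_eqR_01 : ~ eqR zeroM oneM.
Proof.
move/(eqE zero_real one_real); rewrite zero_rl one_rl => /eqP.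
by rewrite eq_sym oner_eq0.
Qed.

Lemma uniqueness_HBU : Uniqueness_M i -> HBU_M i.
Proof.
move=> hU; apply: HBU_of_separation => g gpos hn.
have h0 := gauge_vacuous zero_fun gpos zero_real hn.
have h1 := gauge_vacuous zero_fun gpos one_real hn.
apply: not_eqR_01; apply: (hU zero_fun _ zeroM oneM (conj h0 h1)).
by split; [exact: zero_funI|exists zeroM].
Qed.

Lemma isq_zero n : isq i (ap zeroM n) 0.
Proof. by rewrite zeroM_ap; exact: zero_isq. Qed.

(** To contradict consistency, the gauge integral 1 is set against the Riemann integral 0, whose
    sums are verified here with all partial sums and products equal to 0. *)
Lemma riemann_zero : RiemannInt_M i zero_fun zeroM.
Proof.
have zz : eqR zeroM zeroM by apply/eqE => //; exact: zero_real.
split; first exact: zero_real.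
move=> e er epos; exists oneM; split; first exact: one_real.
split; first by apply/(ltE zero_real one_real); rewrite zero_rl one_rl ltr01.
move=> k c t tpP _; exists zeroM; split; last first.
  exists zeroM, zeroM; split.
    by move=> n; exists 0, 0, 0; do 3?split; try exact: isq_zero; rewrite subr0.
  split=> // n; exists 0, 0; rewrite normr0; split=> //; exact: isq_zero.
split; first exact: zero_real.
exists (ap (mK T1 N) zeroM); split; first by move=> j _; rewrite K_eq; exact: zero_real.
split; first by rewrite K_eq.
split; last by rewrite K_eq.
move=> j /nleE jk.
have cr : isReal (c @ j) by apply: (tp_c_real tpP); nlra.
have c1r : isReal (c @ (j +n m1)) by apply: (tp_c_real tpP); rewrite !iE; nlra.
exists (SUB @ (c @ (j +n m1)) @ (c @ j)), zeroM, zeroM.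
split; first exact: SUBP.
have [lr _] := sub_rl c1r cr; set l := SUB @ _ @ _ in lr *.
rewrite /zero_fun !K_eq; split; last split=> //.
  have hl n := real_isq hi n lr.
  (* [isProd] demands an exponent for which the power of 2 bounds this rational; its numerator [a]
     serves, because [a < 2^a]. *)
  have [a [b [d hb]]] := re_surj hi (`|approx i l m0| + 2).
  exists a; split.
    exists 0, (approx i l m0); split=> //; first exact: isq_zero.
    rewrite normr0 add0r; apply: ltW; apply: le_lt_trans (P2_gt hi a).
    rewrite hb ler_pdivrMr; last by have := i_ge0 hi d; nlra.
    by have := i_ge0 hi a; have := i_ge0 hi b; have := i_ge0 hi d; nra.
  move=> n; exists 0, (approx i l (n +n a)), 0; do 3?split; try exact: isq_zero; first exact: hl.
  by rewrite mul0r.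
by move=> n; exists 0, 0, 0; do 3?split; try exact: isq_zero; rewrite addr0.
Qed.

Lemma consistency_HBU : Consistency_M i -> HBU_M i.
Proof.
move=> hC; apply: HBU_of_separation => g gpos hn.
have h1 := gauge_vacuous zero_fun gpos one_real hn.
apply: not_eqR_01; apply: (hC zero_fun _).2 (conj riemann_zero h1).
by split; [exact: zero_funI|exists zeroM; exact: riemann_zero].
Qed.

(** * From a finite cover to a fine tagged partition *)

(** The range may be nonstandard, so the maximum is obtained by an internal induction on its length,
    comparing the new entry with the maximum so far. *)
Lemma argmax (r : seq) (P : num -> Prop) k : Arith (G := [:: N]) (fun e => P e.1) ->
  (forall j, mlt j k -> isReal (r @ j)) -> (exists j, mlt j k /\ P j) ->
  exists j, [/\ mlt j k, P j & forall j', mlt j' k -> P j' -> rl (r @ j') <= rl (r @ j)].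
Proof.
move=> AP hr [j0 [j0k Pj0]].
have AP' G (g : env M G -> num) : Rep g -> Arith (fun e => P (g e)).
  by move=> Rg; apply: (Arith_subst1 (P := fun e : env M [:: N] => P e.1) AP Rg).
have key : forall n, nle n k -> (exists j, mlt j n /\ P j) ->
    exists j, (mlt j n /\ P j) /\ forall j', mlt j' n -> P j' -> leR (r @ j') (r @ j).
  apply: arith_ind.
  - by rewrite /nle; arith hi; apply: AP'; rep.
  - by move=> _ [j []] /(re_lt hi); rewrite iE ltNge i_ge0.
  - move=> n IH /nleE; rewrite !iE => nk [j1 [/(re_lt hi) + Pj1]]; rewrite !iE => j1n.
    have nk' : mlt n k by apply/(re_lt hi); nlra.
    have ltS j : mlt j (n +n m1) -> mlt j n \/ j = n.
      move=> /(re_lt hi); rewrite !iE => h; case: (ltgtP (i j) (i n)) => [/(re_lt hi)|h'|/(re_inj hi)].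
      + by left.
      + by exfalso; have := i_succ_le hi h'; nlra.
      + by right.
    have Slt j : mlt j n -> mlt j (n +n m1) by move=> /(re_lt hi) h; apply/(re_lt hi); rewrite !iE; nlra.
    have nS : mlt n (n +n m1) by apply/(re_lt hi); rewrite !iE; nlra.
    have rn := hr n nk'.
    have rj j : mlt j n -> isReal (r @ j).
      by move=> /(re_lt hi) h; apply: hr; apply/(re_lt hi); nlra.
    case: (pselect (exists j, mlt j n /\ P j)) => [/IH hj|hno]; last first.
      exists n; split; first split=> //.
        case: (ltS j1) => [|h|<- //]; first by apply/(re_lt hi); rewrite !iE.
        by case: hno; exists j1.
      move=> j' /ltS [h Pj'|-> _]; first by case: hno; exists j'.
      by apply/leE.
    have [|j [[jn Pj] jmax]] := hj; first by apply/nleE; nlra.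
    case: (pselect (P n /\ rl (r @ j) <= rl (r @ n))) => [[Pn h]|hn].
      exists n; split=> // j' /ltS [j'n Pj'|-> _]; last exact/leE.
      apply/leE => //; first exact: rj.
      by apply: le_trans h; apply/leE; [exact: rj|exact: rj|exact: jmax].
    exists j; split; first by split=> //; exact: Slt.
    move=> j' /ltS [|->]; first exact: jmax.
    move=> Pn; apply/leE => //; first exact: rj.
    by rewrite leNgt; apply/negP => /ltW h; apply: hn.
have [||j [[jk Pj] h]] := key k; [by right|by exists j0|].
by exists j; split=> // j' j'k Pj'; apply/leE; [exact: hr|exact: hr|exact: h].
Qed.

(* After [a] continue with an interval that contains [up a] and reaches as far right as
   possible. If the chain never passed 1, a visited interval with the largest right end would
   have a successor reaching further; and greediness makes the left ends, hence the centres,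
   increase. *)
Lemma greedy_chain (k : num) (y lo up : seq) :
  (forall j, mlt j k -> [/\ isReal (y @ j), isReal (lo @ j) & isReal (up @ j)]) ->
  (forall j, mlt j k -> [/\ rl (lo @ j) < rl (y @ j), rl (y @ j) < rl (up @ j),
     rl (lo @ j) + rl (up @ j) = rl (y @ j) + rl (y @ j) & 0 <= rl (y @ j) <= 1]) ->
  (forall x, isReal x -> 0 <= rl x <= 1 ->
     exists j, mlt j k /\ rl (lo @ j) < rl x < rl (up @ j)) ->
  exists (m : num) (s : dom M T1), [/\ forall j, i j <= i m -> mlt (s @ j) k,
    rl (lo @ (s @ m0)) < 0, 1 < rl (up @ (s @ m))
    & forall j, i j < i m -> rl (y @ (s @ j)) < rl (y @ (s @ (j +n m1))) /\
        rl (lo @ (s @ (j +n m1))) < rl (up @ (s @ j))].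
Proof.
move=> hreal hctr hcov.
have zr := zero_real; have or := one_real.
have hup j : mlt j k -> isReal (up @ j) by case/hreal.
have hlo j : mlt j k -> isReal (lo @ j) by case/hreal.
pose next a b := [/\ mlt b k, ltR (lo @ b) (up @ a), ltR (up @ a) (up @ b)
  & forall b', mlt b' k -> ltR (lo @ b') (up @ a) -> ltR (up @ a) (up @ b') -> leR (up @ b') (up @ b)].
(* The chain starts with the interval around 0 that reaches furthest to the right. *)
have [j0 [j0k [j0l j0u] j0max]] : exists j, [/\ mlt j k, ltR (lo @ j) zeroM /\ ltR zeroM (up @ j)
    & forall j', mlt j' k -> ltR (lo @ j') zeroM /\ ltR zeroM (up @ j') -> rl (up @ j') <= rl (up @ j)].
  apply: argmax => //; first by arith hi.
  have [|j [jk /andP [h h']]] := hcov zeroM zr; first by rewrite zero_rl lexx ler01.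
  by exists j; split=> //; split; [apply/(ltE (hlo _ jk) zr)|apply/(ltE zr (hup _ jk))].
have next_ex a : mlt a k -> leR (up @ a) oneM -> exists b, next a b.
  move=> ak /(leE (hup _ ak) or); rewrite one_rl => a1; have ua := hup a ak.
  have [b [bk [b1 b2] bmax]] : exists b, [/\ mlt b k, ltR (lo @ b) (up @ a) /\ ltR (up @ a) (up @ b)
    & forall j', mlt j' k -> ltR (lo @ j') (up @ a) /\ ltR (up @ a) (up @ j') -> rl (up @ j') <= rl (up @ b)].
    apply: argmax => //; first by arith hi.
    have [|j [jk /andP [h h']]] := hcov (up @ a) ua.
      by have [_ h _ /andP [h' _]] := hctr a ak; rewrite a1 andbT; nlra.
    by exists j; split=> //; split; [apply/(ltE (hlo _ jk) ua)|apply/(ltE ua (hup _ jk))].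
  exists b; split=> // b' b'k h1 h2; apply/leE; [exact: hup|exact: hup|exact: bmax].
have [nx hnx] : exists nx : dom M T1, forall a, (mlt a k /\ leR (up @ a) oneM) -> next a (nx @ a).
  apply: (@arith_choice_fun M (fun a b => (mlt a k /\ leR (up @ a) oneM) -> next a b)).
    apply: Arith_iff (_ : Arith (fun e : env M [:: N; N] => (mlt e.2.1 k /\ leR (up @ e.2.1) oneM) ->
      mlt e.1 k /\ ltR (lo @ e.1) (up @ e.2.1) /\ ltR (up @ e.2.1) (up @ e.1) /\
      forall b', mlt b' k -> ltR (lo @ b') (up @ e.2.1) -> ltR (up @ e.2.1) (up @ b') -> leR (up @ b') (up @ e.1))).
      by move=> e; split=> h /h; [case=> ? [? []]|case].
    by arith hi.
  move=> a; case: (pselect (mlt a k /\ leR (up @ a) oneM)) => [[h1 h2]|h]; last by exists m0.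
  by have [b hb] := next_ex a h1 h2; exists b.
(* The successor choice [nx] is one object of the model, so the recursor can iterate it a
   nonstandard number of times. *)
pose s := ap (ap mR nx) j0.
have s0 : s @ m0 = j0 by exact: R_0.
have sS n : s @ (n +n m1) = nx @ (s @ n) by exact: R_S.
pose good n := mlt (s @ n) k /\ leR (up @ (s @ n)) oneM.
have goodS n : good n -> next (s @ n) (s @ (n +n m1)) by rewrite sS; exact: hnx.
have [m [bad hmin]] : exists m, ~ good m /\ forall n, i n < i m -> ~ ~ good n.
  apply: (arith_least hi); first by rewrite /good; arith hi.
  apply: contrapT => hno.
  have allgood n : good n by apply: contrapT => h; apply: hno; exists n.
  have [||a [ak [n an] amax]] := @argmax up (fun a => exists n, a = s @ n) k _ hup.
  - by arith hi.
  - by exists j0; split=> //; exists m0.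
  have [bk _ h _] := goodS n (allgood n).
  have h1 : rl (up @ (s @ (n +n m1))) <= rl (up @ a) by apply: amax => //; exists (n +n m1).
  move: h; rewrite -an => /(ltE (hup _ ak) (hup _ bk)); rewrite ltNge => /negP; exact.
have {}hmin n : i n < i m -> good n by move=> h; exact: (contrapT (hmin n h)).
have sk j : i j <= i m -> mlt (s @ j) k.
  case: (pred_ex j) => [->|[n ->]]; first by rewrite s0.
  by rewrite (re_add hi) (re_1 hi) => h; case: (goodS n) => //; apply: hmin; nlra.
(* An interval that reaches further than the first one starts at 0 or later; otherwise it would
   contain 0 and have been preferred at the start. *)
have lt0 j : mlt j k -> rl (up @ j0) < rl (up @ j) -> 0 <= rl (lo @ j).
  move=> jk h; rewrite leNgt; apply/negP => h'.
  move/(ltE zr (hup _ j0k)): j0u; rewrite zero_rl => u0.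
  suff : rl (up @ j) <= rl (up @ j0) by rewrite leNgt h.
  apply: j0max => //; split; first by apply/(ltE (hlo _ jk) zr); rewrite zero_rl.
  by apply/(ltE zr (hup _ jk)); rewrite zero_rl (lt_trans u0).
exists m, s; split=> //.
- by rewrite s0 -zero_rl; apply/(ltE (hlo _ j0k) zr).
- rewrite ltNge; apply/negP => h; apply: bad; split; first exact: sk.
  by apply/leE => //; [exact: hup (sk m (lexx _))|rewrite one_rl].
move=> j jm; have gj := hmin j jm; have [bk b1 b2 bmax] := goodS j gj.
have ak := gj.1; have ua := hup _ ak; have ub := hup _ bk; have lb := hlo _ bk; have la := hlo _ ak.
move/(ltE lb ua): b1 => b1; move/(ltE ua ub): b2 => b2; split=> //.
have [_ _ ea _] := hctr _ ak; have [_ _ eb _] := hctr _ bk.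
(* Centres are midpoints and the right ends increase, so it is enough that the left ends
   increase. *)
suff : rl (lo @ (s @ j)) < rl (lo @ (s @ (j +n m1))) by nlra.
case: (pred_ex j) => [ej|[n ej]].
  have h : 0 <= rl (lo @ (s @ (j +n m1))) by apply: lt0 => //; rewrite -s0 -ej.
  by apply: lt_le_trans h; rewrite ej s0 -zero_rl; apply/(ltE (hlo _ j0k) zr).
have gn : good n by apply: hmin; move: jm; rewrite ej (re_add hi) (re_1 hi); nlra.
have := goodS n gn; rewrite -ej => -[_ c1 c2 cmax].
have uc := hup _ gn.1; move/(ltE la uc): (c1) => d1; move/(ltE uc ua): (c2) => d2.
(* If the later interval began before the right end of [s @ n], it was already a candidate at step
   [n], where the interval chosen reaches less far. *)
apply: lt_le_trans d1 _; rewrite leNgt; apply/negP => h.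
have : rl (up @ (s @ (j +n m1))) <= rl (up @ (s @ j)); last by rewrite leNgt b2.
apply/(leE ub ua); apply: cmax => //; first exact/(ltE lb uc).
by apply/(ltE uc ub); exact: lt_trans d2 b2.
Qed.

(** An inequality asserts that its entries decode, so the constant sequence has the code of a
    rational as its value. This recovers reality from chosen codes. *)
Lemma cst_lt_real x v : ltR x (cst v) \/ ltR (cst v) x -> isReal (cst v).
Proof.
have key q n : isq i (cst v @ n) q -> isReal (cst v).
  by rewrite /cst K_eq => /(cst_real hi hf) [].
by case=> -[n [p [q [h h' _]]]]; [exact: key h'|exact: key h].
Qed.

(** The set of [n] with [1 / (n + 1)] below both gauges is the same at equal reals, and the selector
    depends on this set alone; hence the new gauge respects equality. *)
Lemma common_gauge (g1 g2 : fn) : funRpos_M i g1 -> funRpos_M i g2 ->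
  exists g : fn, funRpos_M i g /\
    forall x, isReal x -> rl (g @ x) < rl (g1 @ x) /\ rl (g @ x) < rl (g2 @ x).
Proof.
move=> [[gr1 ge1] gp1] [[gr2 ge2] gp2].
(* The premise makes the choice total on sequences that are not reals. *)
pose P (e : env M [:: T1]) n :=
  isReal e.1 -> ltR (cst (invc n)) (g1 @ e.1) /\ ltR (cst (invc n)) (g2 @ e.1).
have [||phi [Rphi hphi phi_ext]] := @arith_choice M [:: T1] P.
- by rewrite /P; arith hi.
- move=> [x []]; rewrite /P /=; case: (pselect (isReal x)) => xr; last by exists m0.
  have r1 := gr1 x xr; have r2 := gr2 x xr.
  have p1 : 0 < rl (g1 @ x) by rewrite -zero_rl; apply/(ltE zero_real r1); exact: gp1.
  have p2 : 0 < rl (g2 @ x) by rewrite -zero_rl; apply/(ltE zero_real r2); exact: gp2.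
  have [|n hn] := @invc_small (Num.min (rl (g1 @ x)) (rl (g2 @ x))); first by rewrite lt_min p1.
  have nr := (invc_real n).1; move: hn; rewrite lt_min => /andP [h1 h2].
  by exists n => _; split; [exact/(ltE nr r1)|exact/(ltE nr r2)].
have [|g hg] := @Rep_fun1 M T1 T1 (fun x => cst (invc (phi (x, tt)))).
  have Rphi' : Rep (fun e : env M [:: T1] => phi (e.1, tt)).
    by have -> // : (fun e : env M [:: T1] => phi (e.1, tt)) = phi by apply: funext => -[a []].
  by rep.
exists g; split; last first.
  move=> x xr; rewrite hg; have [h1 h2] := hphi (x, tt) xr; have nr := (invc_real (phi (x, tt))).1.
  by split; [exact/(ltE nr (gr1 x xr))|exact/(ltE nr (gr2 x xr))].
split; last by move=> x xr; rewrite hg; apply/(ltE zero_real (invc_real _).1); rewrite zero_rl invc_gt0.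
split; first by move=> x _; rewrite hg; exact: (invc_real _).1.
move=> x xr y yr xy; rewrite !hg.
have -> : phi (x, tt) = phi (y, tt); last by apply/eqE => //; exact: (invc_real _).1.
apply: phi_ext => n; rewrite /P /=; have nr := (invc_real n).1.
have e1 : rl (g1 @ x) = rl (g1 @ y) by apply/(eqE (gr1 x xr) (gr1 y yr)); exact: ge1.
have e2 : rl (g2 @ x) = rl (g2 @ y) by apply/(eqE (gr2 x xr) (gr2 y yr)); exact: ge2.
split=> h _.
  have [/(ltE nr (gr1 x xr)) h1 /(ltE nr (gr2 x xr)) h2] := h xr.
  by split; [apply/(ltE nr (gr1 y yr)); rewrite -e1|apply/(ltE nr (gr2 y yr)); rewrite -e2].
have [/(ltE nr (gr1 y yr)) h1 /(ltE nr (gr2 y yr)) h2] := h yr.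
by split; [apply/(ltE nr (gr1 x xr)); rewrite e1|apply/(ltE nr (gr2 x xr)); rewrite e2].
Qed.

(** The tags are the centres of a greedy chain. A rational division point is chosen between
    consecutive centres within the overlap of their intervals, and the strict bounds leave a margin
    for larger gauges. *)
Lemma cover_partition (g : fn) : funRpos_M i g -> HBU_M i ->
  exists k c t, [/\ tp_M i k c t, forall j, i j <= i k -> inI_M i (t @ j)
    & forall j, i j <= i k -> rl (t @ j) - rl (g @ (t @ j)) < rl (c @ j)
        /\ rl (c @ (j +n m1)) < rl (t @ j) + rl (g @ (t @ j))].
Proof.
move=> gpos hH; have [[gr _] gp] := gpos; have [k [y [yI hcov]]] := hH g gpos.
have [|lo hlo] := @Rep_fun1 M N T1 (fun j => SUB @ (y @ j) @ (g @ (y @ j))); first by rep.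
have [|up hup] := @Rep_fun1 M N T1 (fun j => ADD @ (y @ j) @ (g @ (y @ j))); first by rep.
have yr j : mlt j k -> isReal (y @ j) by move/yI/inIE => [].
have loE j : mlt j k -> isReal (lo @ j) /\ rl (lo @ j) = rl (y @ j) - rl (g @ (y @ j)).
  by move=> jk; rewrite hlo; apply: sub_rl; [exact: yr|apply: gr; exact: yr].
have upE j : mlt j k -> isReal (up @ j) /\ rl (up @ j) = rl (y @ j) + rl (g @ (y @ j)).
  by move=> jk; rewrite hup; apply: add_rl; [exact: yr|apply: gr; exact: yr].
have gp0 j : mlt j k -> 0 < rl (g @ (y @ j)).
  by move=> jk; rewrite -zero_rl; apply/(ltE zero_real (gr _ (yr j jk))); apply: gp; exact: yr.
have [|||m [s [sk lo0 up1 hstep]]] := @greedy_chain k y lo up.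
- by move=> j jk; split; [exact: yr|case: (loE j jk)|case: (upE j jk)].
- move=> j jk; rewrite (loE j jk).2 (upE j jk).2; have h := gp0 j jk.
  by have /inIE [_ h'] := yI j jk; split=> //; nlra.
- move=> x xr x01; have [j [jk [l [u [hl [hu [h1 h2]]]]]]] := hcov x ((inIE x).2 (conj xr x01)).
  have [lr el] := isDiff_rl hi hf (yr j jk) (gr _ (yr j jk)) hl.
  have [ur eu] := isSum_rl hi hf (yr j jk) (gr _ (yr j jk)) hu.
  exists j; split=> //; rewrite (loE j jk).2 (upE j jk).2 -el -eu.
  by apply/andP; split; [exact/(ltE lr xr)|exact/(ltE xr ur)].
(* Codes of the division points: 0 first, 1 last, and overlap points in between. Positions beyond
   [m +n m1] are unconstrained. *)
pose P n v := (n = m0 -> v = mqcode m0 m0 m0) /\ (n = m +n m1 -> v = mqcode m1 m0 m0) /\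
  forall j, n = j +n m1 -> mlt j m -> ltR (y @ (s @ j)) (cst v) /\ ltR (lo @ (s @ (j +n m1))) (cst v) /\
     ltR (cst v) (y @ (s @ (j +n m1))) /\ ltR (cst v) (up @ (s @ j)).
have S_neq0 (j : num) : j +n m1 <> m0.
  by move=> e; have := congr1 i e; rewrite !iE; have := i_ge0 hi j; nlra.
have S_inj (a b : num) : a +n m1 = b +n m1 -> a = b.
  by move=> e; have := congr1 i e; rewrite !iE => /addIr /(re_inj hi).
have sk1 j : i j < i m -> mlt (s @ (j +n m1)) k.
  by move=> jm; apply: sk; rewrite !iE; exact: i_succ_le.
have [ds hds] : exists ds : dom M T1, forall n, P n (ds @ n).
  apply: arith_choice_fun; first by rewrite /P; arith hi.
  move=> n; case: (pred_ex n) => [->|[j ->]].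
    by exists (mqcode m0 m0 m0); split=> //; split=> [/esym /S_neq0|j /esym /S_neq0].
  case: (ltgtP (i j) (i m)) => jm.
  - have [h1 h2] := hstep j jm; have jm' : i j <= i m by exact: ltW.
    have a1 := yr _ (sk j jm'); have a2 := yr _ (sk1 j jm).
    have [b1 be1] := upE _ (sk j jm'); have [b2 be2] := loE _ (sk1 j jm).
    have p1 := gp0 _ (sk j jm'); have p2 := gp0 _ (sk1 j jm).
    (* The maximum is below the minimum because centres increase, consecutive intervals overlap, and
       each centre is inside its own interval. *)
    have [|q /andP []] := fr_dense_in hf (x := Num.max (rl (y @ (s @ j))) (rl (lo @ (s @ (j +n m1)))))
      (y := Num.min (rl (y @ (s @ (j +n m1)))) (rl (up @ (s @ j)))).
      by rewrite gt_max !lt_min; apply/andP; split; apply/andP; split; nlra.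
    rewrite gt_max lt_min => /andP [h3 h4] /andP [h5 h6].
    have [v /(cst_real hi hf) [vr ve]] := isq_surj hi q.
    exists v; split=> [/S_neq0 //|]; split=> [/S_inj ej|j' /S_inj <- _].
      by move: jm; rewrite ej ltxx.
    by do 3?split; apply/ltE => //; rewrite ve.
  - exists m0; split=> [/S_neq0 //|]; split=> [/S_inj ej|j' /S_inj <- /(re_lt hi)].
      by move: jm; rewrite ej ltxx.
    by rewrite ltNge ltW.
  - exists (mqcode m1 m0 m0); split=> [/S_neq0 //|]; split=> // j' /S_inj <- /(re_lt hi).
    by rewrite jm ltxx.
have [|c hc] := @Rep_fun1 M N T1 (fun n => cst (ds @ n)); first by rep.
have [|t ht] := @Rep_fun1 M N T1 (fun j => y @ (s @ j)); first by rep.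
have c0 : c @ m0 = zeroM by rewrite hc (hds m0).1.
have c1 : c @ (m +n m1) = oneM by rewrite hc (hds _).2.1.
have inner j : i j < i m -> isReal (c @ (j +n m1)) /\
    [/\ rl (t @ j) < rl (c @ (j +n m1)), rl (lo @ (s @ (j +n m1))) < rl (c @ (j +n m1)),
        rl (c @ (j +n m1)) < rl (t @ (j +n m1)) & rl (c @ (j +n m1)) < rl (up @ (s @ j))].
  move=> jm; have [_ [_ h]] := hds (j +n m1).
  have [h1 [h2 [h3 h4]]] := h j erefl ((re_lt hi _ _).2 jm).
  have vr : isReal (cst (ds @ (j +n m1))) by apply: cst_lt_real; left; exact: h1.
  have jm' : i j <= i m by exact: ltW.
  rewrite hc !ht; split=> //; split; apply/ltE => //; try (by apply: yr; [exact: sk|exact: sk1]).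
  - by apply: yr; exact: sk.
  - by have [] := loE _ (sk1 j jm).
  - by apply: yr; exact: sk1.
  - by have [] := upE _ (sk j jm').
have cr n : i n <= i m + 1 -> isReal (c @ n).
  case: (pred_ex n) => [->|[j ->]]; first by rewrite c0 => _; exact: zero_real.
  rewrite !iE => h; case: (ltgtP (i j) (i m)) => jm; first by case: (inner j jm).
    by move: h; rewrite lerD2r leNgt jm.
  by rewrite (re_inj hi jm) c1; exact: one_real.
have tI j : i j <= i m -> inI_M i (t @ j) by move=> jm; rewrite ht; apply: yI; exact: sk.
have gE j : i j <= i m -> rl (lo @ (s @ j)) = rl (t @ j) - rl (g @ (t @ j)) /\
    rl (up @ (s @ j)) = rl (t @ j) + rl (g @ (t @ j)).
  by move=> jm; rewrite !ht; split; [case: (loE _ (sk j jm))|case: (upE _ (sk j jm))].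
have left_le j : i j <= i m -> [/\ rl (c @ j) <= rl (t @ j), j <> m0 -> rl (c @ j) < rl (t @ j)
    & rl (lo @ (s @ j)) < rl (c @ j)].
  move=> jm; have /inIE [_ /andP [h0 _]] := tI j jm; move: jm h0.
  case: (pred_ex j) => [->|[n ->]]; first by rewrite c0 zero_rl.
  rewrite !iE => jm _; have [|_ [h1 h2 h3 h4]] := inner n; first nlra.
  by split=> //; exact: ltW.
have right_le j : i j <= i m -> [/\ rl (t @ j) <= rl (c @ (j +n m1)),
    i j < i m -> rl (t @ j) < rl (c @ (j +n m1)) & rl (c @ (j +n m1)) < rl (up @ (s @ j))].
  move=> jm; have /inIE [_ /andP [_ h1]] := tI j jm; move: jm h1.
  rewrite le_eqVlt => /orP [/eqP /(re_inj hi) ->|jm _]; first by rewrite c1 one_rl ltxx.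
  by have [_ [h1 h2 h3 h4]] := inner j jm; split=> //; exact: ltW.
exists m, c, t; split=> //; last first.
  move=> j jm; have [e1 e2] := gE j jm; rewrite -e1 -e2.
  by have [_ _ ?] := left_le j jm; have [_ _ ?] := right_le j jm.
split; first by move=> j /nleE; rewrite !iE; exact: cr.
split; first by rewrite c0; apply/eqE => //; exact: zero_real.
split; first by rewrite c1; apply/eqE => //; exact: one_real.
move=> j /nleE jm; have /inIE [tr _] := tI j jm.
have r0 : isReal (c @ j) by apply: cr; nlra.
have r1 : isReal (c @ (j +n m1)) by apply: cr; rewrite !iE; nlra.
have [l1 l2 _] := left_le j jm; have [u1 u2 _] := right_le j jm.
split=> //; split; last by split; apply/leE.
(* The bounds around a tag are strict, except possibly at 0 for the first tag and at 1 for the last.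
   If these coincide, the division points are 0 and 1. *)
apply/(ltE r0 r1); case: (ltgtP (i j) (i m)) => jm'.
- exact: le_lt_trans l1 (u2 jm').
- by move: jm; rewrite leNgt jm'.
case: (pred_ex j) => [j0|[n en]]; last first.
  by apply: lt_le_trans u1; apply: l2; rewrite en; exact: S_neq0.
by rewrite {2}(re_inj hi jm') j0 c0 c1 zero_rl one_rl ltr01.
Qed.

(** The gauge interval is convex, so bounds at the two end points settle all points in between. *)
Lemma fine_of_margin (g h : fn) k c t : tp_M i k c t -> funRpos_M i h ->
  (forall x, isReal x -> rl (g @ x) < rl (h @ x)) ->
  (forall j, i j <= i k -> rl (t @ j) - rl (g @ (t @ j)) < rl (c @ j)
        /\ rl (c @ (j +n m1)) < rl (t @ j) + rl (g @ (t @ j))) ->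
  fine_M i h k c t.
Proof.
move=> tpP [[hr _] _] gh hm j /nleE jk y yr [cy yc]; have [tr _ _] := tp_step tpP jk.
have cr : isReal (c @ j) by apply: (tp_c_real tpP); nlra.
have c1r : isReal (c @ (j +n m1)) by apply: (tp_c_real tpP); rewrite !iE; nlra.
move/(leE cr yr): cy => cy; move/(leE yr c1r): yc => yc.
have [h1 h2] := hm j jk; have h3 := gh _ tr; have hr' := hr _ tr.
have [lr le] := sub_rl tr hr'; have [ur ue] := add_rl tr hr'.
exists (SUB @ (t @ j) @ (h @ (t @ j))), (ADD @ (t @ j) @ (h @ (t @ j))).
split; first exact: SUBP.
split; first exact: ADDP.
by split; apply/leE => //; rewrite ?le ?ue; nlra.
Qed.

(** A Riemann sum is given by a relation with witnesses for lengths, products and partial sums; an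
    internal induction shows that the partial sums agree as reals. The tags have to lie in the unit
    interval, where [h] has real values. *)
Lemma RSum_unique (h : fn) k c t S S' : funI_M i h -> tp_M i k c t ->
  (forall j, i j <= i k -> inI_M i (t @ j)) -> isRSum_M i h k c t S -> isRSum_M i h k c t S' -> rl S = rl S'.
Proof.
move=> [hr _] tpP tI [Sr [s [sr [s0 [sS sk]]]]] [Sr' [s' [sr' [s0' [sS' sk']]]]].
have key : forall j, nle j (k +n m1) -> eqR (s @ j) (s' @ j).
  apply: arith_ind; first by rewrite /nle; arith hi.
    move=> h0; have r := sr _ h0; have r' := sr' _ h0.
    move/(eqE r zero_real): s0 => s0; move/(eqE r' zero_real): s0' => s0'.
    by apply/(eqE r r'); rewrite s0 s0'.
  move=> j IH jk1; have jk : nle j k by move/nleE: jk1; rewrite !iE => h1; apply/nleE; nlra.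
  have jk' : nle j (k +n m1) by apply/nleE; rewrite !iE; move/nleE: jk => h1; nlra.
  move/(eqE (sr _ jk') (sr' _ jk')): (IH jk') => e.
  have hi' := (nleE _ _).1 jk.
  have cr : isReal (c @ j) by apply: (tp_c_real tpP); nlra.
  have c1r : isReal (c @ (j +n m1)) by apply: (tp_c_real tpP); rewrite !iE; nlra.
  have fr : isReal (h @ (t @ j)) by apply: hr; exact: tI.
  have [l [p [u [hl [hp [hu eu]]]]]] := sS j jk.
  have [l' [p' [u' [hl' [hp' [hu' eu']]]]]] := sS' j jk.
  have [lr le] := isDiff_rl hi hf c1r cr hl; have [lr' le'] := isDiff_rl hi hf c1r cr hl'.
  have [pr pe] := isProd_rl hi hf fr lr hp; have [pr' pe'] := isProd_rl hi hf fr lr' hp'.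
  have [ur ue] := isSum_rl hi hf (sr _ jk') pr hu; have [ur' ue'] := isSum_rl hi hf (sr' _ jk') pr' hu'.
  apply/(eqE (sr _ jk1) (sr' _ jk1)).
  move/(eqE (sr _ jk1) ur): eu => ->; move/(eqE (sr' _ jk1) ur'): eu' => ->.
  by rewrite ue ue' pe pe' le le' e.
have kk : nle (k +n m1) (k +n m1) by right.
move/(eqE Sr (sr _ kk)): sk => ->; move/(eqE Sr' (sr' _ kk)): sk' => ->.
by apply/(eqE (sr _ kk) (sr' _ kk)); exact: key.
Qed.

Lemma distltR_rl x y e : isReal x -> isReal y -> isReal e -> distltR_M i x y e -> `|rl x - rl y| < rl e.
Proof.
move=> xr yr er [d [a [hd [ha h]]]]; have [dr de] := isDiff_rl hi hf xr yr hd.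
have [ar ae] := isAbs_rl hi hf dr ha.
by rewrite -de -ae; apply/(ltE ar er).
Qed.

Lemma invc_half (z : F) : 0 < z -> exists n, rl (cst (invc n)) + rl (cst (invc n)) < z.
Proof.
move=> /(fr_dense_in hf) [q /andP [q0 qz]].
have [|n hn] := @invc_small (f (q / 2)).
  by move: q0; rewrite -(f0 hf) !(f_lt hf); lra.
exists n; apply: lt_trans qz.
by have -> : f q = f (q / 2) + f (q / 2); [rewrite -(fr_add hf); congr f; field|lra].
Qed.

Lemma HBU_uniqueness : HBU_M i -> Uniqueness_M i.
Proof.
move=> hH h [hI _] A B [[Ar hA] [Br hB]]; apply/(eqE Ar Br); apply: contrapT => ne.
have z0 : 0 < `|rl A - rl B| by rewrite normr_gt0 subr_eq0; apply/eqP.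
(* The tolerance [1 / (n + 1)] is less than half the distance, so one Riemann sum cannot be that
   close to both integrals. *)
have [n hn] := invc_half z0; have er := (invc_real n).1.
have epos : ltR zeroM (cst (invc n)) by apply/(ltE zero_real er); rewrite zero_rl invc_gt0.
have [g1 [g1pos h1]] := hA _ er epos; have [g2 [g2pos h2]] := hB _ er epos.
have [g [gpos gg]] := common_gauge g1pos g2pos.
have [k [c [t [tpP tI hm]]]] := cover_partition gpos hH.
have f1 : fine_M i g1 k c t by apply: fine_of_margin hm => // x /gg [].
have f2 : fine_M i g2 k c t by apply: fine_of_margin hm => // x /gg [].
have [S1 [hS1 d1]] := h1 k c t tpP f1; have [S2 [hS2 d2]] := h2 k c t tpP f2.
have eS := RSum_unique hI tpP tI hS1 hS2.
have {}d1 := distltR_rl hS1.1 Ar er d1; have {}d2 := distltR_rl hS2.1 Br er d2.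
rewrite -eS in d2; move: hn; rewrite ltNge => /negP; apply; apply: ltW.
by move: d1 d2; rewrite !ltr_norml; nlra.
Qed.

(** For the constant gauge [1 / (n + 1)] an interval of a fine partition has length at most
    [2 / (n + 1) < d]. The mesh has to exist as a real; [argmax] provides the largest length. *)
Lemma riemann_gauge (h : fn) A : RiemannInt_M i h A -> GaugeInt_M i h A.
Proof.
move=> [Ar hA]; split=> // e er epos; have [d [dr [dpos hd]]] := hA e er epos.
have d0 : 0 < rl d by rewrite -zero_rl; apply/(ltE zero_real dr).
have [n hn] := invc_half d0; have nr := (invc_real n).1.
exists (ap (mK T1 T1) (cst (invc n))); split.
  split; last by move=> x _; rewrite K_eq; apply/(ltE zero_real nr); rewrite zero_rl invc_gt0.
  by split=> [x _|x _ y _ _]; rewrite !K_eq //; apply/eqE.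
move=> k c t tpP hfine; apply: hd => //.
have [|l hl] := @Rep_fun1 M N T1 (fun j => SUB @ (c @ (j +n m1)) @ (c @ j)); first by rep.
have cr j : i j <= i k -> isReal (c @ j) by move=> jk; apply: (tp_c_real tpP); nlra.
have c1r j : i j <= i k -> isReal (c @ (j +n m1)).
  by move=> jk; apply: (tp_c_real tpP); rewrite !iE; nlra.
have lD j : i j <= i k -> isDiff_M i (c @ (j +n m1)) (c @ j) (l @ j).
  by move=> jk; rewrite hl; apply: SUBP; [exact: c1r|exact: cr].
have lE j : i j <= i k -> isReal (l @ j) /\ rl (l @ j) = rl (c @ (j +n m1)) - rl (c @ j).
  by move=> jk; apply: (isDiff_rl hi hf (c1r j jk) (cr j jk)); exact: lD.
have ltS j : mlt j (k +n m1) <-> i j <= i k.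
  split=> [/(re_lt hi)|h1]; last by apply/(re_lt hi); rewrite !iE; nlra.
  rewrite !iE leNgt => h1; apply/negP => /(i_succ_le hi) h2; by move: h2; rewrite leNgt h1.
have lr0 j : mlt j (k +n m1) -> isReal (l @ j) by move=> /ltS /lE [].
have k_ex : exists j, mlt j (k +n m1) /\ True by exists k; split=> //; apply/ltS.
have [j [/ltS jk _ jmax]] := argmax (P := fun _ => True) (Arith_const M [:: N] True) lr0 k_ex.
have [lr le] := lE j jk; exists (l @ j); split.
  split=> //; split.
    move=> j' /nleE jk'; exists (l @ j'); split; first exact: lD.
    by apply/leE => //; [case: (lE j' jk')|apply: jmax => //; apply/ltS].
  by exists j; split; [exact/nleE|exists (l @ j); split; [exact: lD|exact/eqE]].
apply/(leE lr dr); rewrite le; have [tr cc _] := tp_step tpP jk.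
have cj := cr j jk; have c1j := c1r j jk.
have [a [b [ha [hb [ac _]]]]] : exists a b,
    isDiff_M i (t @ j) (ap (mK T1 T1) (cst (invc n)) @ (t @ j)) a /\
    isSum_M i (t @ j) (ap (mK T1 T1) (cst (invc n)) @ (t @ j)) b /\ leR a (c @ j) /\ leR (c @ j) b.
  apply: hfine => //; first exact/nleE.
  by split; apply/leE => //; exact: ltW.
have [a' [b' [ha' [hb' [_ cb]]]]] : exists a b,
    isDiff_M i (t @ j) (ap (mK T1 T1) (cst (invc n)) @ (t @ j)) a /\
    isSum_M i (t @ j) (ap (mK T1 T1) (cst (invc n)) @ (t @ j)) b /\
    leR a (c @ (j +n m1)) /\ leR (c @ (j +n m1)) b.
  apply: hfine => //; first exact/nleE.
  by split; apply/leE => //; exact: ltW.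
rewrite K_eq in ha; rewrite K_eq in hb'.
have [ar ae] := isDiff_rl hi hf tr nr ha; have [br be] := isSum_rl hi hf tr nr hb'.
move/(leE ar cj): ac; move/(leE c1j br): cb; rewrite ae be; nlra.
Qed.

Lemma HBU_consistency : HBU_M i -> Consistency_M i.
Proof.
move=> hH h [hI [A hA]]; split; first by exists A; exact: riemann_gauge.
move=> B C [/riemann_gauge hB hC]; apply: (HBU_uniqueness hH (f := h)) => //.
by split=> //; exists B.
Qed.

End SubAdd.
End Equivalence.

Lemma ACA0w_complete (A : form [::]) : (forall M : aca_model, sem (M := M) A tt) -> provable ACA0w A.
Proof.
move=> h; apply: completeness; first exact: ACA0w_closed.
  by move=> r t G; apply: aca_rca; exact: ax_ext.
by move=> M hM; exact: (h (AcaModel hM)).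
Qed.

Lemma equivalences (M : aca_model) :
  (sem (M := M) HBU tt <-> sem (M := M) GaugeUniqueness tt) /\
  (sem (M := M) HBU tt <-> sem (M := M) RiemannGaugeConsistency tt).
Proof.
have [K [i hi]] := rationals_exist M.
have [F [f [lim [fD fM f1 fle [fdense flim]]]]] := completion_exists i m0.
have hf : real_embedding i f lim by split.
have [SUB SUBP] := real_sub hi; have [ADD ADDP] := real_add hi.
rewrite (sem_HBU hi) (sem_Uniqueness hi) (sem_Consistency hi); split; split.
- exact: (HBU_uniqueness hi hf SUBP ADDP).
- exact: (uniqueness_HBU hi hf SUBP ADDP).
- exact: (HBU_consistency hi hf SUBP ADDP).
- exact: (consistency_HBU hi hf SUBP ADDP).
Qed.

Theorem theorem3p20 :
  provable ACA0w (Iff HBU GaugeUniqueness) /\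
  provable ACA0w (Iff HBU RiemannGaugeConsistency).
Proof.
by split; apply: ACA0w_complete => M; have [h1 h2] := equivalences M;
  split; [exact: h1.1|exact: h1.2|exact: h2.1|exact: h2.2].
Qed.
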